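(* For every finite stage, all bounded regions (internal regions) into which the corner toothpick structure and the toothpick structure divide the plane are squares or rectangles. Furthermore, with $\rho(n)$ and $r(n)$ as defined in the context, $\rho(0)=\rho(1)=0$, $\rho(2)=1$, $\rho(3)=2$, and for $k\ge2$, $$ \rho(2^k+i)=\begin{cases} 2^{k-1}-1, & i=0;\\ 2\rho(i)+\rho(i+1), & i=1,\ldots,2^k-3;\\ 2\rho(i)+\rho(i+1)+1, & i=2^k-2;\\ 2\rho(i)+\rho(i+1)+2, & i=2^k-1;\end{cases} $$ and $r(0)=r(1)=r(2)=0$, $r(3)=2$, and for $k\ge 2$, $$ r(2^k+i)=\begin{cases} 2^k-2, & i=0;\\ 4\rho(i), & i=1,\ldots,2^k-2;\\ 4\rho(i)+2, & i=2^k-1.\end{cases} $$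
   Context: A toothpick is a line segment of length $1$ in the plane. An end of a toothpick is exposed if that point is neither an end nor the midpoint of any other toothpick (or half-toothpick) in the structure. The toothpick structure: at stage $1$ place a single toothpick from $(0,-\tfrac12)$ to $(0,\tfrac12)$; at each subsequent stage, for every exposed toothpick end, place a toothpick centered at that end and perpendicular to the toothpick having that end. The corner toothpick structure: no toothpick may cross into the third quadrant $\{x<0,y<0\}$, and toothpicks may touch the negative $x$- or $y$-axis only at their ends; at stage $0$ place a half-toothpick from $(0,0)$ to $(\tfrac12,0)$; at each stage $n\ge1$, for every exposed end, place a perpendicular toothpick centered at that end whenever this respects the restrictions. Let $R(n)$ be the number of internal regions (squares and rectangles, i.e. bounded components of the complement of the union of the toothpicks) in the toothpick structure after $n$ stages and $r(n)=R(n)-R(n-1)$ ($r(0)=0$) the number added at stage $n$; let $\rho(n)$ be the number of squares and rectangles added to the corner structure at stage $n$ (the number of internal regions after stage $n$ minus the number after stage $n-1$).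
   Formalization: For the corner structure, the negative x- and y-axes count as walls along with the toothpicks when internal regions are formed; with the toothpicks alone the structure after stage 2 encloses no bounded region, so ρ(2)=1 would fail. *)

(* Defs.v *)
From HB Require Import structures.
From mathcomp Require Import all_boot all_order all_algebra.
From mathcomp Require Import finmap.
From mathcomp Require Import all_classical all_reals all_analysis.

Import Order.TTheory GRing.Theory Num.Theory.
Import numFieldNormedType.Exports.

Local Open Scope classical_set_scope.
Local Open Scope ring_scope.

(* Axis-parallel segments.  A horizontal or vertical segment of positive length
   has exactly one representation, so [t <> s] below means that the segments
   differ as subsets of the plane. *)
Record segment (R : realType) := Segment
  { horizontal : bool ; midpoint : R * R ; len : R }.
Arguments Segment {R}.
Arguments horizontal {R}.
Arguments midpoint {R}.
Arguments len {R}.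

Definition seg_points {R : realType} (s : segment R) : set (R * R) :=
  [set p | if horizontal s
           then `|p.1 - (midpoint s).1| <= len s / 2 /\ p.2 = (midpoint s).2
           else p.1 = (midpoint s).1 /\ `|p.2 - (midpoint s).2| <= len s / 2].

Definition seg_ends {R : realType} (s : segment R) : set (R * R) :=
  let: (x, y) := midpoint s in
  if horizontal s
  then [set (x - len s / 2, y); (x + len s / 2, y)]
  else [set (x, y - len s / 2); (x, y + len s / 2)].

Definition exposed_end {R : realType} (S : set (segment R)) (s : segment R)
    (e : R * R) : Prop :=
  seg_ends s e /\
  forall t, S t -> t <> s -> ~ seg_ends t e /\ e <> midpoint t.

Definition perp_toothpick {R : realType} (s : segment R) (e : R * R) :
    segment R :=
  Segment (~~ horizontal s) e 1.

Definition grow {R : realType} (allowed : set (segment R))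
    (S : set (segment R)) : set (segment R) :=
  S `|` [set t | allowed t /\
         exists s e, [/\ S s, exposed_end S s e & t = perp_toothpick s e]].

(* Stage 0 is the empty plane: the first toothpick is placed at stage 1. *)
Fixpoint toothpick_structure (R : realType) (n : nat) : set (segment R) :=
  match n with
  | 0 => set0
  | 1 => [set Segment false (0, 0) 1]
  | m.+1 => grow setT (toothpick_structure R m)
  end.

Definition third_quadrant (R : realType) : set (R * R) :=
  [set p | p.1 < 0 /\ p.2 < 0].

Definition negative_axes (R : realType) : set (R * R) :=
  [set p | (p.1 < 0 /\ p.2 = 0) \/ (p.1 = 0 /\ p.2 < 0)].

Definition corner_allowed (R : realType) : set (segment R) :=
  [set t | seg_points t `&` third_quadrant R = set0 /\
           seg_points t `&` negative_axes R `<=` seg_ends t].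

Fixpoint corner_structure (R : realType) (n : nat) : set (segment R) :=
  match n with
  | 0 => [set Segment true (4^-1, 0) 2^-1]
  | m.+1 => grow (corner_allowed R) (corner_structure R m)
  end.

Definition covered {R : realType} (S : set (segment R)) : set (R * R) :=
  \bigcup_(s in S) seg_points s.

Definition internal_regions {R : realType} (A : set (R * R)) :
    set (set (R * R)) :=
  [set C | (exists2 p, ~ A p & C = connected_component (~` A) p) /\
           bounded_set C].

Definition toothpick_regions (R : realType) (n : nat) : set (set (R * R)) :=
  internal_regions (covered (toothpick_structure R n)).

(* The corner structure lives outside the excluded third quadrant, whose sides
   (the negative half-axes) act as walls: the square with corners (0,0),
   (1/2,0), (1/2,-1/2), (0,-1/2) is the one region present after stage 2. *)
Definition corner_regions (R : realType) (n : nat) : set (set (R * R)) :=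
  internal_regions (negative_axes R `|` covered (corner_structure R n)).

Definition open_rectangle {R : realType} (C : set (R * R)) : Prop :=
  exists a b c d : R, [/\ a < b, c < d &
    C = [set p | a < p.1 < b /\ c < p.2 < d]].

(* [fset_set] returns the empty set on an infinite set, so the counts below are
   meaningful only when the sets of regions are finite. *)
Definition rho (R : realType) (n : nat) : int :=
  if n is m.+1
  then (#|` fset_set (corner_regions R m.+1)|)%:Z
       - (#|` fset_set (corner_regions R m)|)%:Z
  else (#|` fset_set (corner_regions R 0)|)%:Z.

Definition r (R : realType) (n : nat) : int :=
  if n is m.+1
  then (#|` fset_set (toothpick_regions R m.+1)|)%:Z
       - (#|` fset_set (toothpick_regions R m)|)%:Z
  else 0.

(* Main.v *)
(* A site at the centre of a toothpick determines its direction by parity, and a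
   site becomes a centre one stage after the earlier of the two toothpicks that
   may end there, unless both appear at the same stage.  This rule is solved by
   a self-similar function: when the corner structure has completed a box of
   side about [m] at stage [2 m], three reflected or rotated copies of it, two
   starting at stage [2 m] and one at stage [2 m - 1], grow around the box
   without interacting and complete a box of twice the size at stage [4 m].
   Likewise four copies starting at stage [2 m] grow around a box of the
   toothpick structure.

   The regions are followed through the same recursion, as a list of disjoint
   rectangular rooms with their closing stages: a new box consists of the old
   one, the copies, and four rooms in the gaps between the copies, which give
   the corrections to the recurrences.  A room that is not yet closed opens,
   across its last edge, to a room that closes later or to the outside; hence its
   component is unbounded, and the bounded components are exactly the closed
   rooms. *)

Require Import Defs.
From Stdlib Require Import ZArith Lia.
From HB Require Import structures.
From mathcomp Require Import all_boot all_order all_algebra.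
From mathcomp Require Import finmap.
From mathcomp Require Import all_classical all_reals all_analysis.
From mathcomp Require Import ssrZ zify ring lra.

Import Order.TTheory GRing.Theory Num.Theory.
Import numFieldNormedType.Exports.

Set Implicit Arguments.
Unset Strict Implicit.
Unset Printing Implicit Defensive.

Ltac Zify.zify_post_hook ::= Z.to_euclidean_division_equations.

Local Open Scope Z_scope.

(** * Birth stages of the corner structure *)

(* Lengths are doubled: the site [(x, y)] is the point [(x / 2, y / 2)].  A stage
   is an integer, and [-1] means that the toothpick is never placed. *)

(** The obstacle is to see that the copies do not interact. Where two copies are mirror images
    started together (A and B, and neighbouring copies of the toothpick structure), the two ends
    that can meet on the axis between them are simultaneous and block each other for ever. A and C
    are different: C is rotated and starts one stage earlier, because its corner [(m, 1 - m)] lies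
    on the right side of the box, completed at [2 * m - 1]. C turns its left side towards A, and A
    its bottom side towards C; these are completed one stage apart, which makes up for the different
    starts. So the invariant [corner_sites] records the completion stages of all sides: [2 * m] at
    the top, [2 * m - 1] on the right and left, [2 * m - 2] at the bottom. These values are
    reproduced by doubling, and they also show that a gap closes one stage after the sides of the
    copies around it. The early start of C is the source of the term with index [i + 1] in the
    recurrence for [rho]. It also brings the site [(m, - m)] to birth at stage [2 * m], beyond the
    box completed then; this exception to the rule is why a box describes the corner structure only
    before stage [2 * m]. *)

Definition shift (s t : Z) : Z := if t <? 0 then -1 else t + s.

Lemma shift_off s : shift s (-1) = -1. Proof. by []. Qed.

(* The birth stage of a toothpick when the toothpicks ending at its centre are
   born at stages [p] and [q]: two simultaneous ends block each other for ever. *)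
Definition birth (p q : Z) : Z :=
  if p =? q then -1 else
  if p <? 0 then q + 1 else
  if q <? 0 then p + 1 else Z.min p q + 1.

(** Births after stage [N] are discarded, so that a box can satisfy the rule exactly at the stage
    [N] of its completion. *)
Definition born_by (N p q : Z) : Z := if birth p q <=? N then birth p q else -1.

Ltac case_ifs :=
  repeat match goal with
  | |- context [if ?b then _ else _] => let E := fresh "E" in destruct b eqn:E
  | H : context [if ?b then _ else _] |- _ => let E := fresh "E" in destruct b eqn:E
  end.

Lemma born_byC N p q : -1 <= p -> -1 <= q -> born_by N p q = born_by N q p.
Proof. rewrite /born_by /birth => *; case_ifs; lia. Qed.

Lemma shiftP s t : (t < 0 /\ shift s t = -1) \/ (0 <= t /\ shift s t = t + s).
Proof. rewrite /shift; case_ifs; lia. Qed.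

Lemma born_byP N p q : -1 <= p -> -1 <= q -> exists b : Z,
  ((p = q /\ b = -1) \/ (p = -1 /\ p < q /\ b = q + 1) \/ (q = -1 /\ q < p /\ b = p + 1) \/
   (0 <= p < q /\ b = p + 1) \/ (0 <= q < p /\ b = q + 1)) /\
  ((b <= N /\ born_by N p q = b) \/ (N < b /\ born_by N p q = -1)).
Proof. rewrite /born_by => ? ?; exists (birth p q); rewrite /birth; case_ifs; lia. Qed.

Ltac born_lia :=
  intros;
  repeat match goal with
  | |- context [born_by ?N ?p ?q] =>
      destruct (@born_byP N p q ltac:(lia) ltac:(lia)) as [? ?];
      generalize dependent (born_by N p q); intros
  | H : context [born_by ?N ?p ?q] |- _ =>
      destruct (@born_byP N p q ltac:(lia) ltac:(lia)) as [? ?];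
      generalize dependent (born_by N p q); intros
  | |- context [shift ?s ?t] =>
      pose proof (shiftP s t); generalize dependent (shift s t); intros
  | H : context [shift ?s ?t] |- _ =>
      pose proof (shiftP s t); generalize dependent (shift s t); intros
  end; case_ifs; lia.

(** The rule only compares stages and adds one, so it is invariant under a common delay of the ends
    and of the bound. *)
Lemma shift_rule N s a p q : -1 <= a -> -1 <= p -> -1 <= q -> 0 <= s ->
  a = born_by N p q -> shift s a = born_by (N + s) (shift s p) (shift s q).
Proof.
born_lia.
Qed.

(** A larger bound by one matters only to a child of an end born at stage [N] itself. This serves
    copy C, which completes at [4 * m - 1], one stage before the doubled box. *)
Lemma born_by_succ N p q : -1 <= p -> -1 <= q -> p <> N -> q <> N ->
  born_by (N + 1) p q = born_by N p q.
Proof. born_lia. Qed.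

Lemma born_by_widen N N' p q : -1 <= p < N -> -1 <= q < N -> N <= N' ->
  born_by N p q = born_by N' p q.
Proof. born_lia. Qed.

(** As the child is born by stage [N], the end [p] is born before [N], and a second end born at [N]
    or later comes too late. This protects the sides of the box once copies grow outside of it. *)
Lemma born_by_late N N' p q a : -1 <= p -> -1 <= q -> N <= N' -> 0 <= a ->
  q = -1 \/ N <= q -> a = born_by N p (-1) -> a = born_by N' p q.
Proof. born_lia. Qed.

Lemma born_by_same N p : born_by N p p = -1.
Proof. by rewrite /born_by /birth Z.eqb_refl; case: ifP. Qed.

(* [(m, - m)] is born at time [2 * m], outside of the box completed by then. *)
Definition corner_rule (m : Z) (f : Z -> Z -> Z) : Prop :=
  forall x y, 1 <= x \/ 1 <= y -> ~ (x = m /\ y = - m) ->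
  ((x + y) mod 2 = 0 ->
     f x y = born_by (2 * m) (f x (y - 1)) (f x (y + 1))) /\
  ((x + y) mod 2 = 1 ->
     f x y = born_by (2 * m) (f (x - 1) y) (f (x + 1) y)).

(* [f x y] is the stage at which the toothpick centred at the site [(x, y)] is
   born, in the corner structure at stage [2 * m] for [m] a power of two; the
   half-toothpick is the site [(0, 0)].  As each toothpick is perpendicular to
   its parent, it is horizontal iff [x + y] is even.  At stage [2 * m] the box
   [[2 - m, m] x [1 - m, m]] minus the third quadrant is complete, and its four
   sides are completed at the stages given below. *)
Record corner_sites (m : Z) (f : Z -> Z -> Z) : Prop := {
  cs_m : 2 <= m /\ m mod 2 = 0;
  cs_range : forall x y, -1 <= f x y <= 2 * m;
  cs_origin : f 0 0 = 0;
  cs_supp : forall x y, 0 <= f x y -> (x = 0 /\ y = 0) \/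
    (1 <= f x y /\ 2 - m <= x <= m /\ 1 - m <= y <= m /\ (1 <= x \/ 1 <= y));
  cs_last : forall x y, f x y = 2 * m -> y = m;
  cs_top : forall x, 2 - m <= x <= m ->
    f x m = if x mod 2 =? 0 then 2 * m else -1;
  cs_right : forall y, 1 - m <= y < m ->
    f m y = if y mod 2 =? 0 then -1 else 2 * m - 1;
  cs_left : forall y, 1 <= y < m ->
    f (2 - m) y = if y mod 2 =? 0 then -1 else 2 * m - 1;
  cs_bottom : forall x, 1 <= x < m ->
    f x (1 - m) = if x mod 2 =? 0 then -1 else 2 * m - 2;
  cs_rule : corner_rule m f
}.

(* Around the complete box grow three copies of the corner structure, with the
   sides of the box as walls: from the top right corner at stage [2 * m] (A),
   from the top left corner at stage [2 * m] (B) and from the bottom right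
   corner at stage [2 * m - 1] (C).  The column [x = 1] between A and B and the
   row [y = 0] between A and C stay empty. *)
Definition corner_step (m : Z) (f : Z -> Z -> Z) (x y : Z) : Z :=
  if (2 <=? x) && (1 <=? y) && ~~ ((x <=? m) && (y <=? m)) then
    shift (2 * m) (f (x - m) (y - m))
  else if (x <=? 0) && (1 <=? y) && ~~ ((2 - m <=? x) && (y <=? m)) then
    shift (2 * m) (f (2 - m - x) (y - m))
  else if (1 <=? x) && (y <=? -1) && ~~ ((x <=? m) && (1 - m <=? y)) then
    shift (2 * m - 1) (f (1 - m - y) (x - m))
  else f x y.

(** * One doubling of the corner structure *)

Section CornerStep.
Variables (m : Z) (f : Z -> Z -> Z).
Hypothesis F : corner_sites m f.

Lemma cs_off x y : ~ (x = 0 /\ y = 0) ->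
  (x < 2 - m \/ m < x \/ y < 1 - m \/ m < y \/ (x <= 0 /\ y <= 0)) -> f x y = -1.
Proof.
move=> O H; have := cs_range F x y; have := @cs_supp _ _ F x y.
lia.
Qed.

Lemma step_box x y : (x <= m /\ 2 - m <= x) -> (y <= m /\ 1 - m <= y) ->
  corner_step m f x y = f x y.
Proof. rewrite /corner_step => *; case_ifs; lia. Qed.

Lemma step_third x y : x <= 0 -> y <= 0 -> corner_step m f x y = f x y.
Proof. rewrite /corner_step => *; case_ifs; lia. Qed.

Lemma step_gap_col y : m < y -> corner_step m f 1 y = -1.
Proof. have m2 := cs_m F; move=> ?; have := @cs_off 1 y; rewrite /corner_step => *; case_ifs; lia. Qed.

Lemma step_gap_row x : m < x -> corner_step m f x 0 = -1.
Proof. have m2 := cs_m F; move=> ?; have := @cs_off x 0; rewrite /corner_step => *; case_ifs; lia. Qed.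

(** The formula of the copy extends to the sides of the box that serve as its walls, at sites of one
    parity: there the box has no toothpick and the copy is outside of its support. The corner
    [(m, m)], born at [2 * m], is the origin of the copy. When the rule is checked for a site of the
    copy, its neighbours on the walls have just this parity. *)
Lemma step_A x y : 1 <= x -> 0 <= y -> m <= x \/ m <= y ->
  (y = m -> x < m -> x mod 2 = 1) -> (x = m -> y < m -> y mod 2 = 0) ->
  corner_step m f x y = shift (2 * m) (f (x - m) (y - m)).
Proof.
have m2 := cs_m F; move=> x1 y0 out Hy Hx.
case: (Z.eq_dec x 1) => [?|nx1]; first subst x.
  rewrite [f (1 - m) _]cs_off; [rewrite shift_off|lia|lia].
  case: (Z.eq_dec y m) => [->|?]; last by rewrite step_gap_col; lia.
  by rewrite step_box ?(cs_top F); try lia; rewrite /shift; case_ifs; lia.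
case: (Z.eq_dec y 0) => [?|ny0]; first subst y.
  rewrite [f _ (0 - m)]cs_off; [rewrite shift_off|lia|lia].
  case: (Z.eq_dec x m) => [->|?]; last by rewrite step_gap_row; lia.
  by rewrite step_box ?(cs_right F); try lia; rewrite /shift; case_ifs; lia.
case: (Z_le_gt_dec x m) => xm; last by rewrite /corner_step; case_ifs; lia.
case: (Z_le_gt_dec y m) => ym; last by rewrite /corner_step; case_ifs; lia.
rewrite step_box; [|lia|lia].
have [[-> ->]|[[-> {}xm]|[-> {}ym]]] : x = m /\ y = m \/ y = m /\ x < m \/ x = m /\ y < m by lia.
- by rewrite (cs_top F) ?Z.sub_diag ?(cs_origin F) /shift; case_ifs; lia.
- by rewrite (cs_top F) ?cs_off /shift; try lia; rewrite /shift; case_ifs; lia.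
- by rewrite (cs_right F) ?cs_off /shift; try lia; rewrite /shift; case_ifs; lia.
Qed.

Lemma step_B x y : x <= 1 -> 0 <= y -> (y = 0 -> x < 0) -> x <= 2 - m \/ m <= y ->
  (y = m -> 2 - m < x -> x mod 2 = 1) -> (x = 2 - m -> y < m -> y mod 2 = 0) ->
  corner_step m f x y = shift (2 * m) (f (2 - m - x) (y - m)).
Proof.
have m2 := cs_m F; move=> x1 y0 y0' out Hy Hx.
case: (Z.eq_dec x 1) => [?|nx1]; first subst x.
  rewrite [f (2 - m - 1) _]cs_off; [rewrite shift_off|lia|lia].
  case: (Z.eq_dec y m) => [->|?]; last by rewrite step_gap_col; lia.
  by rewrite step_box ?(cs_top F); try lia; rewrite /shift; case_ifs; lia.
case: (Z.eq_dec y 0) => [?|ny0]; first subst y.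
  rewrite [f _ (0 - m)]cs_off; [rewrite shift_off|lia|lia].
  by rewrite step_third ?cs_off; lia.
case: (Z_le_gt_dec (2 - m) x) => xm; last by rewrite /corner_step; case_ifs; lia.
case: (Z_le_gt_dec y m) => ym; last by rewrite /corner_step; case_ifs; lia.
rewrite step_box; [|lia|lia].
have [[-> ->]|[[-> {}xm]|[-> {}ym]]] : x = 2 - m /\ y = m \/ y = m /\ 2 - m < x \/ x = 2 - m /\ y < m by lia.
- by rewrite (cs_top F) ?Z.sub_diag ?(cs_origin F) /shift; case_ifs; lia.
- by rewrite (cs_top F) ?cs_off /shift; try lia; rewrite /shift; case_ifs; lia.
- by rewrite (cs_left F) ?cs_off /shift; try lia; rewrite /shift; case_ifs; lia.
Qed.

(** The origin of this copy is [(m, 1 - m)], a site of the right side, born at [2 * m - 1]: hence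
    the delay. A rotation exchanges the directions, in accordance with the odd constant in
    [1 - m - y]. *)
Lemma step_C x y : 0 <= x -> y <= 0 -> (x = 0 -> y < 0) -> m <= x \/ y <= 1 - m ->
  (y = 1 - m -> x < m -> x mod 2 = 0) -> (x = m -> 1 - m < y -> y mod 2 = 0) ->
  corner_step m f x y = shift (2 * m - 1) (f (1 - m - y) (x - m)).
Proof.
have m2 := cs_m F; move=> x1 y0 x0' out Hy Hx.
case: (Z.eq_dec x 0) => [?|nx1]; first subst x.
  rewrite [f _ (0 - m)]cs_off; [rewrite shift_off|lia|lia].
  by rewrite step_third ?cs_off; lia.
case: (Z.eq_dec y 0) => [?|ny0]; first subst y.
  rewrite [f (1 - m - 0) _]cs_off; [rewrite shift_off|lia|lia].
  case: (Z.eq_dec x m) => [->|?]; last by rewrite step_gap_row; lia.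
  by rewrite step_box ?(cs_right F); try lia; rewrite /shift; case_ifs; lia.
case: (Z_le_gt_dec x m) => xm; last by rewrite /corner_step; case_ifs; lia.
case: (Z_le_gt_dec (1 - m) y) => ym; last by rewrite /corner_step; case_ifs; lia.
rewrite step_box; [|lia|lia].
have [[-> ->]|[[-> {}xm]|[-> {}ym]]] : x = m /\ y = 1 - m \/ y = 1 - m /\ x < m \/ x = m /\ 1 - m < y by lia.
- by rewrite (cs_right F) ?Z.sub_diag ?(cs_origin F) /shift; try lia; case_ifs; lia.
- by rewrite (cs_bottom F) ?cs_off /shift; try lia; case_ifs; lia.
- by rewrite (cs_right F) ?cs_off /shift; try lia; case_ifs; lia.
Qed.

Lemma step_range x y : -1 <= corner_step m f x y <= 4 * m.
Proof.
have m2 := cs_m F; rewrite /corner_step /shift; case_ifs.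
all: try match goal with |- context [f ?u ?v] => have := cs_range F u v end; lia.
Qed.

Lemma step_supp x y : 0 <= corner_step m f x y -> (x = 0 /\ y = 0) \/
  (1 <= corner_step m f x y /\ 2 - 2 * m <= x <= 2 * m /\
   1 - 2 * m <= y <= 2 * m /\ (1 <= x \/ 1 <= y)).
Proof.
have m2 := cs_m F; rewrite /corner_step /shift; case_ifs.
all: try match goal with |- context [f ?u ?v] => have := @cs_supp _ _ F u v end; lia.
Qed.

Lemma step_last x y : corner_step m f x y = 4 * m -> y = 2 * m.
Proof.
have m2 := cs_m F; rewrite /corner_step /shift; case_ifs.
all: try match goal with |- context [f ?u ?v] =>
  have := @cs_last _ _ F u v; have := cs_range F u v end; lia.
Qed.

(** No site outside of the box is early enough to disturb a side of it. The inequality cannot be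
    strict on the lower rows, since [(m, - m)] is born at [2 * m]. *)
Lemma step_outside x y : (m < x \/ x < 2 - m \/ m < y \/ y < 1 - m) ->
  corner_step m f x y = -1 \/ 2 * m <= corner_step m f x y /\
   (1 <= y -> 2 * m < corner_step m f x y).
Proof.
have m2 := cs_m F; rewrite /corner_step /shift; case_ifs => ?.
all: try match goal with |- context [f ?u ?v] =>
  have := @cs_supp _ _ F u v; have := cs_range F u v end; lia.
Qed.

Lemma step_top x : 2 - 2 * m <= x <= 2 * m ->
  corner_step m f x (2 * m) = if x mod 2 =? 0 then 4 * m else -1.
Proof.
have m2 := cs_m F => ?.
have [?|[->|?]] : 2 <= x \/ x = 1 \/ x <= 0 by lia.
- rewrite step_A; try lia; replace (2 * m - m) with m by lia.
  rewrite (cs_top F) /shift; try lia; case_ifs; lia.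
- rewrite step_gap_col; try lia; case_ifs; lia.
- rewrite step_B; try lia; replace (2 * m - m) with m by lia.
  rewrite (cs_top F) /shift; try lia; case_ifs; lia.
Qed.

Lemma step_right y : 1 - 2 * m <= y < 2 * m ->
  corner_step m f (2 * m) y = if y mod 2 =? 0 then -1 else 4 * m - 1.
Proof.
have m2 := cs_m F => ?.
have [?|[->|?]] : 1 <= y \/ y = 0 \/ y <= -1 by lia.
- rewrite step_A; try lia; replace (2 * m - m) with m by lia.
  rewrite (cs_right F) /shift; try lia; case_ifs; lia.
- rewrite step_gap_row; try lia; case_ifs; lia.
- rewrite step_C; try lia; replace (2 * m - m) with m by lia.
  rewrite (cs_top F) /shift; try lia; case_ifs; lia.
Qed.

Lemma step_left y : 1 <= y < 2 * m ->
  corner_step m f (2 - 2 * m) y = if y mod 2 =? 0 then -1 else 4 * m - 1.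
Proof.
have m2 := cs_m F => ?.
rewrite step_B; try lia; replace (2 - m - (2 - 2 * m)) with m by lia.
rewrite (cs_right F) /shift; try lia; case_ifs; lia.
Qed.

Lemma step_bottom x : 1 <= x < 2 * m ->
  corner_step m f x (1 - 2 * m) = if x mod 2 =? 0 then -1 else 4 * m - 2.
Proof.
have m2 := cs_m F => ?.
rewrite step_C; try lia; replace (1 - m - (1 - 2 * m)) with m by lia.
rewrite (cs_right F) /shift; try lia; case_ifs; lia.
Qed.

(** The row above is the bottom side of A, born at [2 * m - 2] in the copy; the row below is the
    left side of C, born at [2 * m - 1] in the copy. The delays [2 * m] and [2 * m - 1] make them
    simultaneous, which keeps the row [y = 0] empty. *)
Lemma step_mirror_row x : m < x -> x mod 2 = 0 ->
  corner_step m f x (-1) = corner_step m f x 1.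
Proof.
have m2 := cs_m F => ? ?.
rewrite [corner_step m f x 1]step_A; try lia; rewrite step_C; try lia.
replace (1 - m - -1) with (2 - m) by lia.
case: (Z.lt_trichotomy (x - m) m) => [?|[->|?]].
- rewrite (cs_left F) ?(cs_bottom F) /shift; try lia; case_ifs; lia.
- rewrite (cs_top F) ?(cs_right F) /shift; try lia; case_ifs; lia.
- by rewrite !cs_off ?shift_off; lia.
Qed.

Lemma step_mirror_col y : m < y -> corner_step m f 0 y = corner_step m f 2 y.
Proof.
have m2 := cs_m F => ?.
by rewrite [corner_step m f 2 y]step_A; try lia; rewrite step_B; try lia; rewrite Z.sub_0_r.
Qed.

Lemma step_rule_box x y : 2 - m <= x <= m -> 1 - m <= y <= m -> 1 <= x \/ 1 <= y ->
  ((x + y) mod 2 = 0 -> corner_step m f x y =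
     born_by (4 * m) (corner_step m f x (y - 1)) (corner_step m f x (y + 1))) /\
  ((x + y) mod 2 = 1 -> corner_step m f x y =
     born_by (4 * m) (corner_step m f (x - 1) y) (corner_step m f (x + 1) y)).
Proof.
have m2 := cs_m F => xb yb L.
have [H0 H1] := @cs_rule _ _ F x y L ltac:(lia).
have R := cs_range F; have R' := step_range.
have low u v : v < m -> f u v < 2 * m.
  by move=> ?; have := R u v; have := @cs_last _ _ F u v; lia.
split=> par.
- have {H0 H1} := H0 par; rewrite [corner_step m f x y]step_box; try lia.
  have [?|[?|?]] : y = m \/ y = 1 - m \/ 1 - m < y < m by lia.
  + subst y; have ? := step_outside (x := x) (y := m + 1).
    rewrite (cs_off (x := x) (y := m + 1)); try lia.
    rewrite [corner_step m f x (m - 1)]step_box; try lia.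
    have r0 := proj1 (R x (m - 1)); have r1 := proj1 (R' x (m + 1)).
    apply: born_by_late => //; try lia.
    by rewrite (cs_top F); try lia; case_ifs; lia.
  + subst y; have ? := step_outside (x := x) (y := 1 - m - 1).
    rewrite (cs_off (x := x) (y := 1 - m - 1)); try lia.
    rewrite [corner_step m f x (1 - m + 1)]step_box; try lia.
    have r0 := proj1 (R x (1 - m + 1)); have r1 := proj1 (R' x (1 - m - 1)).
    rewrite born_byC // [in X in _ -> X]born_byC //.
    apply: born_by_late => //; try lia.
    by rewrite (cs_bottom F); try lia; case_ifs; lia.
  + have ? : f x (y + 1) < 2 * m.
      have [e|?] : y + 1 = m \/ y + 1 < m by lia.
        by rewrite e (cs_top F); try lia; case_ifs; lia.
      by apply: low; lia.
    have ? := low x (y - 1) ltac:(lia).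
    have := R x (y - 1); have := R x (y + 1) => ? ?.
    by rewrite !step_box; try lia; move=> ->; apply: born_by_widen; lia.
- have {H0 H1} := H1 par; rewrite [corner_step m f x y]step_box; try lia.
  (* Ends born at the last stage [2 * m] occur only on the top row. There the two horizontal
     neighbours are simultaneous and block the site, whatever the bound. *)
  have [?|?] : y = m \/ y < m by lia.
    subst y; have e : f (x - 1) m = f (x + 1) m.
      by rewrite (cs_top F) ?(cs_top F); try lia; case_ifs; lia.
    by rewrite !step_box ?e ?born_by_same; lia.
  have [?|[?|?]] : x = m \/ x = 2 - m \/ 2 - m < x < m by lia.
  + subst x; have ? := step_outside (x := m + 1) (y := y).
    rewrite (cs_off (x := m + 1) (y := y)); try lia.
    rewrite [corner_step m f (m - 1) y]step_box; try lia.
    have r0 := proj1 (R (m - 1) y); have r1 := proj1 (R' (m + 1) y).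
    apply: born_by_late => //; try lia.
    by rewrite (cs_right F); try lia; case_ifs; lia.
  + have [{}L|?] : 1 <= y \/ y <= 0 by lia.
      subst x; have ? := step_outside (x := 2 - m - 1) (y := y).
      rewrite (cs_off (x := 2 - m - 1) (y := y)); try lia.
      rewrite [corner_step m f (2 - m + 1) y]step_box; try lia.
      have r0 := proj1 (R (2 - m + 1) y); have r1 := proj1 (R' (2 - m - 1) y).
      rewrite born_byC // [in X in _ -> X]born_byC //.
      apply: born_by_late => //; try lia.
      by rewrite (cs_left F); try lia; case_ifs; lia.
    lia.
  + have ? := low (x - 1) y ltac:(lia); have ? := low (x + 1) y ltac:(lia).
    have := R (x - 1) y; have := R (x + 1) y => ? ?.
    by rewrite !step_box; try lia; move=> ->; apply: born_by_widen; lia.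
Qed.

Lemma step_rule : corner_rule (2 * m) (corner_step m f).
Proof.
have m2 := cs_m F => x y L ne.
have R := cs_range F.
replace (2 * (2 * m)) with (2 * m + 2 * m) by lia.
have [inbox|out] : (2 - m <= x <= m /\ 1 - m <= y <= m) \/
   ~ (2 - m <= x <= m /\ 1 - m <= y <= m) by lia.
  replace (2 * m + 2 * m) with (4 * m) by lia; apply: step_rule_box; lia.
have [?|[?|[?|[?|?]]]] : 2 <= x /\ 1 <= y \/ x <= 0 /\ 1 <= y \/ 1 <= x /\ y <= -1
    \/ x = 1 /\ 1 <= y \/ 1 <= x /\ y = 0 by lia.
- have [H0 H1] : _ /\ _ := @cs_rule _ _ F (x - m) (y - m) ltac:(lia) ltac:(lia).
  split=> par; rewrite !step_A; try lia; apply: shift_rule; try exact: (proj1 (R _ _)); try lia.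
  + by rewrite H0; [congr (born_by _ (f _ _) (f _ _)); lia|lia].
  + by rewrite H1; [congr (born_by _ (f _ _) (f _ _)); lia|lia].
- have [H0 H1] : _ /\ _ := @cs_rule _ _ F (2 - m - x) (y - m) ltac:(lia) ltac:(lia).
  split=> par; rewrite !step_B; try lia; apply: shift_rule; try exact: (proj1 (R _ _)); try lia.
  + by rewrite H0; [congr (born_by _ (f _ _) (f _ _)); lia|lia].
  + rewrite H1; [|lia].
    rewrite born_byC; try exact: (proj1 (R _ _)).
    by congr (born_by _ (f _ _) (f _ _)); lia.
- have [H0 H1] : _ /\ _ := @cs_rule _ _ F (1 - m - y) (x - m) ltac:(lia) ltac:(lia).
  (* The delay of C gives the rule with a bound smaller by one than required. [born_by_succ] closes
     the difference unless a neighbour is born at the last stage of the copy, which can only be on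
     its top row, here the column [x = 2 * m]. *)
  replace (2 * m + 2 * m) with (2 * m + (2 * m - 1) + 1) by lia.
  split=> par; rewrite !step_C; try lia.
  + have {H0 H1} := H1 ltac:(lia).
    replace (1 - m - (y - 1)) with (1 - m - y + 1) by lia.
    replace (1 - m - (y + 1)) with (1 - m - y - 1) by lia.
    have := R (1 - m - y) (x - m); have := R (1 - m - y + 1) (x - m).
    have := R (1 - m - y - 1) (x - m).
    have := @cs_last _ _ F (1 - m - y + 1) (x - m).
    have := @cs_last _ _ F (1 - m - y - 1) (x - m).
    case: (Z.eq_dec x (2 * m)) => [?|?].
      subst x; replace (2 * m - m) with m by lia.
      move=> _ _ _ _ _ _.
      (* The value [y = - (2 * m)] is the site excluded from the rule; above it the two ends are
         simultaneous or both absent, below it both are absent. *)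
      have [?|?] : - (2 * m) < y \/ y < - (2 * m) by lia.
        rewrite !(cs_top F); try lia.
        by born_lia.
      by rewrite !cs_off; try lia; born_lia.
    move=> T0 T1 R0 R1 R2 E.
    have := shiftP (2 * m - 1) (f (1 - m - y + 1) (x - m)).
    have := shiftP (2 * m - 1) (f (1 - m - y - 1) (x - m)) => S0 S1.
    rewrite born_by_succ; try lia.
    by apply: shift_rule; try lia; rewrite born_byC; lia.
  + have {H0 H1} := H0 ltac:(lia).
    replace (x - 1 - m) with (x - m - 1) by lia.
    replace (x + 1 - m) with (x - m + 1) by lia.
    have := R (1 - m - y) (x - m); have := R (1 - m - y) (x - m - 1).
    have := R (1 - m - y) (x - m + 1).
    (* By parity, such a neighbour on the top row of the copy would be at an odd position, where
       that row is empty. *)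
    have ? : f (1 - m - y) (x - m - 1) <> 2 * m.
      move=> top; have ? := @cs_last _ _ F _ _ top; move: top.
      replace (x - m - 1) with m by lia.
      have [?|?] : 2 - m <= 1 - m - y <= m \/ m < 1 - m - y by lia.
        by rewrite (cs_top F); try lia; case_ifs; lia.
      by rewrite cs_off; lia.
    have ? : f (1 - m - y) (x - m + 1) <> 2 * m.
      move=> top; have ? := @cs_last _ _ F _ _ top; move: top.
      replace (x - m + 1) with m by lia.
      have [?|?] : 2 - m <= 1 - m - y <= m \/ m < 1 - m - y by lia.
        by rewrite (cs_top F); try lia; case_ifs; lia.
      by rewrite cs_off; lia.
    move=> R0 R1 R2 E.
    have := shiftP (2 * m - 1) (f (1 - m - y) (x - m + 1)).
    have := shiftP (2 * m - 1) (f (1 - m - y) (x - m - 1)) => S0 S1.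
    rewrite born_by_succ; try lia.
    by apply: shift_rule; try lia.
- have ? : x = 1 by lia. subst x; split=> par.
  + rewrite step_gap_col; try lia.
    have -> : corner_step m f 1 (y + 1) = -1 by apply: step_gap_col; lia.
    have -> : corner_step m f 1 (y - 1) = -1.
      have [->|?] : y - 1 = m \/ m < y - 1 by lia.
        by rewrite step_box ?(cs_top F); try lia; case_ifs; lia.
      by apply: step_gap_col; lia.
    by born_lia.
  + rewrite step_gap_col; try lia.
    replace (1 - 1) with 0 by lia; replace (1 + 1) with 2 by lia.
    rewrite step_mirror_col; last lia.
    have := step_range 2 y.
    by born_lia.
- have ? : y = 0 by lia. subst y; split=> par.
  + rewrite step_gap_row; try lia.
    replace (0 - 1) with (-1) by lia; replace (0 + 1) with 1 by lia.
    rewrite step_mirror_row; try lia.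
    have := step_range x 1.
    by born_lia.
  + rewrite step_gap_row; try lia.
    have -> : corner_step m f (x + 1) 0 = -1 by apply: step_gap_row; lia.
    have -> : corner_step m f (x - 1) 0 = -1.
      have [->|?] : x - 1 = m \/ m < x - 1 by lia.
        by rewrite step_box ?(cs_right F); try lia; case_ifs; lia.
      by apply: step_gap_row; lia.
    by born_lia.
Qed.

Lemma corner_sites_step : corner_sites (2 * m) (corner_step m f).
Proof.
have m2 := cs_m F.
split; replace (2 * (2 * m)) with (4 * m) by lia.
- lia.
- exact: step_range.
- by rewrite step_box ?(cs_origin F); lia.
- exact: step_supp.
- exact: step_last.
- exact: step_top.
- exact: step_right.
- exact: step_left.
- exact: step_bottom.
- exact: step_rule.
Qed.
End CornerStep.

Definition corner_base (x y : Z) : Z :=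
  if (x =? 0) && (y =? 0) then 0 else
  if (x =? 1) && (y =? 0) then 1 else
  if (x =? 1) && ((y =? 1) || (y =? -1)) then 2 else
  if ((x =? 0) || (x =? 2)) && (y =? 1) || (x =? 2) && (y =? -1) then 3 else
  if ((x =? 0) || (x =? 2)) && (y =? 2) then 4 else -1.

Lemma corner_sites_base : corner_sites 2 corner_base.
Proof.
split.
- lia.
- by move=> x y; rewrite /corner_base; case_ifs; lia.
- by [].
- by move=> x y; rewrite /corner_base; case_ifs; lia.
- by move=> x y; rewrite /corner_base; case_ifs; lia.
- by move=> x y; rewrite /corner_base; case_ifs; lia.
- by move=> x y; rewrite /corner_base; case_ifs; lia.
- by move=> x y; rewrite /corner_base; case_ifs; lia.
- by move=> x y; rewrite /corner_base; case_ifs; lia.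
- move=> x y L ne.
  (* Beyond this window the site and its neighbours are all empty; within it the rule is evaluated
     site by site. *)
  have [out|inb] : (x < -1 \/ 3 < x \/ y < -2 \/ 3 < y) \/ (-1 <= x <= 3 /\ -2 <= y <= 3) by lia.
    have off u v : (u < 0 \/ 2 < u \/ v < -1 \/ 2 < v) -> corner_base u v = -1.
      by rewrite /corner_base => ?; case_ifs; lia.
    by split=> par; rewrite !off //; lia.
  have [?|[?|[?|[?|?]]]] : x = -1 \/ x = 0 \/ x = 1 \/ x = 2 \/ x = 3 by lia.
  all: have [?|[?|[?|[?|[?|?]]]]] : y = -2 \/ y = -1 \/ y = 0 \/ y = 1 \/ y = 2 \/ y = 3 by lia.
  all: subst x y; split=> // par; try lia.
  all: by [].
Qed.

(** * Birth stages of the toothpick structure *)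

Definition tooth_rule (m : Z) (f : Z -> Z -> Z) (x y : Z) : Prop :=
  ((x + y) mod 2 = 0 ->
     f x y = born_by (2 * m) (f (x - 1) y) (f (x + 1) y)) /\
  ((x + y) mod 2 = 1 ->
     f x y = born_by (2 * m) (f x (y - 1)) (f x (y + 1))).

(* Here a toothpick is vertical iff [x + y] is even, and the box
   [[1 - m, m - 1] x [- m, m]] is complete at stage [2 * m]. *)
Record tooth_sites (m : Z) (f : Z -> Z -> Z) : Prop := {
  ts_m : 2 <= m /\ m mod 2 = 0;
  ts_range : forall x y, -1 <= f x y <= 2 * m;
  ts_init : f 0 0 = 1;
  ts_supp : forall x y, 0 <= f x y ->
    1 <= f x y /\ Z.abs x < m /\ Z.abs y <= m /\ (1 < f x y \/ x = 0 /\ y = 0);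
  ts_symx : forall x y, f (- x) y = f x y;
  ts_symy : forall x y, f x (- y) = f x y;
  ts_last : forall x y, f x y = 2 * m -> Z.abs y = m;
  ts_top : forall x, Z.abs x < m -> f x m = if x mod 2 =? 0 then -1 else 2 * m;
  ts_right : forall y, Z.abs y < m ->
    f (m - 1) y = if y mod 2 =? 0 then -1 else 2 * m - 1;
  ts_rule : forall x y, ~ (x = 0 /\ y = 0) -> tooth_rule m f x y
}.

(* Four copies of the corner structure, one in each quadrant. *)
Definition tooth_step (m : Z) (f g : Z -> Z -> Z) (x y : Z) : Z :=
  if (1 <=? Z.abs x) && (1 <=? Z.abs y) && ~~ ((Z.abs x <? m) && (Z.abs y <=? m))
  then shift (2 * m) (g (Z.abs x - (m - 1)) (Z.abs y - m)) else f x y.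

(** * One doubling of the toothpick structure *)

Section ToothStep.
Variables (m : Z) (f g : Z -> Z -> Z).
Hypotheses (F : tooth_sites m f) (G : corner_sites m g).

Lemma ts_off x y : m <= Z.abs x \/ m < Z.abs y -> f x y = -1.
Proof. have := ts_range F x y; have := @ts_supp _ _ F x y; lia. Qed.

Lemma tstep_box x y : Z.abs x < m -> Z.abs y <= m -> tooth_step m f g x y = f x y.
Proof. rewrite /tooth_step => *; case_ifs; lia. Qed.

Lemma tstep_gap_col y : m < Z.abs y -> tooth_step m f g 0 y = -1.
Proof. have := @ts_off 0 y; rewrite /tooth_step => *; case_ifs; lia. Qed.

Lemma tstep_gap_row x : m <= Z.abs x -> tooth_step m f g x 0 = -1.
Proof. have := @ts_off x 0; rewrite /tooth_step => *; case_ifs; lia. Qed.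

Lemma tstep_symx x y : tooth_step m f g (- x) y = tooth_step m f g x y.
Proof. by rewrite /tooth_step Z.abs_opp (ts_symx F). Qed.

Lemma tstep_symy x y : tooth_step m f g x (- y) = tooth_step m f g x y.
Proof. by rewrite /tooth_step Z.abs_opp (ts_symy F). Qed.

(** The corner [(m - 1, m)] of the box is born at [2 * m] and is the origin of the copy. The
    translation by it changes the parity of [x + y], which reconciles the opposite conventions of
    the two structures on directions. *)
Lemma tstep_Q x y : 0 <= x -> 0 <= y -> m - 1 <= x \/ m <= y ->
  (y = m -> x < m - 1 -> x mod 2 = 0) -> (x = m - 1 -> y < m -> y mod 2 = 0) ->
  tooth_step m f g x y = shift (2 * m) (g (x - (m - 1)) (y - m)).
Proof.
have m2 := ts_m F; move=> x0 y0 out Hy Hx.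
case: (Z.eq_dec x 0) => [?|nx]; first subst x.
  rewrite [g _ _](cs_off G); [rewrite shift_off|lia|lia].
  case: (Z.eq_dec y m) => [->|?]; last by rewrite tstep_gap_col; lia.
  by rewrite tstep_box ?(ts_top F); try lia; case_ifs; lia.
case: (Z.eq_dec y 0) => [?|ny]; first subst y.
  rewrite [g _ _](cs_off G); [rewrite shift_off|lia|lia].
  case: (Z.eq_dec x (m - 1)) => [->|?]; last by rewrite tstep_gap_row; lia.
  by rewrite tstep_box ?(ts_right F); try lia; case_ifs; lia.
case: (Z_lt_ge_dec x m) => xm; last by rewrite /tooth_step !Z.abs_eq; try lia; case_ifs; lia.
case: (Z_le_gt_dec y m) => ym; last by rewrite /tooth_step !Z.abs_eq; try lia; case_ifs; lia.
rewrite tstep_box; [|lia|lia].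
have [[-> ->]|[[-> {}xm]|[-> {}ym]]] : x = m - 1 /\ y = m \/ y = m /\ x < m - 1 \/ x = m - 1 /\ y < m by lia.
- by rewrite (ts_top F) ?Z.sub_diag ?(cs_origin G) /shift; try lia; case_ifs; lia.
- by rewrite (ts_top F) ?(cs_off G) /shift; try lia; case_ifs; lia.
- by rewrite (ts_right F) ?(cs_off G) /shift; try lia; case_ifs; lia.
Qed.

Lemma tstep_range x y : -1 <= tooth_step m f g x y <= 4 * m.
Proof.
have m2 := ts_m F; rewrite /tooth_step /shift; case_ifs; try lia.
  by have := cs_range G (Z.abs x - (m - 1)) (Z.abs y - m); lia.
by have := ts_range F x y; lia.
Qed.

Lemma tstep_supp x y : 0 <= tooth_step m f g x y -> 1 <= tooth_step m f g x y /\
  Z.abs x < 2 * m /\ Z.abs y <= 2 * m /\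
  (1 < tooth_step m f g x y \/ x = 0 /\ y = 0).
Proof.
have m2 := ts_m F; rewrite /tooth_step /shift; case_ifs; try lia.
  by have := @cs_supp _ _ G (Z.abs x - (m - 1)) (Z.abs y - m); lia.
by have := @ts_supp _ _ F x y; lia.
Qed.

Lemma tstep_last x y : tooth_step m f g x y = 4 * m -> Z.abs y = 2 * m.
Proof.
have m2 := ts_m F; rewrite /tooth_step /shift; case_ifs; try lia.
  by have := @cs_last _ _ G (Z.abs x - (m - 1)) (Z.abs y - m); lia.
by have := ts_range F x y; lia.
Qed.

Lemma tstep_outside x y : m <= Z.abs x \/ m < Z.abs y ->
  tooth_step m f g x y = -1 \/ 2 * m < tooth_step m f g x y.
Proof.
have m2 := ts_m F; move=> out; rewrite /tooth_step /shift; case_ifs; try lia.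
  by have := @cs_supp _ _ G (Z.abs x - (m - 1)) (Z.abs y - m); lia.
by rewrite ts_off; lia.
Qed.

Lemma tstep_top x : Z.abs x < 2 * m ->
  tooth_step m f g x (2 * m) = if x mod 2 =? 0 then -1 else 4 * m.
Proof.
have m2 := ts_m F => xb.
wlog x0 : x xb / 0 <= x => [H|].
  have [?|?] := Z_le_gt_dec 0 x; first exact: H.
  by rewrite -tstep_symx H; try lia; case_ifs; lia.
case: (Z.eq_dec x 0) => [->|?].
  by rewrite tstep_gap_col; try lia; case_ifs; lia.
rewrite tstep_Q; try lia; replace (2 * m - m) with m by lia.
by rewrite (cs_top G); try lia; born_lia.
Qed.

Lemma tstep_right y : Z.abs y < 2 * m ->
  tooth_step m f g (2 * m - 1) y = if y mod 2 =? 0 then -1 else 4 * m - 1.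
Proof.
have m2 := ts_m F => yb.
wlog y0 : y yb / 0 <= y => [H|].
  have [?|?] := Z_le_gt_dec 0 y; first exact: H.
  by rewrite -tstep_symy H; try lia; case_ifs; lia.
case: (Z.eq_dec y 0) => [->|?].
  by rewrite tstep_gap_row; try lia; case_ifs; lia.
rewrite tstep_Q; try lia; replace (2 * m - 1 - (m - 1)) with m by lia.
by rewrite (cs_right G); try lia; born_lia.
Qed.

Lemma tstep_rule_box x y : 0 <= x < m -> 0 <= y <= m -> ~ (x = 0 /\ y = 0) ->
  tooth_rule (2 * m) (tooth_step m f g) x y.
Proof.
have m2 := ts_m F => xb yb ne.
have [H0 H1] := @ts_rule _ _ F x y ne.
have R := ts_range F; have R' := tstep_range.
have low u v : Z.abs v < m -> f u v < 2 * m.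
  by move=> ?; have := R u v; have := @ts_last _ _ F u v; lia.
split=> par.
- have {H0 H1} := H0 par; rewrite [tooth_step m f g x y]tstep_box; try lia.
  have [?|?] : y = m \/ y < m by lia.
    subst y; have e : f (x - 1) m = f (x + 1) m.
      by rewrite (ts_top F) ?(ts_top F); try lia; case_ifs; lia.
    by rewrite !tstep_box ?e ?born_by_same; lia.
  have [?|?] : x = m - 1 \/ x < m - 1 by lia.
    subst x; have ? := tstep_outside (x := m - 1 + 1) (y := y).
    rewrite (ts_off (x := m - 1 + 1)); try lia.
    rewrite [tooth_step m f g (m - 1 - 1) y]tstep_box; try lia.
    have r0 := proj1 (R (m - 1 - 1) y); have r1 := proj1 (R' (m - 1 + 1) y).
    apply: born_by_late => //; try lia.
    by rewrite (ts_right F); try lia; case_ifs; lia.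
  have ? := low (x - 1) y ltac:(lia); have ? := low (x + 1) y ltac:(lia).
  have := R (x - 1) y; have := R (x + 1) y => ? ?.
  by rewrite !tstep_box; try lia; move=> ->; apply: born_by_widen; lia.
- have {H0 H1} := H1 par; rewrite [tooth_step m f g x y]tstep_box; try lia.
  have [?|?] : y = m \/ y < m by lia.
    subst y; have ? := tstep_outside (x := x) (y := m + 1).
    rewrite (ts_off (y := m + 1)); try lia.
    rewrite [tooth_step m f g x (m - 1)]tstep_box; try lia.
    have r0 := proj1 (R x (m - 1)); have r1 := proj1 (R' x (m + 1)).
    apply: born_by_late => //; try lia.
    by rewrite (ts_top F); try lia; case_ifs; lia.
  have ? : f x (y + 1) < 2 * m.
    have [e|?] : y + 1 = m \/ y + 1 < m by lia.
      by rewrite e (ts_top F); try lia; case_ifs; lia.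
    by apply: low; lia.
  have ? := low x (y - 1) ltac:(lia).
  have := R x (y - 1); have := R x (y + 1) => ? ?.
  by rewrite !tstep_box; try lia; move=> ->; apply: born_by_widen; lia.
Qed.

(** The two symmetries reduce the rule to one quadrant. On an axis outside of the box, the two ends
    that can meet belong to mirror images and are simultaneous or both absent. *)
Lemma tstep_rule x y : ~ (x = 0 /\ y = 0) -> tooth_rule (2 * m) (tooth_step m f g) x y.
Proof.
have m2 := ts_m F.
have S := tstep_range.
wlog x0 : x / 0 <= x => [H|].
  have [?|?] := Z_le_gt_dec 0 x; first exact: H.
  have {}H := H (- x) ltac:(lia) => ne.
  have [H0 H1] := H ltac:(lia); split=> par.
    rewrite -(tstep_symx x) -(tstep_symx (x - 1)) -(tstep_symx (x + 1)) born_byC; try exact: (proj1 (S _ _)).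
    by rewrite H0; [congr (born_by _ (tooth_step _ _ _ _ _) (tooth_step _ _ _ _ _)); lia|lia].
  by rewrite -(tstep_symx x y) -(tstep_symx x (y - 1)) -(tstep_symx x (y + 1)) H1; lia.
wlog y0 : y / 0 <= y => [H|].
  have [?|?] := Z_le_gt_dec 0 y; first exact: H.
  have {}H := H (- y) ltac:(lia) => ne.
  have [H0 H1] := H ltac:(lia); split=> par.
    by rewrite -(tstep_symy x y) -(tstep_symy (x - 1) y) -(tstep_symy (x + 1) y) H0; lia.
  rewrite -(tstep_symy x y) -(tstep_symy x (y - 1)) -(tstep_symy x (y + 1)) born_byC; try exact: (proj1 (S _ _)).
  by rewrite H1; [congr (born_by _ (tooth_step _ _ _ _ _) (tooth_step _ _ _ _ _)); lia|lia].
move=> ne; rewrite /tooth_rule.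
have [inb|out] : (x < m /\ y <= m) \/ (m <= x \/ m < y) by lia.
  by apply: tstep_rule_box; lia.
replace (2 * (2 * m)) with (2 * m + 2 * m) by lia.
have [?|[?|?]] : x = 0 \/ y = 0 \/ 1 <= x /\ 1 <= y by lia.
- subst x; split=> par.
    have := S 1 y; rewrite tstep_gap_col; try lia.
    by rewrite -(tstep_symx (0 - 1)) /=; born_lia.
  rewrite tstep_gap_col; try lia; rewrite [tooth_step m f g 0 (y + 1)]tstep_gap_col; try lia.
  have -> : tooth_step m f g 0 (y - 1) = -1; last by born_lia.
  have [->|?] : y - 1 = m \/ m < y - 1 by lia.
    by rewrite tstep_box ?(ts_top F); try lia; case_ifs; lia.
  by rewrite tstep_gap_col; lia.
- subst y; split=> par.
    rewrite tstep_gap_row; try lia; rewrite [tooth_step m f g (x + 1) 0]tstep_gap_row; try lia.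
    have -> : tooth_step m f g (x - 1) 0 = -1; last by born_lia.
    have [->|?] : x - 1 = m - 1 \/ m <= x - 1 by lia.
      by rewrite tstep_box ?(ts_right F); try lia; case_ifs; lia.
    by rewrite tstep_gap_row; lia.
  have := S x 1; rewrite tstep_gap_row; try lia.
  by rewrite -(tstep_symy x (0 - 1)) /=; born_lia.
- have [H0 H1] : _ /\ _ := @cs_rule _ _ G (x - (m - 1)) (y - m) ltac:(lia) ltac:(lia).
  have R := cs_range G.
  split=> par; rewrite !tstep_Q; try lia; apply: shift_rule; try exact: (proj1 (R _ _)); try lia.
  + by rewrite H1; [congr (born_by _ (g _ _) (g _ _)); lia|lia].
  + by rewrite H0; [congr (born_by _ (g _ _) (g _ _)); lia|lia].
Qed.

Lemma tooth_sites_step : tooth_sites (2 * m) (tooth_step m f g).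
Proof.
have m2 := ts_m F.
split; replace (2 * (2 * m)) with (4 * m) by lia.
- lia.
- exact: tstep_range.
- by rewrite tstep_box ?(ts_init F); lia.
- exact: tstep_supp.
- exact: tstep_symx.
- exact: tstep_symy.
- exact: tstep_last.
- exact: tstep_top.
- exact: tstep_right.
- exact: tstep_rule.
Qed.
End ToothStep.

Definition tooth_base (x y : Z) : Z :=
  if (x =? 0) && (y =? 0) then 1 else
  if (x =? 0) && (Z.abs y =? 1) then 2 else
  if (Z.abs x =? 1) && (Z.abs y =? 1) then 3 else
  if (Z.abs x =? 1) && (Z.abs y =? 2) then 4 else -1.

Lemma tooth_sites_base : tooth_sites 2 tooth_base.
Proof.
split.
- lia.
- by move=> x y; rewrite /tooth_base; case_ifs; lia.
- by [].
- by move=> x y; rewrite /tooth_base; case_ifs; lia.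
- by move=> x y; rewrite /tooth_base; case_ifs; lia.
- by move=> x y; rewrite /tooth_base; case_ifs; lia.
- by move=> x y; rewrite /tooth_base; case_ifs; lia.
- by move=> x y; rewrite /tooth_base; case_ifs; lia.
- by move=> x y; rewrite /tooth_base; case_ifs; lia.
- move=> x y ne.
  have [out|inb] : (x < -2 \/ 2 < x \/ y < -3 \/ 3 < y) \/ (-2 <= x <= 2 /\ -3 <= y <= 3) by lia.
    have off u v : (u < -1 \/ 1 < u \/ v < -2 \/ 2 < v) -> tooth_base u v = -1.
      by rewrite /tooth_base => ?; case_ifs; lia.
    by split=> par; rewrite !off //; lia.
  have [?|[?|[?|[?|?]]]] : x = -2 \/ x = -1 \/ x = 0 \/ x = 1 \/ x = 2 by lia.
  all: have [?|[?|[?|[?|[?|[?|?]]]]]] : y = -3 \/ y = -2 \/ y = -1 \/ y = 0 \/ y = 1 \/ y = 2 \/ y = 3 by lia.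
  all: subst x y; split=> // par; try lia.
  all: by [].
Qed.

(** * Tilings by rooms *)

(* Edges and cells are indexed by their midpoints in doubled site coordinates:
   vertices are (even, even), cells (odd, odd), and edges have odd sum.  Each
   edge lies on the toothpick of exactly one of its ends, the one whose parity
   ([par] tells which) is that of the direction of the edge. *)
Definition edge_time (par : Z) (f : Z -> Z -> Z) (X Y : Z) : Z :=
  if Y mod 2 =? 0 then
    if ((X - 1) / 2 + Y / 2 + par) mod 2 =? 0 then f ((X - 1) / 2) (Y / 2)
    else f ((X - 1) / 2 + 1) (Y / 2)
  else
    if (X / 2 + (Y - 1) / 2 + par) mod 2 =? 0 then f (X / 2) ((Y - 1) / 2 + 1)
    else f (X / 2) ((Y - 1) / 2).

Lemma edge_time_h par f X Y x y : X = 2 * x + 1 -> Y = 2 * y ->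
  edge_time par f X Y = if (x + y + par) mod 2 =? 0 then f x y else f (x + 1) y.
Proof.
move=> -> ->; rewrite /edge_time.
have -> : (2 * x + 1 - 1) / 2 = x by lia.
have -> : (2 * y) / 2 = y by lia.
by have -> : (2 * y) mod 2 =? 0 = true by lia.
Qed.

Lemma edge_time_v par f X Y x y : X = 2 * x -> Y = 2 * y + 1 ->
  edge_time par f X Y = if (x + y + par) mod 2 =? 0 then f x (y + 1) else f x y.
Proof.
move=> -> ->; rewrite /edge_time.
have -> : (2 * y + 1 - 1) / 2 = y by lia.
have -> : (2 * x) / 2 = x by lia.
by have -> : (2 * y + 1) mod 2 =? 0 = false by lia.
Qed.

Lemma odd_sumP X Y : (X + Y) mod 2 = 1 ->
  (exists x y, X = 2 * x + 1 /\ Y = 2 * y) \/ (exists x y, X = 2 * x /\ Y = 2 * y + 1).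
Proof.
move=> H; have [E|E] : X mod 2 = 1 /\ Y mod 2 = 0 \/ X mod 2 = 0 /\ Y mod 2 = 1 by lia.
- by left; exists (X / 2), (Y / 2); lia.
- by right; exists (X / 2), (Y / 2); lia.
Qed.

(* The walls count as edges present from stage 0 on. *)
Definition corner_edge (f : Z -> Z -> Z) (X Y : Z) : Z :=
  if (Y =? 0) && (X <? 0) || (X =? 0) && (Y <? 0) then 0 else edge_time 0 f X Y.

(* [(a, b, c, d, t)]: the rectangle [[a, b] x [c, d]] in site coordinates, closed
   at stage [t]. *)
Definition room := (Z * Z * Z * Z * Z)%type.

Definition time (rm : room) : Z := rm.2.
Definition rect (rm : room) : Z * Z * Z * Z := rm.1.

Definition inside (rm : room) (X Y : Z) : Prop :=
  let: (a, b, c, d, _) := rm in 2 * a < X < 2 * b /\ 2 * c < Y < 2 * d.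

Definition meets (rm : room) (X Y : Z) : Prop :=
  let: (a, b, c, d, _) := rm in 2 * a <= X <= 2 * b /\ 2 * c <= Y <= 2 * d.

Definition proper (rm : room) : Prop :=
  let: (a, b, c, d, _) := rm in a < b /\ c < d.

Definition unit_step (dx dy : Z) : Prop := Z.abs dx + Z.abs dy = 1.

(* [E] gives the birth stages of the edges, [B] is the set of cells that the
   rooms tile, and [N] the stage at which the tiling is complete. *)
Record partial_tiling (B : Z -> Z -> Prop) (N : Z) (E : Z -> Z -> Z) (l : seq room) : Prop := {
  tl_proper : forall rm : room, rm \in l -> proper rm /\ 2 <= time rm <= N;
  tl_sub : forall rm : room, rm \in l -> forall X Y, X mod 2 = 1 -> Y mod 2 = 1 ->
    inside rm X Y -> B X Y;
  tl_boundary : forall rm : room, rm \in l -> forall X Y, (X + Y) mod 2 = 1 ->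
    meets rm X Y -> ~ inside rm X Y -> 0 <= E X Y <= time rm;
  tl_inside : forall rm : room, rm \in l -> forall X Y, (X + Y) mod 2 = 1 ->
    inside rm X Y -> E X Y = -1;
  tl_cover : forall X Y, X mod 2 = 1 -> Y mod 2 = 1 -> B X Y ->
    exists2 rm : room, rm \in l & inside rm X Y;
  tl_uniq : uniq [seq rect rm | rm : room <- l]
}.

(* The last edge of a room separates it from a later room or from the outside
   [~ B], so that an incomplete room communicates with the outside. *)
Definition sealed (B : Z -> Z -> Prop) (E : Z -> Z -> Z) (l : seq room) (rm : room) : Prop :=
  exists X Y dx dy, [/\ X mod 2 = 1, Y mod 2 = 1, unit_step dx dy, inside rm X Y &
    E (X + dx) (Y + dy) = time rm /\
    (~ B (X + 2 * dx) (Y + 2 * dy) \/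
     exists2 rm' : room, rm' \in l &
       inside rm' (X + 2 * dx) (Y + 2 * dy) /\ time rm < time rm')].

Definition tiling B N E l : Prop :=
  partial_tiling B N E l /\ forall rm : room, rm \in l -> sealed B E l rm.

(* An optional exchange of the coordinates, then sign changes, then a translation
   (in site coordinates). *)
Record iso := Iso { iso_swap : bool; iso_nx : bool; iso_ny : bool; iso_x : Z; iso_y : Z }.

Definition neg_if (b : bool) (z : Z) : Z := if b then - z else z.

Definition iso_X (g : iso) (X Y : Z) : Z :=
  neg_if (iso_nx g) (if iso_swap g then Y else X) + 2 * iso_x g.
Definition iso_Y (g : iso) (X Y : Z) : Z :=
  neg_if (iso_ny g) (if iso_swap g then X else Y) + 2 * iso_y g.

Definition move_interval (n : bool) (t : Z) (i : Z * Z) : Z * Z :=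
  if n then (t - i.2, t - i.1) else (i.1 + t, i.2 + t).

Definition move_room (g : iso) (s : Z) (rm : room) : room :=
  let: (a, b, c, d, t) := rm in
  let: (i, j) := if iso_swap g then ((c, d), (a, b)) else ((a, b), (c, d)) in
  (move_interval (iso_nx g) (iso_x g) i, (move_interval (iso_ny g) (iso_y g) j).1,
   (move_interval (iso_ny g) (iso_y g) j).2, t + s).

Ltac room_simpl :=
  cbv beta iota zeta delta [iso_X iso_Y iso_swap iso_nx iso_ny iso_x iso_y neg_if
    move_room move_interval time rect inside meets proper unit_step fst snd].

Ltac cases_lia :=
  intros; repeat match goal with
  | H : _ \/ _ |- _ => destruct H
  | H : _ /\ _ |- _ => destruct H
  end; lia.

Lemma move_room_time g s rm : time (move_room g s rm) = time rm + s.
Proof. by case: g rm => [[] ? ? ? ?] [[[[? ?] ?] ?] ?]. Qed.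

Lemma inside_move g s rm X Y :
  inside (move_room g s rm) (iso_X g X Y) (iso_Y g X Y) <-> inside rm X Y.
Proof.
case: g rm => [[] [] [] u v] [[[[a b] c] d] t]; room_simpl; lia.
Qed.

Lemma meets_move g s rm X Y :
  meets (move_room g s rm) (iso_X g X Y) (iso_Y g X Y) <-> meets rm X Y.
Proof.
case: g rm => [[] [] [] u v] [[[[a b] c] d] t]; room_simpl; lia.
Qed.

Lemma proper_move g s rm : proper (move_room g s rm) <-> proper rm.
Proof.
case: g rm => [[] [] [] u v] [[[[a b] c] d] t]; room_simpl; lia.
Qed.

Lemma move_room_inj g s : injective (fun rm : room => (move_room g s rm)).
Proof.
case: g => [[] [] [] u v] [[[[a b] c] d] t] [[[[a' b'] c'] d'] t']; room_simpl => -[*].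
all: by congr (_, _, _, _, _); lia.
Qed.

Lemma iso_surj g X' Y' : exists X Y, X' = iso_X g X Y /\ Y' = iso_Y g X Y.
Proof.
case: g => sw nx ny u v; room_simpl.
exists (if sw then if ny then 2 * v - Y' else Y' - 2 * v else if nx then 2 * u - X' else X' - 2 * u).
exists (if sw then if nx then 2 * u - X' else X' - 2 * u else if ny then 2 * v - Y' else Y' - 2 * v).
by case: sw; case: nx; case: ny; lia.
Qed.

Lemma iso_parity g X Y : (iso_X g X Y + iso_Y g X Y) mod 2 = (X + Y) mod 2.
Proof. by case: g => [[] [] [] u v]; room_simpl; lia. Qed.

Lemma iso_odd g X Y : X mod 2 = 1 -> Y mod 2 = 1 ->
  iso_X g X Y mod 2 = 1 /\ iso_Y g X Y mod 2 = 1.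
Proof. by case: g => [[] [] [] u v]; room_simpl; lia. Qed.

(** Every edge that meets a room borders a cell of it, so that facts known around the cells of [B]
    apply to all edges of a room. *)
Lemma edge_cell rm X Y : proper rm -> (X + Y) mod 2 = 1 -> meets rm X Y ->
  exists U V dx dy, [/\ U mod 2 = 1, V mod 2 = 1, unit_step dx dy, inside rm U V &
    X = U + dx /\ Y = V + dy].
Proof.
case: rm => [[[[a b] c] d] t]; room_simpl => P par M.
have [[oX eY]|[eX oY]] : X mod 2 = 1 /\ Y mod 2 = 0 \/ X mod 2 = 0 /\ Y mod 2 = 1 by lia.
- have [?|?] : Y < 2 * d \/ Y = 2 * d by lia.
    by exists X, (Y + 1), 0, (-1); split=> //; room_simpl; lia.
  by exists X, (Y - 1), 0, 1; split=> //; room_simpl; lia.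
- have [?|?] : X < 2 * b \/ X = 2 * b by lia.
    by exists (X + 1), Y, (-1), 0; split=> //; room_simpl; lia.
  by exists (X - 1), Y, 1, 0; split=> //; room_simpl; lia.
Qed.

(** * Transport of a tiling by an isometry and a delay *)

Section Move.
Variables (g : iso) (s N : Z) (B : Z -> Z -> Prop) (E E' : Z -> Z -> Z) (l : seq room).
Hypothesis s0 : 0 <= s.
Hypothesis T : partial_tiling B N E l.
(* The second alternative is a wall of the copy, which is [E]-born at stage 0 but
   is an edge born at some earlier stage in the whole structure. *)
Definition agrees_at X Y :=
  E' (iso_X g X Y) (iso_Y g X Y) = shift s (E X Y)
  \/ E X Y = 0 /\ 0 <= E' (iso_X g X Y) (iso_Y g X Y) <= s.
Definition agrees := forall X Y dx dy, X mod 2 = 1 -> Y mod 2 = 1 -> B X Y -> unit_step dx dy ->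
  agrees_at (X + dx) (Y + dy).
Hypothesis A : agrees.

Let agree rm X Y : rm \in l -> (X + Y) mod 2 = 1 -> meets rm X Y -> agrees_at X Y.
Proof.
move=> rml par M; have [P _] := tl_proper T rml.
have [U [V [dx [dy [oU oV u I [-> ->]]]]]] := edge_cell P par M.
by apply: A => //; exact (tl_sub T rml oU oV I).
Qed.

Lemma inside_meets rm X Y : inside rm X Y -> meets rm X Y.
Proof. by case: rm => [[[[a b] c] d] t]; room_simpl; lia. Qed.

Lemma moved_proper rm : rm \in map (move_room g s) l -> proper rm /\ 2 <= time rm <= N + s.
Proof.
case/mapP=> r0 rl ->; rewrite move_room_time; have [P ?] := tl_proper T rl.
by split; [apply/proper_move|lia].
Qed.

Lemma moved_boundary rm : rm \in map (move_room g s) l -> forall X Y, (X + Y) mod 2 = 1 ->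
    meets rm X Y -> ~ inside rm X Y -> 0 <= E' X Y <= time rm.
Proof.
case/mapP=> r0 rl -> X' Y'; have [X [Y [-> ->]]] := iso_surj g X' Y'.
rewrite iso_parity => par /meets_move M I; rewrite move_room_time.
have {}I : ~ inside r0 X Y by move=> H; apply: I; apply/inside_move.
have := tl_boundary T rl par M I.
by have [->|] := agree rl par M; have := tl_proper T rl; have := shiftP s (E X Y); lia.
Qed.

Lemma moved_inside rm : rm \in map (move_room g s) l -> forall X Y, (X + Y) mod 2 = 1 ->
    inside rm X Y -> E' X Y = -1.
Proof.
case/mapP=> r0 rl -> X' Y'; have [X [Y [-> ->]]] := iso_surj g X' Y'.
rewrite iso_parity => par /inside_move I.
have := tl_inside T rl par I.
by have [->|] := agree rl par (inside_meets I); have := shiftP s (E X Y); lia.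
Qed.

(** The last edge of a moved room, described both in the original box ([X], [Y], [dx], [dy]) and in
    the whole structure ([U], [V], [eu], [ev]). The former tells by which side the room leaves its
    box, the latter which room lies beyond. The stage is positive, so the edge is not a wall. *)
Lemma moved_seal rm : rm \in map (move_room g s) l ->
    (forall rm : room, rm \in l -> sealed B E l rm) -> exists X Y dx dy,
    [/\ X mod 2 = 1, Y mod 2 = 1, unit_step dx dy, B X Y &
        0 < E (X + dx) (Y + dy) /\
        exists U V eu ev, [/\ U mod 2 = 1, V mod 2 = 1, unit_step eu ev, inside rm U V &
        [/\ U + 2 * eu = iso_X g (X + 2 * dx) (Y + 2 * dy),
            V + 2 * ev = iso_Y g (X + 2 * dx) (Y + 2 * dy),
            time rm = E (X + dx) (Y + dy) + s, E' (U + eu) (V + ev) = time rm &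
        (~ B (X + 2 * dx) (Y + 2 * dy) \/
         exists2 rm' : room, rm' \in map (move_room g s) l &
           inside rm' (U + 2 * eu) (V + 2 * ev) /\ time rm < time rm')]]].
Proof.
case/mapP=> r0 rl -> S; rewrite move_room_time.
have [X [Y [dx [dy [oX oY u I [Et nx]]]]]] := S _ rl.
have [P tb] := tl_proper T rl.
have BXY := tl_sub T rl oX oY I.
exists X, Y, dx, dy; split=> //; split; first lia.
have [oU oV] := iso_odd g oX oY.
(* The differences are the linear part of [g] applied to [(dx, dy)]. *)
exists (iso_X g X Y), (iso_Y g X Y), (iso_X g (X + dx) (Y + dy) - iso_X g X Y),
  (iso_Y g (X + dx) (Y + dy) - iso_Y g X Y).
have eX : iso_X g X Y + 2 * (iso_X g (X + dx) (Y + dy) - iso_X g X Y)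
  = iso_X g (X + 2 * dx) (Y + 2 * dy).
  by case: (g) => [[] [] [] p q]; room_simpl; lia.
have eY : iso_Y g X Y + 2 * (iso_Y g (X + dx) (Y + dy) - iso_Y g X Y)
  = iso_Y g (X + 2 * dx) (Y + 2 * dy).
  by case: (g) => [[] [] [] p q]; room_simpl; lia.
split=> //.
- by move: u; case: (g) => [[] [] [] p q]; room_simpl; lia.
- by apply/inside_move.
split=> //; first by rewrite Et.
- rewrite !Zplus_minus.
  by have [->|] := A oX oY BXY u; rewrite Et; have := shiftP s (time r0); lia.
case: nx => [?|[r1 r1l [I1 lt]]]; [by left|right].
exists (move_room g s r1); first exact: map_f.
by rewrite move_room_time eX eY; split; [apply/inside_move|lia].
Qed.

Lemma moved_uniq : uniq [seq rect rm | rm : room <- map (move_room g s) l].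
Proof.
have := tl_uniq T; rewrite -map_comp.
elim: (l) => //= r1 l1 IH /andP[n1 /IH ->]; rewrite andbT.
apply: contra n1 => /mapP[r2 r2l e]; apply/mapP; exists r2 => //.
have: move_room g s (rect r1, 0) = move_room g s (rect r2, 0).
  move: e; rewrite /=; case: (r1) (r2) => [[[[a b] c] d] t] [[[[a' b'] c'] d'] t'].
  by case: (g) => [[] ? ? ? ?]; room_simpl => e; congr (_, _).
by move/move_room_inj => -[].
Qed.

Lemma partial_tiling_move (B' : Z -> Z -> Prop) :
  (forall X Y, X mod 2 = 1 -> Y mod 2 = 1 -> B' (iso_X g X Y) (iso_Y g X Y) <-> B X Y) ->
  partial_tiling B' (N + s) E' (map (move_room g s) l).
Proof.
move=> BB; split.
- exact: moved_proper.
- move=> _ /mapP[r0 rl ->] X' Y'; have [X [Y [-> ->]]] := iso_surj g X' Y'.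
  move=> oX oY /inside_move I.
  have [oX' oY'] : X mod 2 = 1 /\ Y mod 2 = 1.
    by move: oX oY; case: (g) => [[] [] [] u v]; room_simpl; lia.
  by apply/BB => //; exact: (tl_sub T rl).
- exact: moved_boundary.
- exact: moved_inside.
- move=> X' Y'; have [X [Y [-> ->]]] := iso_surj g X' Y' => oX oY.
  have [oX' oY'] : X mod 2 = 1 /\ Y mod 2 = 1.
    by move: oX oY; case: (g) => [[] [] [] u v]; room_simpl; lia.
  move/BB => /(_ oX' oY') /(tl_cover T oX' oY')[r0 rl I].
  by exists (move_room g s r0); [exact: map_f|apply/inside_move].
- exact: moved_uniq.
Qed.
End Move.

(** The rectangles remain distinct because a proper one contains a cell, for instance
    [(2 * a + 1, 2 * c + 1)], which would lie in both of the disjoint sets. *)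
Lemma partial_tiling_union B1 B2 N E l1 l2 :
  partial_tiling B1 N E l1 -> partial_tiling B2 N E l2 ->
  (forall X Y, X mod 2 = 1 -> Y mod 2 = 1 -> B1 X Y -> B2 X Y -> False) ->
  partial_tiling (fun X Y => B1 X Y \/ B2 X Y) N E (l1 ++ l2).
Proof.
move=> T1 T2 dis; split.
- by move=> rm; rewrite mem_cat => /orP[/(tl_proper T1)|/(tl_proper T2)].
- move=> rm; rewrite mem_cat => /orP[] rml X Y oX oY I.
  + by left; exact: (tl_sub T1 rml).
  + by right; exact: (tl_sub T2 rml).
- by move=> rm; rewrite mem_cat => /orP[/(tl_boundary T1)|/(tl_boundary T2)].
- by move=> rm; rewrite mem_cat => /orP[/(tl_inside T1)|/(tl_inside T2)].
- move=> X Y oX oY [] BXY.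
  + by have [rm rml I] := tl_cover T1 oX oY BXY; exists rm; rewrite // mem_cat rml.
  + by have [rm rml I] := tl_cover T2 oX oY BXY; exists rm; rewrite // mem_cat rml orbT.
- rewrite map_cat cat_uniq (tl_uniq T1) (tl_uniq T2) andbT /=; apply/hasPn.
  move=> _ /mapP[r2 r2l ->]; apply/mapP => -[r1 r1l e].
  have [P _] := tl_proper T2 r2l.
  have [X [Y [oX oY I2]]] : exists X Y, [/\ X mod 2 = 1, Y mod 2 = 1 & inside r2 X Y].
    move: P; case: (r2) => [[[[a b] c] d] t]; room_simpl => ?.
    by exists (2 * a + 1), (2 * c + 1); split; lia.
  have I1 : inside r1 X Y.
    by move: e I2; case: (r1) (r2) => [[[[? ?] ?] ?] ?] [[[[? ?] ?] ?] ?]; room_simpl => -[-> -> -> ->].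
  by apply: (dis X Y) => //; [exact: (tl_sub T1 r1l)|exact: (tl_sub T2 r2l)].
Qed.

Lemma partial_tiling_ext B B' N N' E l : partial_tiling B N E l -> N <= N' ->
  (forall X Y, X mod 2 = 1 -> Y mod 2 = 1 -> B X Y <-> B' X Y) ->
  partial_tiling B' N' E l.
Proof.
move=> T NN BB; split.
- by move=> rm /(tl_proper T) [? ?]; split; [|lia].
- by move=> rm rml X Y oX oY I; apply/BB => //; exact: (tl_sub T rml).
- exact: tl_boundary T.
- exact: tl_inside T.
- by move=> X Y oX oY /BB BXY; apply: (tl_cover T) => //; exact: BXY.
- exact: tl_uniq T.
Qed.

Lemma partial_tiling_single N E (rm : room) : proper rm -> 2 <= time rm <= N ->
  (forall X Y, (X + Y) mod 2 = 1 -> meets rm X Y -> ~ inside rm X Y -> 0 <= E X Y <= time rm) ->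
  (forall X Y, (X + Y) mod 2 = 1 -> inside rm X Y -> E X Y = -1) ->
  partial_tiling (inside rm) N E [:: rm].
Proof.
move=> P t bd ins; split => //=.
- by move=> _ /[!inE] /eqP ->.
- by move=> _ /[!inE] /eqP ->.
- by move=> _ /[!inE] /eqP ->.
- by move=> _ /[!inE] /eqP ->.
- by move=> X Y _ _ I; exists rm; rewrite ?inE.
Qed.

(** * Rooms of the corner structure *)

Definition corner_box (m : Z) (X Y : Z) : Prop :=
  2 * (2 - m) < X < 2 * m /\ 2 * (1 - m) < Y < 2 * m /\ (0 < X \/ 0 < Y).

Definition iso_A (m : Z) : iso := Iso false false false m m.
Definition iso_B (m : Z) : iso := Iso false true false (2 - m) m.
Definition iso_C (m : Z) : iso := Iso true false true m (1 - m).

(* The rooms in the gaps left by the copies: below the box beside C, between A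
   and C, left of the box below B, and between A and B. *)
Definition room_C (m : Z) : room := (0, 1, 1 - 2 * m, 1 - m, 4 * m - 2).
Definition room_AC (m : Z) : room := (m, 2 * m, -1, 1, 4 * m - 1).
Definition room_B (m : Z) : room := (2 - 2 * m, 2 - m, 0, 1, 4 * m - 1).
Definition room_AB (m : Z) : room := (0, 2, m, 2 * m, 4 * m).

Definition corner_rooms_step (m : Z) (l : seq room) : seq room :=
  l ++ (map (move_room (iso_A m) (2 * m)) l ++ (map (move_room (iso_B m) (2 * m)) l ++
  (map (move_room (iso_C m) (2 * m - 1)) l ++
   ([:: room_C m] ++ ([:: room_AC m] ++ ([:: room_B m] ++ [:: room_AB m])))))).

Lemma corner_edge_h f X Y x y : X = 2 * x + 1 -> Y = 2 * y ->
  corner_edge f X Y = if (y =? 0) && (x <? 0) then 0 else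
    if (x + y) mod 2 =? 0 then f x y else f (x + 1) y.
Proof.
move=> eX eY; rewrite /corner_edge (edge_time_h 0 f eX eY) Z.add_0_r.
by case_ifs; lia.
Qed.

Lemma corner_edge_v f X Y x y : X = 2 * x -> Y = 2 * y + 1 ->
  corner_edge f X Y = if (x =? 0) && (y <? 0) then 0 else
    if (x + y) mod 2 =? 0 then f x (y + 1) else f x y.
Proof.
move=> eX eY; rewrite /corner_edge (edge_time_v 0 f eX eY) Z.add_0_r.
by case_ifs; lia.
Qed.

Lemma corner_box_edges m (P : Z -> Z -> Prop) :
  (forall x y, 2 - m <= x < m -> 1 - m <= y <= m -> 0 <= x \/ 0 <= y ->
     P (2 * x + 1) (2 * y)) ->
  (forall x y, 2 - m <= x <= m -> 1 - m <= y < m -> 0 <= x \/ 0 <= y ->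
     P (2 * x) (2 * y + 1)) ->
  forall X Y dx dy, X mod 2 = 1 -> Y mod 2 = 1 -> corner_box m X Y -> unit_step dx dy ->
  P (X + dx) (Y + dy).
Proof.
rewrite /corner_box /unit_step => Ph Pv X Y dx dy oX oY BXY u.
have [dx0|dy0] : dx = 0 \/ dy = 0 by lia.
- have -> : X + dx = 2 * (X / 2) + 1 by lia.
  have -> : Y + dy = 2 * ((Y + dy) / 2) by lia.
  by apply: Ph; lia.
- have -> : X + dx = 2 * ((X + dx) / 2) by lia.
  have -> : Y + dy = 2 * (Y / 2) + 1 by lia.
  by apply: Pv; lia.
Qed.

Section CornerTiling.
Variables (m : Z) (f : Z -> Z -> Z).
Hypothesis F : corner_sites m f.
Let E := corner_edge f.
Let E' := corner_edge (corner_step m f).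

Lemma agrees_id : agrees (Iso false false false 0 0) 0 (corner_box m) E E'.
Proof.
have m2 := cs_m F; rewrite /E /E'.
apply: (@corner_box_edges m (agrees_at (Iso false false false 0 0) (0) _ _)) => x y xb yb L; rewrite /agrees_at; left; room_simpl.
- rewrite (@corner_edge_h _ _ _ x y) ?(@corner_edge_h f _ _ x y); try lia.
  rewrite !step_box; try lia.
  have := cs_range F x y; have := cs_range F (x + 1) y.
  by case_ifs; born_lia.
- rewrite (@corner_edge_v _ _ _ x y) ?(@corner_edge_v f _ _ x y); try lia.
  rewrite !step_box; try lia.
  have := cs_range F x y; have := cs_range F x (y + 1).
  by case_ifs; born_lia.
Qed.

(** The walls of the copy are the top and right sides of the box, already complete at the starting
    stage [2 * m]; every other edge is a delayed edge of [f]. *)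
Lemma agrees_A : agrees (iso_A m) (2 * m) (corner_box m) E E'.
Proof.
have m2 := cs_m F; rewrite /E /E'.
apply: (@corner_box_edges m (agrees_at (iso_A m) (2 * m) _ _)) => x y xb yb L; rewrite /agrees_at /iso_A /iso_B /iso_C; room_simpl.
- rewrite (@corner_edge_h _ _ _ (x + m) (y + m)) ?(@corner_edge_h f _ _ x y); try lia.
  have [wall|nw] : (y = 0 /\ x < 0) \/ ~ (y = 0 /\ x < 0) by lia.
    right; rewrite !step_box; try lia.
    replace (y + m) with m by lia; rewrite !(cs_top F); try lia.
    by case_ifs; lia.
  left; case_ifs; try lia.
  + by rewrite (step_A F); try lia; congr (shift _ (f _ _)); lia.
  + by rewrite (step_A F); try lia; congr (shift _ (f _ _)); lia.
- rewrite (@corner_edge_v _ _ _ (x + m) (y + m)) ?(@corner_edge_v f _ _ x y); try lia.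
  have [wall|nw] : (x = 0 /\ y < 0) \/ ~ (x = 0 /\ y < 0) by lia.
    right; replace (x + m) with m by lia.
    case_ifs; try lia; rewrite step_box; try lia.
    + have [->|?] : y = -1 \/ y < -1 by lia.
        by rewrite (_ : -1 + m + 1 = m) ?(cs_top F); try lia; case_ifs; lia.
      by rewrite (cs_right F); try lia; case_ifs; lia.
    + by rewrite (cs_right F); try lia; case_ifs; lia.
  left; case_ifs; try lia.
  + by rewrite (step_A F); try lia; congr (shift _ (f _ _)); lia.
  + by rewrite (step_A F); try lia; congr (shift _ (f _ _)); lia.
Qed.

Lemma agrees_B : agrees (iso_B m) (2 * m) (corner_box m) E E'.
Proof.
have m2 := cs_m F; rewrite /E /E'.
apply: (@corner_box_edges m (agrees_at (iso_B m) (2 * m) _ _)) => x y xb yb L; rewrite /agrees_at /iso_A /iso_B /iso_C; room_simpl.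
- rewrite (@corner_edge_h _ _ _ (1 - m - x) (y + m)) ?(@corner_edge_h f _ _ x y); try lia.
  have [wall|nw] : (y = 0 /\ x < 0) \/ ~ (y = 0 /\ x < 0) by lia.
    right; rewrite !step_box; try lia.
    replace (y + m) with m by lia; rewrite !(cs_top F); try lia.
    by case_ifs; lia.
  left; case_ifs; try lia.
  + by rewrite (step_B F); try lia; congr (shift _ (f _ _)); lia.
  + by rewrite (step_B F); try lia; congr (shift _ (f _ _)); lia.
- rewrite (@corner_edge_v _ _ _ (2 - m - x) (y + m)) ?(@corner_edge_v f _ _ x y); try lia.
  have [wall|nw] : (x = 0 /\ y < 0) \/ ~ (x = 0 /\ y < 0) by lia.
    right; replace (2 - m - x) with (2 - m) by lia.
    case_ifs; try lia; rewrite step_box; try lia.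
    + have [->|?] : y = -1 \/ y < -1 by lia.
        by rewrite (_ : -1 + m + 1 = m) ?(cs_top F); try lia; case_ifs; lia.
      by rewrite (cs_left F); try lia; case_ifs; lia.
    + by rewrite (cs_left F); try lia; case_ifs; lia.
  left; case_ifs; try lia.
  + by rewrite (step_B F); try lia; congr (shift _ (f _ _)); lia.
  + by rewrite (step_B F); try lia; congr (shift _ (f _ _)); lia.
Qed.

(** The walls are the right and bottom sides of the box, complete at [2 * m - 1] and [2 * m - 2],
    hence by the earlier start of this copy. *)
Lemma agrees_C : agrees (iso_C m) (2 * m - 1) (corner_box m) E E'.
Proof.
have m2 := cs_m F; rewrite /E /E'.
apply: (@corner_box_edges m (agrees_at (iso_C m) (2 * m - 1) _ _)) => x y xb yb L; rewrite /agrees_at /iso_A /iso_B /iso_C; room_simpl.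
- rewrite (@corner_edge_v _ _ _ (y + m) (- m - x)) ?(@corner_edge_h f _ _ x y); try lia.
  have [wall|nw] : (y = 0 /\ x < 0) \/ ~ (y = 0 /\ x < 0) by lia.
    right; rewrite !step_box; try lia.
    replace (y + m) with m by lia; rewrite !(cs_right F); try lia.
    by case_ifs; lia.
  left; case_ifs; try lia.
  + by rewrite (step_C F); try lia; congr (shift _ (f _ _)); lia.
  + by rewrite (step_C F); try lia; congr (shift _ (f _ _)); lia.
- rewrite (@corner_edge_h _ _ _ (y + m) (1 - m - x)) ?(@corner_edge_v f _ _ x y); try lia.
  have [wall|nw] : (x = 0 /\ y < 0) \/ ~ (x = 0 /\ y < 0) by lia.
    right; replace (1 - m - x) with (1 - m) by lia.
    case_ifs; try lia; rewrite step_box; try lia.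
    + by rewrite (cs_bottom F); try lia; case_ifs; lia.
    + have [->|?] : y = -1 \/ y < -1 by lia.
        by rewrite (_ : -1 + m + 1 = m) ?(cs_right F); try lia; case_ifs; lia.
      by rewrite (cs_bottom F); try lia; case_ifs; lia.
  left; case_ifs; try lia.
  + by rewrite (step_C F); try lia; congr (shift _ (f _ _)); lia.
  + by rewrite (step_C F); try lia; congr (shift _ (f _ _)); lia.
Qed.

(** In this gap, as in the other three, the edges contributed by the box, the walls and the copies
    are complete one stage before the side of the doubled box, which closes the room. Here the
    bottom side of C is complete at [4 * m - 3] and the bottom of the doubled box at [4 * m - 2]. *)
Lemma partial_room_C : partial_tiling (inside (room_C m)) (4 * m) E' [:: room_C m].
Proof.
have m2 := cs_m F; have F' := corner_sites_step F.
have col y : 1 - 2 * m < y <= - m ->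
    corner_step m f 1 y = if y mod 2 =? 0 then 4 * m - 3 else -1.
  move=> ?; rewrite (step_C F); try lia; rewrite (cs_bottom F); try lia.
  by case_ifs; born_lia.
have third y : y < 0 -> corner_step m f 0 y = -1.
  by move=> ?; rewrite (cs_off F'); lia.
apply: partial_tiling_single; rewrite /room_C /E'; room_simpl; try lia.
- move=> X Y /odd_sumP[[x [y [-> ->]]]|[x [y [-> ->]]]] M I.
  + rewrite (@corner_edge_h _ _ _ x y) //; have -> : x = 0 by lia.
    have [->|->] : y = 1 - m \/ y = 1 - 2 * m by lia.
      by rewrite [corner_step m f (0 + 1) _]step_box ?(cs_bottom F); try lia; case_ifs; lia.
    by rewrite (step_bottom F (x := 0 + 1)) ; try lia; case_ifs; lia.
  + rewrite (@corner_edge_v _ _ _ x y) //.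
    have [->|->] : x = 0 \/ x = 1 by lia.
      by case_ifs; lia.
    have [->|?] : y = 1 - 2 * m \/ 1 - 2 * m < y by lia.
      by rewrite col ?(step_bottom F); try lia; case_ifs; lia.
    have [?|?] : y mod 2 = 0 \/ y mod 2 = 1 by lia.
      by rewrite (col y); try lia; case_ifs; lia.
    by rewrite (col (y + 1)); try lia; case_ifs; lia.
- move=> X Y /odd_sumP[[x [y [-> ->]]]|[x [y [-> ->]]]] I; last lia.
  rewrite (@corner_edge_h _ _ _ x y) //; have -> : x = 0 by lia.
  by rewrite third ?(col y); try lia; case_ifs; lia.
Qed.

Lemma partial_room_AC : partial_tiling (inside (room_AC m)) (4 * m) E' [:: room_AC m].
Proof.
have m2 := cs_m F.
have up x : m < x < 2 * m ->
    corner_step m f x 1 = if x mod 2 =? 0 then -1 else 4 * m - 2.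
  move=> ?; rewrite (step_A F); try lia; rewrite (cs_bottom F); try lia.
  by case_ifs; born_lia.
have down x : m < x < 2 * m ->
    corner_step m f x (-1) = if x mod 2 =? 0 then -1 else 4 * m - 2.
  move=> ?; rewrite (step_C F); try lia.
  replace (1 - m - -1) with (2 - m) by lia; rewrite (cs_left F); try lia.
  by case_ifs; born_lia.
have mid x : m <= x -> corner_step m f x 0 = -1.
  move=> ?; have [->|?] : x = m \/ m < x by lia.
    by rewrite step_box ?(cs_right F); try lia; case_ifs; lia.
  by rewrite (step_gap_row F); lia.
apply: partial_tiling_single; rewrite /room_AC /E'; room_simpl; try lia.
- move=> X Y /odd_sumP[[x [y [-> ->]]]|[x [y [-> ->]]]] M I.
  + rewrite (@corner_edge_h _ _ _ x y) //.
    have [?|?] : x mod 2 = 0 \/ x mod 2 = 1 by lia.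
      have [->|->] : y = 1 \/ y = -1 by lia.
        by rewrite (up (x + 1)); try lia; case_ifs; lia.
      by rewrite (down (x + 1)); try lia; case_ifs; lia.
    have [->|->] : y = 1 \/ y = -1 by lia.
      by rewrite (up x); try lia; case_ifs; lia.
    by rewrite (down x); try lia; case_ifs; lia.
  + rewrite (@corner_edge_v _ _ _ x y) //.
    have [->|->] : x = m \/ x = 2 * m by lia.
      have [->|->] : y = -1 \/ y = 0 by lia.
        by rewrite !step_box ?(cs_right F m (y := -1)) ?(cs_right F (y := -1)); try lia; case_ifs; lia.
      by rewrite !step_box ?(cs_right F (y := 0 + 1)); try lia; case_ifs; lia.
    have [->|->] : y = -1 \/ y = 0 by lia.
      by rewrite !(step_right F); try lia; case_ifs; lia.
    by rewrite !(step_right F); try lia; case_ifs; lia.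
- move=> X Y /odd_sumP[[x [y [-> ->]]]|[x [y [-> ->]]]] I.
  + rewrite (@corner_edge_h _ _ _ x y) //; have -> : y = 0 by lia.
    by rewrite !mid; try lia; case_ifs; lia.
  + rewrite (@corner_edge_v _ _ _ x y) //.
    have [->|->] : y = -1 \/ y = 0 by lia.
      by rewrite down ?(mid x); try lia; case_ifs; lia.
    by rewrite up ?(mid x); try lia; case_ifs; lia.
Qed.

Lemma partial_room_B : partial_tiling (inside (room_B m)) (4 * m) E' [:: room_B m].
Proof.
have m2 := cs_m F; have F' := corner_sites_step F.
have row x : 2 - 2 * m < x < 2 - m ->
    corner_step m f x 1 = if x mod 2 =? 0 then -1 else 4 * m - 2.
  move=> ?; rewrite (step_B F); try lia; rewrite (cs_bottom F); try lia.
  by case_ifs; born_lia.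
have third x : x < 0 -> corner_step m f x 0 = -1.
  by move=> ?; rewrite (cs_off F'); lia.
apply: partial_tiling_single; rewrite /room_B /E'; room_simpl; try lia.
- move=> X Y /odd_sumP[[x [y [-> ->]]]|[x [y [-> ->]]]] M I.
  + rewrite (@corner_edge_h _ _ _ x y) //.
    have [->|->] : y = 0 \/ y = 1 by lia.
      by case_ifs; lia.
    have [?|?] : x mod 2 = 0 \/ x mod 2 = 1 by lia.
      by rewrite (row (x + 1)); try lia; case_ifs; lia.
    by rewrite (row x); try lia; case_ifs; lia.
  + rewrite (@corner_edge_v _ _ _ x y) //; have -> : y = 0 by lia.
    have [->|->] : x = 2 - 2 * m \/ x = 2 - m by lia.
      by rewrite (step_left F); try lia; case_ifs; lia.
    by rewrite [corner_step m f (2 - m) (0 + 1)]step_box ?(cs_left F); try lia; case_ifs; lia.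
- move=> X Y /odd_sumP[[x [y [-> ->]]]|[x [y [-> ->]]]] I; first lia.
  rewrite (@corner_edge_v _ _ _ x y) //; have -> : y = 0 by lia.
  by rewrite third ?row; try lia; case_ifs; lia.
Qed.

Lemma partial_room_AB : partial_tiling (inside (room_AB m)) (4 * m) E' [:: room_AB m].
Proof.
have m2 := cs_m F.
have right y : m < y < 2 * m ->
    corner_step m f 2 y = if y mod 2 =? 0 then -1 else 4 * m - 1.
  move=> ?; rewrite (step_A F); try lia; rewrite (cs_left F); try lia.
  by case_ifs; born_lia.
have left y : m < y < 2 * m ->
    corner_step m f 0 y = if y mod 2 =? 0 then -1 else 4 * m - 1.
  by move=> ?; rewrite (step_mirror_col F) ?right; lia.
have mid y : m <= y -> corner_step m f 1 y = -1.
  move=> ?; have [->|?] : y = m \/ m < y by lia.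
    by rewrite step_box ?(cs_top F); try lia; case_ifs; lia.
  by rewrite (step_gap_col F); lia.
apply: partial_tiling_single; rewrite /room_AB /E'; room_simpl; try lia.
- move=> X Y /odd_sumP[[x [y [-> ->]]]|[x [y [-> ->]]]] M I.
  + rewrite (@corner_edge_h _ _ _ x y) //.
    have [->|->] : y = m \/ y = 2 * m by lia.
      rewrite !step_box; try lia; rewrite !(cs_top F); try lia.
      by case_ifs; lia.
    by rewrite !(step_top F); try lia; case_ifs; lia.
  + rewrite (@corner_edge_v _ _ _ x y) //.
    have [->|->] : x = 0 \/ x = 2 by lia.
      have [?|?] : y mod 2 = 0 \/ y mod 2 = 1 by lia.
        by rewrite (left (y + 1)); try lia; case_ifs; lia.
      by rewrite (left y); try lia; case_ifs; lia.
    have [?|?] : y mod 2 = 0 \/ y mod 2 = 1 by lia.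
      by rewrite (right (y + 1)); try lia; case_ifs; lia.
    by rewrite (right y); try lia; case_ifs; lia.
- move=> X Y /odd_sumP[[x [y [-> ->]]]|[x [y [-> ->]]]] I.
  + rewrite (@corner_edge_h _ _ _ x y) //.
    have [->|->] : x = 0 \/ x = 1 by lia.
      by rewrite left ?(mid y); try lia; case_ifs; lia.
    by rewrite right ?(mid y); try lia; case_ifs; lia.
  + rewrite (@corner_edge_v _ _ _ x y) //; have -> : x = 1 by lia.
    by rewrite !mid; try lia; case_ifs; lia.
Qed.

(* The left and bottom sides are completed before the gaps behind them. *)
Lemma corner_exit X Y dx dy : X mod 2 = 1 -> Y mod 2 = 1 -> corner_box m X Y ->
  unit_step dx dy -> 0 < E (X + dx) (Y + dy) -> ~ corner_box m (X + 2 * dx) (Y + 2 * dy) ->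
  [\/ X = 2 * m - 1 /\ dx = 1 /\ dy = 0, Y = 2 * m - 1 /\ dx = 0 /\ dy = 1,
     X = 2 * (2 - m) + 1 /\ dx = -1 /\ dy = 0 /\ 0 < Y /\ E (X + dx) (Y + dy) = 2 * m - 1 |
     Y = 2 * (1 - m) + 1 /\ dx = 0 /\ dy = -1 /\ 0 < X /\ E (X + dx) (Y + dy) = 2 * m - 2].
Proof.
have m2 := cs_m F.
rewrite /corner_box /unit_step /E => oX oY BXY u E0 out.
have [?|[?|[?|?]]] : (dx = 1 /\ dy = 0) \/ (dx = 0 /\ dy = 1) \/ (dx = -1 /\ dy = 0) \/ (dx = 0 /\ dy = -1) by lia.
- by apply: Or41; lia.
- by apply: Or42; lia.
- case: (Z.eq_dec X (2 * (2 - m) + 1)) => [eX|nX].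
    apply: Or43; move: E0.
    rewrite (@corner_edge_v _ _ _ (2 - m) (Y / 2)); try lia.
    have [?|[?|?]] : Y / 2 < 0 \/ (0 <= Y / 2 /\ (Y / 2) mod 2 = 0) \/ (0 <= Y / 2 /\ (Y / 2) mod 2 = 1) by lia.
    + by case_ifs; lia.
    + by rewrite [f _ (Y / 2 + 1)](cs_left F); try lia; case_ifs; lia.
    + by rewrite [f _ (Y / 2)](cs_left F); try lia; case_ifs; lia.
  exfalso; have X1 : X = 1 by lia.
  by move: E0; rewrite X1 (@corner_edge_v _ _ _ 0 (Y / 2)); try lia; case_ifs; lia.
- case: (Z.eq_dec Y (2 * (1 - m) + 1)) => [eY|nY].
    apply: Or44; move: E0.
    rewrite (@corner_edge_h _ _ _ (X / 2) (1 - m)); try lia.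
    have [?|?] : (X / 2) mod 2 = 0 \/ (X / 2) mod 2 = 1 by lia.
    + by rewrite [f (X / 2 + 1) _](cs_bottom F); try lia; case_ifs; lia.
    + by rewrite [f (X / 2) _](cs_bottom F); try lia; case_ifs; lia.
  exfalso; have Y1 : Y = 1 by lia.
  by move: E0; rewrite Y1 (@corner_edge_h _ _ _ (X / 2) 0); try lia; case_ifs; lia.
Qed.
End CornerTiling.

Lemma move_room_id (rm : room) : move_room (Iso false false false 0 0) 0 rm = rm.
Proof.
case: rm => [[[[a b] c] d] t]; room_simpl.
by congr (_, _, _, _, _); lia.
Qed.

Lemma partial_tiling_keep B N E E' l : partial_tiling B N E l ->
  agrees (Iso false false false 0 0) 0 B E E' -> partial_tiling B N E' l.
Proof.
move=> T A; have -> : l = map (move_room (Iso false false false 0 0) 0) l.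
  by rewrite (eq_map move_room_id) map_id.
have := partial_tiling_move (Z.le_refl 0) T A (B' := B).
rewrite Z.add_0_r; apply=> X Y _ _; room_simpl.
by rewrite !Z.add_0_r.
Qed.

Section CornerTilingStep.
Variables (m : Z) (f : Z -> Z -> Z) (l : seq room).
Hypothesis F : corner_sites m f.
Let E := corner_edge f.
Let E' := corner_edge (corner_step m f).
Hypothesis T : tiling (corner_box m) (2 * m) E l.

Let B_A X Y := corner_box m (X - 2 * m) (Y - 2 * m).
Let B_B X Y := corner_box m (2 * (2 - m) - X) (Y - 2 * m).
Let B_C X Y := corner_box m (2 * (1 - m) - Y) (X - 2 * m).

Lemma partial_A : partial_tiling B_A (4 * m) E' (map (move_room (iso_A m) (2 * m)) l).
Proof.
have m2 := cs_m F; replace (4 * m) with (2 * m + 2 * m) by lia.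
apply: (partial_tiling_move _ (proj1 T) (agrees_A F)); first lia.
by move=> X Y oX oY; rewrite /B_A /corner_box /iso_A; room_simpl; lia.
Qed.

Lemma partial_B : partial_tiling B_B (4 * m) E' (map (move_room (iso_B m) (2 * m)) l).
Proof.
have m2 := cs_m F; replace (4 * m) with (2 * m + 2 * m) by lia.
apply: (partial_tiling_move _ (proj1 T) (agrees_B F)); first lia.
by move=> X Y oX oY; rewrite /B_B /corner_box /iso_B; room_simpl; lia.
Qed.

Lemma partial_C : partial_tiling B_C (4 * m) E' (map (move_room (iso_C m) (2 * m - 1)) l).
Proof.
have m2 := cs_m F.
apply: (@partial_tiling_ext B_C _ (2 * m + (2 * m - 1))) => //; last lia.
apply: (partial_tiling_move _ (proj1 T) (agrees_C F)); first lia.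
by move=> X Y oX oY; rewrite /B_C /corner_box /iso_C; room_simpl; lia.
Qed.

Lemma partial_corner_step :
  partial_tiling (corner_box (2 * m)) (4 * m) E' (corner_rooms_step m l).
Proof.
have m2 := cs_m F.
have T0 : partial_tiling (corner_box m) (4 * m) E' l.
  apply: (@partial_tiling_ext (corner_box m) _ (2 * m)) => //; last lia.
  by apply: partial_tiling_keep (proj1 T) _; exact: agrees_id.
(* Each union still awaits the disjointness of its two parts, which is supplied when the next part
   is added. *)
have T1 := partial_tiling_union (partial_room_B F) (partial_room_AB F).
have {}T1 := partial_tiling_union (partial_room_AC F) (T1 ltac:(rewrite /room_AB /room_B; room_simpl; cases_lia)).
have {}T1 := partial_tiling_union (partial_room_C F) (T1 ltac:(rewrite /room_AB /room_B /room_AC; room_simpl; cases_lia)).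
have {}T1 := partial_tiling_union partial_C (T1 ltac:(rewrite /room_AB /room_B /room_AC /room_C; room_simpl; cases_lia)).
have {}T1 := partial_tiling_union partial_B (T1 ltac:(rewrite /B_C /corner_box /room_AB /room_B /room_AC /room_C; room_simpl; cases_lia)).
have {}T1 := partial_tiling_union partial_A (T1 ltac:(rewrite /B_B /B_C /corner_box /room_AB /room_B /room_AC /room_C; room_simpl; cases_lia)).
have {}T1 := partial_tiling_union T0 (T1 ltac:(rewrite /B_A /B_B /B_C /corner_box /room_AB /room_B /room_AC /room_C; room_simpl; cases_lia)).
apply: (partial_tiling_ext (T1 _)); first 2 last.
- move=> X Y oX oY; rewrite /B_A /B_B /B_C /corner_box /room_AB /room_B /room_AC /room_C; room_simpl.
  split; first by cases_lia.
  move=> H.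
  (* The old box, the copies A, B, C, and the gaps C, AC, B, AB, in the order of the union. *)
  have [?|[?|[?|[?|[?|[?|[?|?]]]]]]] : (2 * (2 - m) < X < 2 * m /\ 2 * (1 - m) < Y < 2 * m) \/
    (4 < X /\ 2 < Y /\ (2 * m < X \/ 2 * m < Y)) \/
    (X < 0 /\ 2 < Y /\ (X < 2 * (2 - m) \/ 2 * m < Y)) \/
    (2 < X /\ Y < -2 /\ (2 * m < X \/ Y < 2 * (1 - m))) \/
    (0 < X < 2 /\ Y < 2 * (1 - m)) \/ (2 * m < X /\ -2 < Y < 2) \/
    (X < 2 * (2 - m) /\ 0 < Y < 2) \/ (0 < X < 4 /\ 2 * m < Y).
    have [?|?] : X < 0 \/ 0 < X by lia.
      have [?|?] : Y < 2 \/ 2 < Y by lia.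
        by cases_lia.
      by cases_lia.
    have [?|[?|?]] : Y < -2 \/ -2 < Y < 2 \/ 2 < Y by lia.
    - have [?|?] : X < 2 \/ 2 < X by lia.
        by cases_lia.
      by cases_lia.
    - by cases_lia.
    have [?|?] : X < 4 \/ 4 < X by lia.
      by cases_lia.
    by cases_lia.
  - by left; lia.
  - by right; left; lia.
  - by do 2 right; left; lia.
  - by do 3 right; left; lia.
  - by do 4 right; left; lia.
  - by do 5 right; left; lia.
  - by do 6 right; left; lia.
  - by do 7 right; lia.
- by rewrite /B_A /B_B /B_C /corner_box /room_AB /room_B /room_AC /room_C; room_simpl; lia.
- lia.
Qed.

Let T' := partial_corner_step.
Let S := proj2 T.

Lemma mem_corner_step rm : rm \in corner_rooms_step m l =
  [|| rm \in l, rm \in map (move_room (iso_A m) (2 * m)) l,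
      rm \in map (move_room (iso_B m) (2 * m)) l,
      rm \in map (move_room (iso_C m) (2 * m - 1)) l |
      rm \in [:: room_C m; room_AC m; room_B m; room_AB m]].
Proof. by rewrite /corner_rooms_step !mem_cat. Qed.

(** Rooms close at stage 2 at the earliest, so that even the delay [2 * m - 1] of C leads beyond
    [2 * m]. *)
Lemma corner_step_new rm : rm \in corner_rooms_step m l -> rm \in l \/ 2 * m < time rm.
Proof.
have m2 := cs_m F; rewrite mem_corner_step => /or4P[|||/orP[]]; first by left.
- case/mapP => r0 rl ->; right; rewrite move_room_time; have [_ ?] := tl_proper (proj1 T) rl; lia.
- case/mapP => r0 rl ->; right; rewrite move_room_time; have [_ ?] := tl_proper (proj1 T) rl; lia.
- case/mapP => r0 rl ->; right; rewrite move_room_time; have [_ ?] := tl_proper (proj1 T) rl; lia.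
- by rewrite !inE => /or4P[] /eqP ->; right; rewrite /room_C /room_AC /room_B /room_AB; room_simpl; lia.
Qed.

(** A room that opened to the outside of the old box now opens to some new room, and every new room
    closes after stage [2 * m]. *)
Lemma sealed_old rm : rm \in l -> sealed (corner_box (2 * m)) E' (corner_rooms_step m l) rm.
Proof.
have m2 := cs_m F; move=> rml.
have [X [Y [dx [dy [oX oY u I [Et nx]]]]]] := S rml.
have [_ tb] := tl_proper (proj1 T) rml.
have BXY := tl_sub (proj1 T) rml oX oY I.
exists X, Y, dx, dy; split=> //; split.
  have := agrees_id F oX oY BXY u; rewrite /agrees_at -/E -/E' Et.
  rewrite /iso_X /iso_Y /neg_if /= !Z.add_0_r => -[->|]; last lia.
  by have := shiftP 0 (time rm); lia.
right; case: nx => [out|[rm' rml' I']]; last first.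
  by exists rm' => //; rewrite mem_corner_step rml'.
have E0 : 0 < E (X + dx) (Y + dy) by rewrite Et; lia.
have := corner_exit F oX oY BXY u E0 out => ex.
have [rm' rml' I'] : exists2 rm' : room, rm' \in corner_rooms_step m l &
    inside rm' (X + 2 * dx) (Y + 2 * dy).
  by apply: (tl_cover T'); move: BXY; rewrite /corner_box; case: ex; lia.
exists rm' => //; split=> //.
have [rl|?] := corner_step_new rml'; last lia.
by case: out; apply: (tl_sub (proj1 T) rl) => //; lia.
Qed.

(** Through the right or top side a room leaves the doubled box. Through the left side, at
    [4 * m - 1], it opens to [room_AB], closed at [4 * m]; through the bottom side, at [4 * m - 2],
    to [room_AC], closed at [4 * m - 1]. *)
Lemma sealed_A rm : rm \in map (move_room (iso_A m) (2 * m)) l ->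
  sealed (corner_box (2 * m)) E' (corner_rooms_step m l) rm.
Proof.
have m2 := cs_m F; move=> rml.
have [X [Y [dx [dy [oX oY u BXY [E0]]]]]] :=
  moved_seal (proj1 T) (agrees_A F) rml S.
move=> [U [V [eu [ev [oU oV u' I [eX eY et Ee nx]]]]]].
exists U, V, eu, ev; split=> //; split=> //.
case: nx => [out|[rm' rml' ?]]; last by right; exists rm'; rewrite // mem_corner_step rml' orbT.
have {}eX : U + 2 * eu = X + 2 * dx + 2 * m := eX.
have {}eY : V + 2 * ev = Y + 2 * dy + 2 * m := eY.
have := corner_exit F oX oY BXY u E0 out.
rewrite -/E; move: BXY; rewrite /corner_box => BXY [] ex.
- by left; lia.
- by left; lia.
- right; exists (room_AB m); first by rewrite mem_corner_step !inE eqxx !orbT.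
  by rewrite /room_AB; rewrite et; room_simpl; lia.
- right; exists (room_AC m); first by rewrite mem_corner_step !inE eqxx !orbT.
  by rewrite /room_AC; rewrite et; room_simpl; lia.
Qed.

Lemma sealed_B rm : rm \in map (move_room (iso_B m) (2 * m)) l ->
  sealed (corner_box (2 * m)) E' (corner_rooms_step m l) rm.
Proof.
have m2 := cs_m F; move=> rml.
have [X [Y [dx [dy [oX oY u BXY [E0]]]]]] :=
  moved_seal (proj1 T) (agrees_B F) rml S.
move=> [U [V [eu [ev [oU oV u' I [eX eY et Ee nx]]]]]].
exists U, V, eu, ev; split=> //; split=> //.
case: nx => [out|[rm' rml' ?]]; last by right; exists rm'; rewrite // mem_corner_step rml' !orbT.
have {}eX : U + 2 * eu = - (X + 2 * dx) + 2 * (2 - m) := eX.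
have {}eY : V + 2 * ev = Y + 2 * dy + 2 * m := eY.
have := corner_exit F oX oY BXY u E0 out.
rewrite -/E; move: BXY; rewrite /corner_box => BXY [] ex.
- by left; lia.
- by left; lia.
- right; exists (room_AB m); first by rewrite mem_corner_step !inE eqxx !orbT.
  by rewrite /room_AB; rewrite et; room_simpl; lia.
- right; exists (room_B m); first by rewrite mem_corner_step !inE eqxx !orbT.
  by rewrite /room_B; rewrite et; room_simpl; lia.
Qed.

(** The left side of the copy faces [room_AC], with stages [4 * m - 2] and [4 * m - 1]; its bottom
    side faces [room_C], with stages [4 * m - 3] and [4 * m - 2]. *)
Lemma sealed_C rm : rm \in map (move_room (iso_C m) (2 * m - 1)) l ->
  sealed (corner_box (2 * m)) E' (corner_rooms_step m l) rm.
Proof.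
have m2 := cs_m F; move=> rml.
have [X [Y [dx [dy [oX oY u BXY [E0]]]]]] :=
  moved_seal (proj1 T) (agrees_C F) rml S.
move=> [U [V [eu [ev [oU oV u' I [eX eY et Ee nx]]]]]].
exists U, V, eu, ev; split=> //; split=> //.
case: nx => [out|[rm' rml' ?]]; last by right; exists rm'; rewrite // mem_corner_step rml' !orbT.
have {}eX : U + 2 * eu = Y + 2 * dy + 2 * m := eX.
have {}eY : V + 2 * ev = - (X + 2 * dx) + 2 * (1 - m) := eY.
have := corner_exit F oX oY BXY u E0 out.
rewrite -/E; move: BXY; rewrite /corner_box => BXY [] ex.
- by left; lia.
- by left; lia.
- right; exists (room_AC m); first by rewrite mem_corner_step !inE eqxx !orbT.
  by rewrite /room_AC; rewrite et; room_simpl; lia.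
- right; exists (room_C m); first by rewrite mem_corner_step !inE eqxx !orbT.
  by rewrite /room_C; rewrite et; room_simpl; lia.
Qed.

Lemma corner_tiling_step : tiling (corner_box (2 * m)) (2 * (2 * m)) E' (corner_rooms_step m l).
Proof.
have m2 := cs_m F; replace (2 * (2 * m)) with (4 * m) by lia.
split; first exact: partial_corner_step.
move=> rm; rewrite mem_corner_step => /or4P[|||/orP[]].
- exact: sealed_old.
- exact: sealed_A.
- exact: sealed_B.
- exact: sealed_C.
rewrite !inE /E' => /or4P[] /eqP ->.
- exists 1, (2 * (1 - 2 * m) + 1), 0, (-1).
  split; try lia; [by rewrite /unit_step; lia|by rewrite /room_C; room_simpl; lia|split; last by left; rewrite /corner_box; lia].
  rewrite (@corner_edge_h _ _ _ 0 (1 - 2 * m)); try lia.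
  by rewrite (step_bottom F (x := 0 + 1)); try lia; rewrite /room_C /room_AC /room_B /room_AB; room_simpl; case_ifs; lia.
- exists (4 * m - 1), 1, 1, 0.
  split; try lia; [by rewrite /unit_step; lia|by rewrite /room_AC; room_simpl; lia|split; last by left; rewrite /corner_box; lia].
  rewrite (@corner_edge_v _ _ _ (2 * m) 0); try lia.
  by rewrite !(step_right F); try lia; rewrite /room_C /room_AC /room_B /room_AB; room_simpl; case_ifs; lia.
- exists (2 * (2 - 2 * m) + 1), 1, (-1), 0.
  split; try lia; [by rewrite /unit_step; lia|by rewrite /room_B; room_simpl; lia|split; last by left; rewrite /corner_box; lia].
  rewrite (@corner_edge_v _ _ _ (2 - 2 * m) 0); try lia.
  by rewrite (step_left F (y := 0 + 1)); try lia; rewrite /room_C /room_AC /room_B /room_AB; room_simpl; case_ifs; lia.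
- exists 1, (4 * m - 1), 0, 1.
  split; try lia; [by rewrite /unit_step; lia|by rewrite /room_AB; room_simpl; lia|split; last by left; rewrite /corner_box; lia].
  rewrite (@corner_edge_h _ _ _ 0 (2 * m)); try lia.
  by rewrite !(step_top F); try lia; rewrite /room_C /room_AC /room_B /room_AB; room_simpl; case_ifs; lia.
Qed.
End CornerTilingStep.

Ltac small_cases X lo n :=
  lazymatch n with
  | O => idtac
  | S ?k => destruct (Z.eq_dec X lo) as [?|?];
      [subst X|let lo' := eval compute in (lo + 1) in small_cases X lo' k]
  end.

Ltac small_room := apply: partial_tiling_single; room_simpl; try lia;
  intros X Y; small_cases X (-4) 9%nat; try lia;
  small_cases Y (-4) 9%nat; try lia; by vm_compute; intuition discriminate.

(** The box for [m = 1] has no cells, so the four gap rooms of that value tile the first box by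
    themselves. *)
Definition corner_rooms_base : seq room :=
  [:: room_C 1; room_AC 1; room_B 1; room_AB 1].

Lemma corner_tiling_base :
  tiling (corner_box 2) 4 (corner_edge corner_base) corner_rooms_base.
Proof.
have T1 : partial_tiling (inside (room_C 1)) 4 (corner_edge corner_base) [:: room_C 1].
  by rewrite /room_C; small_room.
have T2 : partial_tiling (inside (room_AC 1)) 4 (corner_edge corner_base) [:: room_AC 1].
  by rewrite /room_AC; small_room.
have T3 : partial_tiling (inside (room_B 1)) 4 (corner_edge corner_base) [:: room_B 1].
  by rewrite /room_B; small_room.
have T4 : partial_tiling (inside (room_AB 1)) 4 (corner_edge corner_base) [:: room_AB 1].
  by rewrite /room_AB; small_room.
have {}T4 := partial_tiling_union T3 (T4).
have {}T4 := partial_tiling_union T2 (T4 ltac:(rewrite /room_AB /room_B; room_simpl; cases_lia)).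
have {}T4 := partial_tiling_union T1 (T4 ltac:(rewrite /room_AB /room_B /room_AC; room_simpl; cases_lia)).
split.
  apply: (partial_tiling_ext (T4 _)) => //.
    by rewrite /room_AB /room_B /room_AC /room_C; room_simpl; lia.
  by move=> X Y oX oY; rewrite /corner_box /room_AB /room_B /room_AC /room_C; room_simpl; lia.
move=> rm; rewrite !inE => /or4P[] /eqP ->.
- by exists 1, (-1), 0, (-1); split=> //; split=> //; left; rewrite /corner_box; lia.
- by exists 3, 1, 1, 0; split=> //; split=> //; left; rewrite /corner_box; lia.
- exists 1, 1, (-1), 0; split=> //; split=> //; left; rewrite /corner_box; lia.
- by exists 1, 3, 0, 1; split=> //; split=> //; left; rewrite /corner_box; lia.
Qed.

(** * Rooms of the toothpick structure *)

Definition tooth_edge : (Z -> Z -> Z) -> Z -> Z -> Z := edge_time 1.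

Definition tooth_box (m : Z) (X Y : Z) : Prop :=
  - (2 * (m - 1)) < X < 2 * (m - 1) /\ - (2 * m) < Y < 2 * m.

Definition iso_Q (m : Z) (nx ny : bool) : iso :=
  Iso false nx ny (neg_if nx (m - 1)) (neg_if ny m).

Definition room_up (m : Z) : room := (-1, 1, m, 2 * m, 4 * m).
Definition room_down (m : Z) : room := (-1, 1, - (2 * m), - m, 4 * m).
Definition room_right (m : Z) : room := (m - 1, 2 * m - 1, -1, 1, 4 * m - 1).
Definition room_left (m : Z) : room := (1 - 2 * m, 1 - m, -1, 1, 4 * m - 1).

Definition tooth_rooms_step (m : Z) (l k : seq room) : seq room :=
  l ++ (map (move_room (iso_Q m false false) (2 * m)) k ++
  (map (move_room (iso_Q m true false) (2 * m)) k ++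
  (map (move_room (iso_Q m false true) (2 * m)) k ++
  (map (move_room (iso_Q m true true) (2 * m)) k ++
   ([:: room_up m] ++ ([:: room_down m] ++ ([:: room_right m] ++ [:: room_left m]))))))).

Definition tooth_rooms_base : seq room :=
  [:: room_up 1; room_down 1; room_right 1; room_left 1].

Lemma tooth_tiling_base :
  tiling (tooth_box 2) 4 (tooth_edge tooth_base) tooth_rooms_base.
Proof.
have T1 : partial_tiling (inside (room_up 1)) 4 (tooth_edge tooth_base) [:: room_up 1].
  by rewrite /room_up; small_room.
have T2 : partial_tiling (inside (room_down 1)) 4 (tooth_edge tooth_base) [:: room_down 1].
  by rewrite /room_down; small_room.
have T3 : partial_tiling (inside (room_right 1)) 4 (tooth_edge tooth_base) [:: room_right 1].
  by rewrite /room_right; small_room.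
have T4 : partial_tiling (inside (room_left 1)) 4 (tooth_edge tooth_base) [:: room_left 1].
  by rewrite /room_left; small_room.
have {}T4 := partial_tiling_union T3 (T4).
have {}T4 := partial_tiling_union T2 (T4 ltac:(rewrite /room_right /room_left; room_simpl; cases_lia)).
have {}T4 := partial_tiling_union T1 (T4 ltac:(rewrite /room_right /room_left /room_down; room_simpl; cases_lia)).
split.
  apply: (partial_tiling_ext (T4 _)) => //.
    by rewrite /room_up /room_right /room_left /room_down; room_simpl; lia.
  by move=> X Y oX oY; rewrite /tooth_box /room_up /room_right /room_left /room_down; room_simpl; lia.
move=> rm; rewrite !inE => /or4P[] /eqP ->.
- by exists 1, 3, 0, 1; split=> //; split=> //; left; rewrite /tooth_box; lia.
- by exists 1, (-3), 0, (-1); split=> //; split=> //; left; rewrite /tooth_box; lia.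
- by exists 1, 1, 1, 0; split=> //; split=> //; left; rewrite /tooth_box; lia.
- by exists (-1), 1, (-1), 0; split=> //; split=> //; left; rewrite /tooth_box; lia.
Qed.

Lemma tooth_edge_h f X Y x y : X = 2 * x + 1 -> Y = 2 * y ->
  tooth_edge f X Y = if (x + y) mod 2 =? 0 then f (x + 1) y else f x y.
Proof.
by move=> eX eY; rewrite /tooth_edge (edge_time_h 1 f eX eY); case_ifs; lia.
Qed.

Lemma tooth_edge_v f X Y x y : X = 2 * x -> Y = 2 * y + 1 ->
  tooth_edge f X Y = if (x + y) mod 2 =? 0 then f x y else f x (y + 1).
Proof.
by move=> eX eY; rewrite /tooth_edge (edge_time_v 1 f eX eY); case_ifs; lia.
Qed.

Section ToothTiling.
Variables (m : Z) (f g : Z -> Z -> Z).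
Hypotheses (F : tooth_sites m f) (G : corner_sites m g).
Let E := tooth_edge f.
Let E' := tooth_edge (tooth_step m f g).

Lemma tooth_edge_symx X Y : (X + Y) mod 2 = 1 -> E' (- X) Y = E' X Y.
Proof.
rewrite /E' => /odd_sumP[[x [y [-> ->]]]|[x [y [-> ->]]]].
- rewrite (@tooth_edge_h _ _ _ (- x - 1) y) ?(@tooth_edge_h _ (2 * x + 1) _ x y); try lia.
  rewrite -(tstep_symx g F (- x - 1)) -(tstep_symx g F (- x - 1 + 1)).
  replace (- (- x - 1)) with (x + 1) by lia.
  replace (- (- x - 1 + 1)) with x by lia.
  by case_ifs; lia.
- rewrite (@tooth_edge_v _ _ _ (- x) y) ?(@tooth_edge_v _ (2 * x) _ x y); try lia.
  by rewrite !(tstep_symx g F); case_ifs; lia.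
Qed.

Lemma tooth_edge_symy X Y : (X + Y) mod 2 = 1 -> E' X (- Y) = E' X Y.
Proof.
rewrite /E' => /odd_sumP[[x [y [-> ->]]]|[x [y [-> ->]]]].
- rewrite (@tooth_edge_h _ _ _ x (- y)) ?(@tooth_edge_h _ _ (2 * y) x y); try lia.
  by rewrite !(tstep_symy g F); case_ifs; lia.
- rewrite (@tooth_edge_v _ _ _ x (- y - 1)) ?(@tooth_edge_v _ _ (2 * y + 1) x y); try lia.
  rewrite -(tstep_symy g F _ (- y - 1)) -(tstep_symy g F _ (- y - 1 + 1)).
  replace (- (- y - 1)) with (y + 1) by lia.
  replace (- (- y - 1 + 1)) with y by lia.
  by case_ifs; lia.
Qed.

Lemma tooth_edge_sym nx ny X Y : (X + Y) mod 2 = 1 ->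
  E' (neg_if nx X) (neg_if ny Y) = E' X Y.
Proof.
case: nx ny => [] [] /= par; rewrite ?tooth_edge_symx ?tooth_edge_symy //; lia.
Qed.

Lemma agrees_tooth_id : agrees (Iso false false false 0 0) 0 (tooth_box m) E E'.
Proof.
have m2 := ts_m F => X Y dx dy oX oY BXY u; left; rewrite /iso_X /iso_Y /neg_if /= !Z.add_0_r.
have : (X + dx + (Y + dy)) mod 2 = 1 by rewrite /unit_step in u; lia.
have : - (2 * (m - 1)) <= X + dx <= 2 * (m - 1) by rewrite /unit_step in u; rewrite /tooth_box in BXY; lia.
have : - (2 * m) <= Y + dy <= 2 * m by rewrite /unit_step in u; rewrite /tooth_box in BXY; lia.
move: (X + dx) (Y + dy) => {BXY}U V Vb Ub.
rewrite /E /E' => /odd_sumP[[x [y [eU eV]]]|[x [y [eU eV]]]].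
- rewrite !(@tooth_edge_h _ U V x y) // !tstep_box; try lia.
  have := ts_range F x y; have := ts_range F (x + 1) y.
  by case_ifs; born_lia.
- rewrite !(@tooth_edge_v _ U V x y) // !tstep_box; try lia.
  have := ts_range F x y; have := ts_range F x (y + 1).
  by case_ifs; born_lia.
Qed.

(** The whole structure is symmetric in both axes, so only the quadrant where the copy is a
    translate has to be treated; there the walls are the top and right sides of the box. *)
Lemma agrees_Q nx ny : agrees (iso_Q m nx ny) (2 * m) (corner_box m) (corner_edge g) E'.
Proof.
have m2 := ts_m F => X Y dx dy oX oY BXY u.
have par : (X + dx + 2 * (m - 1) + (Y + dy + 2 * m)) mod 2 = 1 by rewrite /unit_step in u; lia.
suff : agrees_at (Iso false false false (m - 1) m) (2 * m) (corner_edge g) E' (X + dx) (Y + dy).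
  rewrite /agrees_at; rewrite -(tooth_edge_sym nx ny).
    have -> : neg_if nx (iso_X (Iso false false false (m - 1) m) (X + dx) (Y + dy)) =
       iso_X (iso_Q m nx ny) (X + dx) (Y + dy).
      by case: (nx) (ny) => [] []; rewrite /iso_Q; room_simpl; lia.
    have -> : neg_if ny (iso_Y (Iso false false false (m - 1) m) (X + dx) (Y + dy)) =
       iso_Y (iso_Q m nx ny) (X + dx) (Y + dy).
      by case: (nx) (ny) => [] []; rewrite /iso_Q; room_simpl; lia.
    by [].
  exact: par.
move: X Y dx dy oX oY BXY u {par}.
apply: (@corner_box_edges m (agrees_at _ (2 * m) _ _)) => x y xb yb L; rewrite /agrees_at /E'; room_simpl.
- rewrite (@tooth_edge_h _ _ _ (x + m - 1) (y + m)) ?(@corner_edge_h g _ _ x y); try lia.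
  have [wall|nw] : (y = 0 /\ x < 0) \/ ~ (y = 0 /\ x < 0) by lia.
    right; rewrite !tstep_box; try lia.
    replace (y + m) with m by lia; rewrite !(ts_top F); try lia.
    by case_ifs; lia.
  left; case_ifs; try lia.
  + by rewrite (tstep_Q F G); try lia; congr (shift _ (g _ _)); lia.
  + by rewrite (tstep_Q F G); try lia; congr (shift _ (g _ _)); lia.
- rewrite (@tooth_edge_v _ _ _ (x + m - 1) (y + m)) ?(@corner_edge_v g _ _ x y); try lia.
  have [wall|nw] : (x = 0 /\ y < 0) \/ ~ (x = 0 /\ y < 0) by lia.
    right; replace (x + m - 1) with (m - 1) by lia.
    case_ifs; try lia; rewrite tstep_box; try lia.
    + by rewrite (ts_right F); try lia; case_ifs; lia.
    + have [->|?] : y = -1 \/ y < -1 by lia.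
        by rewrite (_ : -1 + m + 1 = m) ?(ts_top F); try lia; case_ifs; lia.
      by rewrite (ts_right F); try lia; case_ifs; lia.
  left; case_ifs; try lia.
  + by rewrite (tstep_Q F G); try lia; congr (shift _ (g _ _)); lia.
  + by rewrite (tstep_Q F G); try lia; congr (shift _ (g _ _)); lia.
Qed.

Lemma partial_room_up : partial_tiling (inside (room_up m)) (4 * m) E' [:: room_up m].
Proof.
have m2 := ts_m F.
have side y : m < y < 2 * m ->
    tooth_step m f g 1 y = if y mod 2 =? 0 then -1 else 4 * m - 1.
  move=> ?; rewrite (tstep_Q F G); try lia; replace (1 - (m - 1)) with (2 - m) by lia.
  by rewrite (cs_left G); try lia; case_ifs; born_lia.
have side' y : m < y < 2 * m ->
    tooth_step m f g (-1) y = if y mod 2 =? 0 then -1 else 4 * m - 1.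
  by move=> /side <-; rewrite -(tstep_symx g F 1).
have mid y : m <= y -> tooth_step m f g 0 y = -1.
  move=> ?; have [->|?] : y = m \/ m < y by lia.
    by rewrite tstep_box ?(ts_top F); try lia; case_ifs; lia.
  by rewrite (tstep_gap_col _ F); lia.
apply: partial_tiling_single; rewrite /room_up /E'; room_simpl; try lia.
- move=> X Y /odd_sumP[[x [y [-> ->]]]|[x [y [-> ->]]]] M I.
  + rewrite (@tooth_edge_h _ _ _ x y) //.
    have [->|->] : y = m \/ y = 2 * m by lia.
      rewrite !tstep_box; try lia; rewrite !(ts_top F); try lia.
      by case_ifs; lia.
    by rewrite !(tstep_top F G); try lia; case_ifs; lia.
  + rewrite (@tooth_edge_v _ _ _ x y) //.
    have [->|->] : x = 1 \/ x = -1 by lia.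
      have [?|?] : y mod 2 = 0 \/ y mod 2 = 1 by lia.
        by rewrite (side (y + 1)); try lia; case_ifs; lia.
      by rewrite (side y); try lia; case_ifs; lia.
    have [?|?] : y mod 2 = 0 \/ y mod 2 = 1 by lia.
      by rewrite (side' (y + 1)); try lia; case_ifs; lia.
    by rewrite (side' y); try lia; case_ifs; lia.
- move=> X Y /odd_sumP[[x [y [-> ->]]]|[x [y [-> ->]]]] I.
  + rewrite (@tooth_edge_h _ _ _ x y) //.
    have [->|->] : x = 0 \/ x = -1 by lia.
      by rewrite side ?(mid y); try lia; case_ifs; lia.
    by rewrite side' ?(mid y); try lia; case_ifs; lia.
  + rewrite (@tooth_edge_v _ _ _ x y) //; have -> : x = 0 by lia.
    by rewrite !mid; try lia; case_ifs; lia.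
Qed.

Lemma partial_room_right : partial_tiling (inside (room_right m)) (4 * m) E' [:: room_right m].
Proof.
have m2 := ts_m F.
have side x : m - 1 < x < 2 * m - 1 ->
    tooth_step m f g x 1 = if x mod 2 =? 0 then 4 * m - 2 else -1.
  move=> ?; rewrite (tstep_Q F G); try lia.
  by rewrite (cs_bottom G); try lia; case_ifs; born_lia.
have side' x : m - 1 < x < 2 * m - 1 ->
    tooth_step m f g x (-1) = if x mod 2 =? 0 then 4 * m - 2 else -1.
  by move=> /side <-; rewrite -(tstep_symy g F _ 1).
have mid x : m - 1 <= x -> tooth_step m f g x 0 = -1.
  move=> ?; have [->|?] : x = m - 1 \/ m <= x by lia.
    by rewrite tstep_box ?(ts_right F); try lia; case_ifs; lia.
  by rewrite (tstep_gap_row _ F); lia.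
apply: partial_tiling_single; rewrite /room_right /E'; room_simpl; try lia.
- move=> X Y /odd_sumP[[x [y [-> ->]]]|[x [y [-> ->]]]] M I.
  + rewrite (@tooth_edge_h _ _ _ x y) //.
    have [?|?] : x mod 2 = 0 \/ x mod 2 = 1 by lia.
      have [->|->] : y = 1 \/ y = -1 by lia.
        by rewrite (side x); try lia; case_ifs; lia.
      by rewrite (side' x); try lia; case_ifs; lia.
    have [->|->] : y = 1 \/ y = -1 by lia.
      by rewrite (side (x + 1)); try lia; case_ifs; lia.
    by rewrite (side' (x + 1)); try lia; case_ifs; lia.
  + rewrite (@tooth_edge_v _ _ _ x y) //.
    have [->|->] : x = m - 1 \/ x = 2 * m - 1 by lia.
      rewrite !tstep_box; try lia; rewrite !(ts_right F); try lia.
      by case_ifs; lia.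
    by rewrite !(tstep_right F G); try lia; case_ifs; lia.
- move=> X Y /odd_sumP[[x [y [-> ->]]]|[x [y [-> ->]]]] I.
  + rewrite (@tooth_edge_h _ _ _ x y) //; have -> : y = 0 by lia.
    by rewrite !mid; try lia; case_ifs; lia.
  + rewrite (@tooth_edge_v _ _ _ x y) //.
    have [->|->] : y = -1 \/ y = 0 by lia.
      by rewrite side' ?(mid x); try lia; case_ifs; lia.
    by rewrite side ?(mid x); try lia; case_ifs; lia.
Qed.

(** A symmetry of the structure counts as a move without delay; it carries the upper and right gap
    rooms to the lower and left ones. *)
Lemma agrees_tooth_sym B nx ny : agrees (Iso false nx ny 0 0) 0 B E' E'.
Proof.
move=> X Y dx dy oX oY _ u; left; rewrite /iso_X /iso_Y /= !Z.add_0_r tooth_edge_sym.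
  have := @tstep_range m f g F G.
  have : (X + dx + (Y + dy)) mod 2 = 1 by rewrite /unit_step in u; lia.
  rewrite /E' => /odd_sumP[[x [y [eU eV]]]|[x [y [eU eV]]]] R.
    rewrite !(@tooth_edge_h _ _ _ x y) //; have := R x y; have := R (x + 1) y.
    by case_ifs; born_lia.
  rewrite !(@tooth_edge_v _ _ _ x y) //; have := R x y; have := R x (y + 1).
  by case_ifs; born_lia.
by rewrite /unit_step in u; lia.
Qed.

Lemma partial_room_down : partial_tiling (inside (room_down m)) (4 * m) E' [:: room_down m].
Proof.
have := partial_tiling_move (Z.le_refl 0) partial_room_up (@agrees_tooth_sym _ false true)
  (B' := inside (room_down m)).
have -> : map (move_room (Iso false false true 0 0) 0) [:: room_up m] = [:: room_down m].
  by congr [:: _]; rewrite /room_up /room_down; room_simpl; congr (_, _, _, _, _); lia.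
by rewrite Z.add_0_r; apply=> X Y _ _; rewrite /room_up /room_down; room_simpl; lia.
Qed.

Lemma partial_room_left : partial_tiling (inside (room_left m)) (4 * m) E' [:: room_left m].
Proof.
have := partial_tiling_move (Z.le_refl 0) partial_room_right (@agrees_tooth_sym _ true false)
  (B' := inside (room_left m)).
have -> : map (move_room (Iso false true false 0 0) 0) [:: room_right m] = [:: room_left m].
  by congr [:: _]; rewrite /room_right /room_left; room_simpl; congr (_, _, _, _, _); lia.
by rewrite Z.add_0_r; apply=> X Y _ _; rewrite /room_right /room_left; room_simpl; lia.
Qed.

Variables l k : seq room.
Hypothesis T : tiling (tooth_box m) (2 * m) E l.
Hypothesis C : tiling (corner_box m) (2 * m) (corner_edge g) k.

Let B_Q nx ny X Y := corner_box m (neg_if nx X - 2 * (m - 1)) (neg_if ny Y - 2 * m).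

Lemma partial_Q nx ny :
  partial_tiling (B_Q nx ny) (4 * m) E' (map (move_room (iso_Q m nx ny) (2 * m)) k).
Proof.
have m2 := ts_m F; replace (4 * m) with (2 * m + 2 * m) by lia.
apply: (partial_tiling_move _ (proj1 C) (@agrees_Q nx ny)); first lia.
by move=> X Y oX oY; rewrite /B_Q /corner_box /iso_Q; case: nx ny => [] []; room_simpl; lia.
Qed.

Lemma partial_tooth_step :
  partial_tiling (tooth_box (2 * m)) (4 * m) E' (tooth_rooms_step m l k).
Proof.
have m2 := ts_m F.
have T0 : partial_tiling (tooth_box m) (4 * m) E' l.
  apply: (@partial_tiling_ext (tooth_box m) _ (2 * m)) => //; last lia.
  by apply: partial_tiling_keep (proj1 T) _; exact: agrees_tooth_id.
have T1 := partial_tiling_union partial_room_right partial_room_left.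
have {}T1 := partial_tiling_union partial_room_down (T1 ltac:(rewrite /room_right /room_left; room_simpl; cases_lia)).
have {}T1 := partial_tiling_union partial_room_up (T1 ltac:(rewrite /room_right /room_left /room_down; room_simpl; cases_lia)).
have {}T1 := partial_tiling_union (partial_Q true true) (T1 ltac:(rewrite /room_right /room_left /room_down /room_up; room_simpl; cases_lia)).
have {}T1 := partial_tiling_union (partial_Q false true) (T1 ltac:(rewrite /B_Q /corner_box /room_right /room_left /room_down /room_up; room_simpl; cases_lia)).
have {}T1 := partial_tiling_union (partial_Q true false) (T1 ltac:(rewrite /B_Q /corner_box /room_right /room_left /room_down /room_up; room_simpl; cases_lia)).
have {}T1 := partial_tiling_union (partial_Q false false) (T1 ltac:(rewrite /B_Q /corner_box /room_right /room_left /room_down /room_up; room_simpl; cases_lia)).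
have {}T1 := partial_tiling_union T0 (T1 ltac:(rewrite /B_Q /corner_box /room_right /room_left /room_down /room_up; room_simpl; cases_lia)).
apply: (partial_tiling_ext (T1 _)); first 2 last.
- move=> X Y oX oY; rewrite /B_Q /tooth_box /corner_box /room_right /room_left /room_down /room_up; room_simpl.
  split.
    by move=> [?|[?|[?|[?|[?|[?|[?|[?|?]]]]]]]]; lia.
  move=> ?.
  have [?|[?|[?|[? ?]]]] : (Z.abs X < 2 * (m - 1) /\ Z.abs Y < 2 * m) \/ (Z.abs X < 2 /\ 2 * m < Z.abs Y) \/
    (2 * (m - 1) < Z.abs X /\ Z.abs Y < 2) \/ (2 < Z.abs X /\ 2 < Z.abs Y /\ (2 * m < Z.abs Y \/ 2 * (m - 1) < Z.abs X)) by lia.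
  + by left; lia.
  + have [?|?] : 0 < Y \/ Y < 0 by lia.
      by do 5 right; left; lia.
    by do 6 right; left; lia.
  + have [?|?] : 0 < X \/ X < 0 by lia.
      by do 7 right; left; lia.
    by do 8 right; lia.
  + have [?|?] : 0 < X \/ X < 0 by lia.
      have [?|?] : 0 < Y \/ Y < 0 by lia.
        by right; left; lia.
      by do 3 right; left; lia.
    have [?|?] : 0 < Y \/ Y < 0 by lia.
      by do 2 right; left; lia.
    by do 4 right; left; lia.
- by rewrite /B_Q /tooth_box /corner_box /room_right /room_left /room_down /room_up; room_simpl; lia.
- lia.
Qed.

Lemma mem_tooth_step rm : rm \in tooth_rooms_step m l k <->
  [\/ rm \in l, exists nx ny, rm \in map (move_room (iso_Q m nx ny) (2 * m)) k |
      rm \in [:: room_up m; room_down m; room_right m; room_left m]].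
Proof.
rewrite /tooth_rooms_step !mem_cat; split.
  case/or4P => [H|H|H|/orP[H|/orP[H|H]]]; [by apply: Or31| | | | |by apply: Or33].
  - by apply: Or32; exists false, false.
  - by apply: Or32; exists true, false.
  - by apply: Or32; exists false, true.
  - by apply: Or32; exists true, true.
case=> [->//|[nx [ny H]]|H].
  by move: H; case: nx ny => [] [] ->; rewrite !orbT.
by rewrite H !orbT.
Qed.

Lemma sealed_tooth_old rm : rm \in l -> sealed (tooth_box (2 * m)) E' (tooth_rooms_step m l k) rm.
Proof.
have m2 := ts_m F; move=> rml.
have [X [Y [dx [dy [oX oY u I [Et nx]]]]]] := proj2 T _ rml.
have [_ tb] := tl_proper (proj1 T) rml.
have BXY := tl_sub (proj1 T) rml oX oY I.
exists X, Y, dx, dy; split=> //; split.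
  have := agrees_tooth_id oX oY BXY u; rewrite /agrees_at Et.
  rewrite /iso_X /iso_Y /neg_if /= !Z.add_0_r => -[->|]; last lia.
  by have := shiftP 0 (time rm); lia.
right; case: nx => [out|[rm' rml' I']]; last first.
  by exists rm' => //; apply/mem_tooth_step/Or31.
have [rm' rml' I'] : exists2 rm' : room, rm' \in tooth_rooms_step m l k &
    inside rm' (X + 2 * dx) (Y + 2 * dy).
  apply: (tl_cover partial_tooth_step); try lia.
  by move: BXY u; rewrite /tooth_box /unit_step; lia.
exists rm' => //; split=> //.
have /mem_tooth_step[rl|[nx [ny /mapP[r0 r0k e]]]|] := rml'.
- by case: out; apply: (tl_sub (proj1 T) rl) => //; lia.
- by rewrite e move_room_time; have [_ ?] := tl_proper (proj1 C) r0k; lia.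
- move: tb; generalize (time rm) => t tb.
  by rewrite !inE => /or4P[] /eqP ->; rewrite /room_right /room_left /room_down /room_up; room_simpl; lia.
Qed.

(** The left side of a copy, complete at [4 * m - 1], faces the upper or lower gap room, closed at
    [4 * m]; its bottom side, complete at [4 * m - 2], faces the right or left one, closed at
    [4 * m - 1]. *)
Lemma sealed_Q nx ny rm : rm \in map (move_room (iso_Q m nx ny) (2 * m)) k ->
  sealed (tooth_box (2 * m)) E' (tooth_rooms_step m l k) rm.
Proof.
have m2 := ts_m F; move=> rml.
have [X [Y [dx [dy [oX oY u BXY [E0]]]]]] :=
  moved_seal (proj1 C) (@agrees_Q nx ny) rml (proj2 C).
move=> [U [V [eu [ev [oU oV u' I [eX eY et Ee nxt]]]]]].
exists U, V, eu, ev; split=> //; split=> //.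
case: nxt => [out|[rm' rml' ?]]; last first.
  by right; exists rm' => //; apply/mem_tooth_step/Or32; exists nx, ny.
have {}eX : U + 2 * eu = neg_if nx (X + 2 * dx) + 2 * neg_if nx (m - 1) := eX.
have {}eY : V + 2 * ev = neg_if ny (Y + 2 * dy) + 2 * neg_if ny m := eY.
have := corner_exit G oX oY BXY u E0 out.
move: BXY; rewrite /corner_box => BXY [] ex.
- by left; rewrite /tooth_box; case: nx ny eX eY {rml} => [] []; rewrite /neg_if; lia.
- by left; rewrite /tooth_box; case: nx ny eX eY {rml} => [] []; rewrite /neg_if; lia.
- right; exists (if ny then room_down m else room_up m).
    by apply/mem_tooth_step/Or33; rewrite !inE; case: (ny); rewrite eqxx ?orbT.
  rewrite et; case: nx ny eX eY {rml} => [] []; rewrite /neg_if /room_up /room_down; room_simpl; lia.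
- right; exists (if nx then room_left m else room_right m).
    by apply/mem_tooth_step/Or33; rewrite !inE; case: (nx); rewrite eqxx ?orbT.
  rewrite et; case: nx ny eX eY {rml} => [] []; rewrite /neg_if /room_left /room_right; room_simpl; lia.
Qed.

Lemma tooth_tiling_step : tiling (tooth_box (2 * m)) (2 * (2 * m)) E' (tooth_rooms_step m l k).
Proof.
have m2 := ts_m F; replace (2 * (2 * m)) with (4 * m) by lia.
split; first exact: partial_tooth_step.
have up : E' 1 (4 * m) = 4 * m.
  rewrite /E' (@tooth_edge_h _ _ _ 0 (2 * m)); try lia.
  by rewrite !(tstep_top F G); try lia; case_ifs; lia.
have right : E' (4 * m - 2) 1 = 4 * m - 1.
  rewrite /E' (@tooth_edge_v _ _ _ (2 * m - 1) 0); try lia.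
  by rewrite !(tstep_right F G); try lia; case_ifs; lia.
move=> rm /mem_tooth_step[|[nx [ny]]|].
- exact: sealed_tooth_old.
- exact: sealed_Q.
rewrite !inE => /or4P[] /eqP ->.
- exists 1, (4 * m - 1), 0, 1.
  split; try lia; [by rewrite /unit_step; lia|by rewrite /room_up; room_simpl; lia|].
  split; last by left; rewrite /tooth_box; lia.
  by replace (4 * m - 1 + 1) with (4 * m) by lia.
- exists 1, (1 - 4 * m), 0, (-1).
  split; try lia; [by rewrite /unit_step; lia|by rewrite /room_down; room_simpl; lia|].
  split; last by left; rewrite /tooth_box; lia.
  by replace (1 - 4 * m + -1) with (- (4 * m)) by lia; rewrite tooth_edge_symy //; lia.
- exists (4 * m - 3), 1, 1, 0.
  split; try lia; [by rewrite /unit_step; lia|by rewrite /room_right; room_simpl; lia|].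
  split; last by left; rewrite /tooth_box; lia.
  by replace (4 * m - 3 + 1) with (4 * m - 2) by lia.
- exists (3 - 4 * m), 1, (-1), 0.
  split; try lia; [by rewrite /unit_step; lia|by rewrite /room_left; room_simpl; lia|].
  split; last by left; rewrite /tooth_box; lia.
  by replace (3 - 4 * m + -1) with (- (4 * m - 2)) by lia; rewrite tooth_edge_symx //; lia.
Qed.
End ToothTiling.

Local Close Scope Z_scope.
Delimit Scope Z_scope with BZ.
Local Open Scope classical_set_scope.
Local Open Scope ring_scope.

(** * Components of the complement of a grid *)

Lemma uniq_map_inj (T1 T2 : eqType) (f : T1 -> T2) (s : seq T1) :
  uniq (map f s) -> {in s &, injective f}.
Proof.
elim: s => //= x s IH /andP[nx us] y z /[!inE] /orP[/eqP->|ys] /orP[/eqP->|zs] // e.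
- by case/negP: nx; rewrite e map_f.
- by case/negP: nx; rewrite -e map_f.
- exact: IH.
Qed.

Section Grid.
Variable R : realType.

(* A unit of the doubled site coordinates is a quarter of a toothpick. *)
Definition pos (X : Z) : R := (int_of_Z X)%:~R / 4.

Lemma pos_le X Y : (pos X <= pos Y) = (X <=? Y)%BZ.
Proof.
rewrite /pos ler_pM2r ?invr_gt0 ?ltr0n // ler_int.
by rewrite -[LHS]/((int_of_Z X <= int_of_Z Y)%R); lia.
Qed.

Lemma pos_lt X Y : (pos X < pos Y) = (X <? Y)%BZ.
Proof. by rewrite ltNge pos_le; lia. Qed.

Lemma pos_inj X Y : pos X = pos Y -> X = Y.
Proof.
move=> e; have := pos_le X Y; have := pos_le Y X; rewrite e !lexx; lia.
Qed.

Lemma posD X Y : pos (X + Y)%BZ = pos X + pos Y.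
Proof.
rewrite /pos -mulrDl -intrD; congr (_%:~R / _); lia.
Qed.

Lemma posN X : pos (- X)%BZ = - pos X.
Proof.
rewrite /pos -mulNr -mulrNz; congr (_%:~R / _); lia.
Qed.

Definition on_edge (X Y : Z) (p : R * R) : Prop :=
  if (Y mod 2 =? 0)%BZ then pos (X - 1) <= p.1 <= pos (X + 1) /\ p.2 = pos Y
  else p.1 = pos X /\ pos (Y - 1) <= p.2 <= pos (Y + 1).

Definition grid (C : Z -> Z -> Prop) : set (R * R) :=
  [set p | exists X Y, [/\ ((X + Y) mod 2 = 1)%BZ, C X Y & on_edge X Y p]].

Lemma gridP C p : grid C p <->
  (exists X Y, [/\ (X mod 2 = 1)%BZ, (Y mod 2 = 0)%BZ, C X Y, pos (X - 1) <= p.1 <= pos (X + 1) & p.2 = pos Y]) \/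
  (exists X Y, [/\ (X mod 2 = 0)%BZ, (Y mod 2 = 1)%BZ, C X Y, p.1 = pos X & pos (Y - 1) <= p.2 <= pos (Y + 1)]).
Proof.
split.
  move=> [X [Y [par c]]]; rewrite /on_edge; case: ifP => e [H1 H2].
  - by left; exists X, Y; split=> //; lia.
  - by right; exists X, Y; split=> //; lia.
case=> -[X [Y [oX oY c H1 H2]]]; exists X, Y; split=> //; try lia; rewrite /on_edge.
- by rewrite oY.
- by rewrite oY.
Qed.

Lemma between_le a b (x : R) : pos a <= x -> x <= pos b -> (a <= b)%BZ.
Proof. by move=> H1 H2; have := le_trans H1 H2; rewrite pos_le; lia. Qed.
Lemma between_lt a b (x : R) : pos a < x -> x <= pos b -> (a < b)%BZ.
Proof. by move=> H1 H2; have := lt_le_trans H1 H2; rewrite pos_lt; lia. Qed.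
Lemma between_tl a b (x : R) : pos a <= x -> x < pos b -> (a < b)%BZ.
Proof. by move=> H1 H2; have := le_lt_trans H1 H2; rewrite pos_lt; lia. Qed.

Definition interior_of (rm : room) : set (R * R) :=
  let: (a, b, c, d, _) := rm in
  [set p | pos (2 * a) < p.1 < pos (2 * b) /\ pos (2 * c) < p.2 < pos (2 * d)].

Section GridSet.
Variable C : Z -> Z -> Prop.
Let A := grid C.
Let comp := connected_component (~` A).

Definition seg_at (p q : R * R) (t : R) : R * R :=
  (p.1 + t * (q.1 - p.1), p.2 + t * (q.2 - p.2)).

Lemma same_comp p q : (forall t, 0 <= t <= 1 -> ~ A (seg_at p q t)) -> comp p = comp q.
Proof.
move=> free; apply: same_connected_component.
exists (seg_at p q @` `[0, 1]).
  split.
  - exists 0; first by rewrite /= in_itv /= lexx ler01.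
    by rewrite /seg_at !mul0r !addr0; case: p {free}.
  - by move=> y [t /=]; rewrite in_itv /= => /free H <-.
  - apply: connected_continuous_connected; first exact: segment_connected.
    apply: continuous_subspaceT => t.
    apply: (@cvg_pair _ _ _ (nbhs t) (nbhs (p.1 + t * (q.1 - p.1)))
      (nbhs (p.2 + t * (q.2 - p.2))) _ _ _ (fun t => p.1 + t * (q.1 - p.1))
      (fun t => p.2 + t * (q.2 - p.2))).
    + by apply: cvgD; [exact: cvg_cst|apply: cvgM; [exact: cvg_id|exact: cvg_cst]].
    + by apply: cvgD; [exact: cvg_cst|apply: cvgM; [exact: cvg_id|exact: cvg_cst]].
exists 1; first by rewrite /= in_itv /= lexx ler01.
by rewrite /seg_at !mul1r ![_ + (_ - _)]addrC !subrK; case: q {free}.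
Qed.

Definition center (X Y : Z) : R * R := (pos X, pos Y).

Lemma cell_free X Y p : (X mod 2 = 1)%BZ -> (Y mod 2 = 1)%BZ ->
  pos (X - 1) < p.1 < pos (X + 1) -> pos (Y - 1) < p.2 < pos (Y + 1) -> ~ A p.
Proof.
move=> oX oY /andP[x1 x2] /andP[y1 y2] /gridP[] [U [V [oU oV _ H1 H2]]].
- move: y1 y2; rewrite H2 !pos_lt; lia.
- move: x1 x2; rewrite H1 !pos_lt; lia.
Qed.

Lemma interp_lt (lo hi x y t : R) : lo <= x <= hi -> lo < y < hi -> 0 < t <= 1 ->
  lo < x + t * (y - x) < hi.
Proof. nra. Qed.

Lemma interp_le (lo hi x y t : R) : lo <= x <= hi -> lo <= y <= hi -> 0 <= t <= 1 ->
  lo <= x + t * (y - x) <= hi.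
Proof. nra. Qed.

Lemma interp_itv (lo hi x y t : R) : lo < x < hi -> lo < y < hi -> 0 <= t <= 1 ->
  lo < x + t * (y - x) < hi.
Proof.
move=> hx hy /andP[]; rewrite le_eqVlt => /orP[/eqP <-|t0 t1].
  by rewrite mul0r addr0.
by apply: interp_lt => //; [move: hx; lra|rewrite t0].
Qed.

Lemma pos_center X : pos (X - 1) < pos X < pos (X + 1).
Proof. by rewrite !pos_lt; lia. Qed.

Lemma odd_floor (x : R) : exists X, (X mod 2 = 1)%BZ /\ pos (X - 1) <= x < pos (X + 1).
Proof.
pose n := Num.floor (2 * x).
exists (2 * Z_of_int n + 1)%BZ; split; first lia.
rewrite /pos; have -> : int_of_Z (2 * Z_of_int n + 1 - 1) = 2 * n by lia.
have -> : int_of_Z (2 * Z_of_int n + 1 + 1) = 2 * n + 2 by lia.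
have := floor_itv (2 * x); rewrite -/n => /andP[].
by rewrite !intrD intrM => ? ?; apply/andP; split; lra.
Qed.

(** The segment from [p] to the centre of a cell whose closure contains [p] is inside the open cell
    except at [p] itself, so it avoids the grid even if [p] is on an uncovered edge. *)
Lemma comp_center p : ~ A p -> exists X Y,
  [/\ (X mod 2 = 1)%BZ, (Y mod 2 = 1)%BZ, comp p = comp (center X Y),
      pos (X - 1) <= p.1 <= pos (X + 1) & pos (Y - 1) <= p.2 <= pos (Y + 1)].
Proof.
move=> nA.
have fl (x : R) : exists X, (X mod 2 = 1)%BZ /\ pos (X - 1) <= x <= pos (X + 1).
  by have [X [oX /andP[a b]]] := odd_floor x; exists X; rewrite a ltW.
have [X [oX bX]] := fl p.1; have [Y [oY bY]] := fl p.2.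
exists X, Y; split=> //; apply: same_comp => t /andP[t0 t1].
have [->|tn0] := eqVneq t 0.
  by rewrite /seg_at !mul0r !addr0 -surjective_pairing.
apply: (cell_free oX oY); apply: interp_lt => //=; rewrite ?pos_center ?t1 ?andbT //.
- by rewrite lt_neqAle eq_sym tn0.
- by rewrite lt_neqAle eq_sym tn0.
Qed.

(** The segment between the centres of adjacent cells meets no edge other than their common one. *)
Lemma comp_step X Y dx dy : (X mod 2 = 1)%BZ -> (Y mod 2 = 1)%BZ -> unit_step dx dy ->
  ~ C (X + dx)%BZ (Y + dy)%BZ -> comp (center X Y) = comp (center (X + 2 * dx) (Y + 2 * dy)).
Proof.
rewrite /unit_step => oX oY u nC; apply: same_comp => t t01.
have [X' eX] : exists X', X' = (X + 2 * dx)%BZ by eexists.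
have [Y' eY] : exists Y', Y' = (Y + 2 * dy)%BZ by eexists.
rewrite -eX -eY.
have [[dx0 dy1]|[dy0 dx1]] : (dx = 0 /\ (dy = 1 \/ dy = -1) \/ dy = 0 /\ (dx = 1 \/ dx = -1))%BZ by lia.
- have -> : X' = X by lia.
  move: nC; rewrite dx0 Z.add_0_r /seg_at /= subrr mulr0 addr0 => nC.
  move=> /gridP[] [U [V [oU oV c /= H1 H2]]]; last first.
    by have := pos_inj H1; lia.
  move: H1; rewrite !pos_le => H1.
  have HY : pos (Z.min Y Y') <= pos V <= pos (Z.max Y Y').
    by rewrite -H2; apply: interp_le t01; rewrite !pos_le; lia.
  move: HY; rewrite !pos_le => HY.
  have eV : V = (Y + dy)%BZ by lia.
  have eU : U = X by lia.
  by apply: nC; rewrite -eV -eU.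
- have -> : Y' = Y by lia.
  move: nC; rewrite dy0 Z.add_0_r /seg_at /= subrr mulr0 addr0 => nC.
  move=> /gridP[] [U [V [oU oV c /= H1 H2]]].
    by have := pos_inj H2; lia.
  move: H2; rewrite !pos_le => H2.
  have HX : pos (Z.min X X') <= pos U <= pos (Z.max X X').
    by rewrite -H1; apply: interp_le t01; rewrite !pos_le; lia.
  move: HX; rewrite !pos_le => HX.
  have eU : U = (X + dx)%BZ by lia.
  have eV : V = Y by lia.
  by apply: nC; rewrite -eU -eV.
Qed.

Lemma strict_itv (lo hi x : R) : lo <= x <= hi -> ~ (x = lo \/ x = hi) -> lo < x < hi.
Proof.
move=> /andP[l h] ne; rewrite !lt_neqAle l h !andbT.
by apply/andP; split; apply/eqP => e; apply: ne; rewrite e; [left|right].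
Qed.

Section Room.
Variable rm : room.
Hypothesis P : proper rm.
Hypothesis bd : forall X Y, ((X + Y) mod 2 = 1)%BZ -> meets rm X Y -> ~ inside rm X Y -> C X Y.
Hypothesis ins : forall X Y, ((X + Y) mod 2 = 1)%BZ -> inside rm X Y -> ~ C X Y.

Lemma interior_free p : interior_of rm p -> ~ A p.
Proof.
move: ins; case: rm => [[[[a b] c] d] t]; room_simpl => ins'.
move=> [/andP[x1 x2] /andP[y1 y2]] /gridP[] [X [Y [oX oY cXY]]].
- move=> /andP[H1 H1'] H2; apply: ins' cXY; first lia.
  move: y1 y2; rewrite H2 !pos_lt.
  have := between_lt x1 H1'; have := between_tl H1 x2; lia.
- move=> H1 /andP[H2 H2']; apply: ins' cXY; first lia.
  move: x1 x2; rewrite H1 !pos_lt.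
  have := between_lt y1 H2'; have := between_tl H2 y2; lia.
Qed.

Lemma floor_cell (a b : Z) (x : R) : (a < b)%BZ -> pos (2 * a) <= x <= pos (2 * b) ->
  exists X, [/\ (X mod 2 = 1)%BZ, (2 * a < X < 2 * b)%BZ & pos (X - 1) <= x <= pos (X + 1)].
Proof.
move=> ab /andP[xa xb].
pose n := Num.floor (2 * x).
have := floor_itv (2 * x); rewrite -/n => /andP[n1 n2].
have E1 : pos (2 * Z_of_int n) <= x.
  rewrite /pos; have -> : int_of_Z (2 * Z_of_int n) = 2 * n by lia.
  by rewrite intrM; lra.
have E2 : x < pos (2 * Z_of_int n + 2).
  rewrite /pos; have -> : int_of_Z (2 * Z_of_int n + 2) = 2 * (n + 1) by lia.
  by rewrite intrM; lra.
have := between_tl xa E2; have := between_le E1 xb => n_b n_a.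
have [nb|nb] := Z_lt_ge_dec (Z_of_int n) b.
  exists (2 * Z_of_int n + 1)%BZ; split; try lia.
  rewrite Z.add_simpl_r E1 /= ltW //.
  by rewrite (_ : (2 * Z_of_int n + 1 + 1 = 2 * Z_of_int n + 2)%BZ) //; lia.
(* At the right end of the interval the cell starting at [x] is already outside; the last cell
   inside is taken instead. *)
have e : (2 * Z_of_int n = 2 * b)%BZ by lia.
exists (2 * b - 1)%BZ; split; try lia.
rewrite Z.sub_simpl_r xb andbT (le_trans _ E1) // e pos_le; lia.
Qed.

Lemma frontier_covered p :
  let: (a, b, c, d, _) := rm in
  pos (2 * a) <= p.1 <= pos (2 * b) -> pos (2 * c) <= p.2 <= pos (2 * d) ->
  ~ interior_of rm p -> A p.
Proof.
case: p => px py; move: P bd; case: rm => [[[[a b] c] d] t]; room_simpl => P' bd' x12 y12 nI.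
have [X [oX X12 HX]] := floor_cell (proj1 P') x12.
have [Y [oY Y12 HY]] := floor_cell (proj2 P') y12.
have [e|ne] := pselect (px = pos (2 * a) \/ px = pos (2 * b)).
  apply/gridP; right.
  have [e1|e1] := e; [exists (2 * a)%BZ, Y|exists (2 * b)%BZ, Y]; split=> //; try lia.
    by apply: bd'; lia.
  by apply: bd'; lia.
have [e|ne'] := pselect (py = pos (2 * c) \/ py = pos (2 * d)).
  apply/gridP; left.
  have [e1|e1] := e; [exists X, (2 * c)%BZ|exists X, (2 * d)%BZ]; split=> //; try lia.
    by apply: bd'; lia.
  by apply: bd'; lia.
by case: nI; split; exact: strict_itv.
Qed.

Lemma interior_connected p q : interior_of rm p -> interior_of rm q -> comp p = comp q.
Proof.
move=> Ip Iq; apply: same_comp => t t01; apply: interior_free.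
move: Ip Iq t01; case: rm => [[[[a b] c] d] tm] /= [p1 p2] [q1 q2] t01.
by split; exact: interp_itv.
Qed.

(** Within the component of [p] the interior is open, and also closed: the closed rectangle adds
    only its frontier, which is covered. Connectedness leaves no other points. *)
Lemma room_component p : interior_of rm p -> comp p = interior_of rm.
Proof.
move=> Ip; apply/seteqP; split; last first.
  move=> q Iq; rewrite (interior_connected Ip Iq).
  by apply: connected_component_refl; exact: interior_free.
have conn := @component_connected _ (~` A) p.
suff : comp p `&` interior_of rm = comp p by move=> <- q [].
apply: (conn (comp p `&` interior_of rm)).
- by exists p; split=> //; apply: connected_component_refl; exact: interior_free.
- exists (interior_of rm) => //.
  case: rm => [[[[a b] c] d] t] /=.
  have -> : [set q : R * R | pos (2 * a) < q.1 < pos (2 * b) /\ pos (2 * c) < q.2 < pos (2 * d)]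
    = (fst @^-1` [set x | x > pos (2 * a)] `&` fst @^-1` [set x | x < pos (2 * b)]) `&`
      (snd @^-1` [set x | x > pos (2 * c)] `&` snd @^-1` [set x | x < pos (2 * d)]).
    by apply/seteqP; split=> q /=; [move=> [/andP[? ?] /andP[? ?]]|move=> [[? ?] [? ?]]]; do !split => //; apply/andP.
  by do !apply: openI; apply: open_comp => [? _|]; do ?[exact: cvg_fst|exact: cvg_snd|exact: open_gt|exact: open_lt].
- exists [set q : R * R | let: (a, b, c, d, _) := rm in
    pos (2 * a) <= q.1 <= pos (2 * b) /\ pos (2 * c) <= q.2 <= pos (2 * d)].
    case: (rm) => [[[[a b] c] d] t] /=.
    have -> : [set q : R * R | pos (2 * a) <= q.1 <= pos (2 * b) /\ pos (2 * c) <= q.2 <= pos (2 * d)]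
      = (fst @^-1` [set x | x >= pos (2 * a)] `&` fst @^-1` [set x | x <= pos (2 * b)]) `&`
        (snd @^-1` [set x | x >= pos (2 * c)] `&` snd @^-1` [set x | x <= pos (2 * d)]).
      by apply/seteqP; split=> q /=; [move=> [/andP[? ?] /andP[? ?]]|move=> [[? ?] [? ?]]]; do !split => //; apply/andP.
    by do !apply: closedI; apply: closed_comp => [? _|]; do ?[exact: cvg_fst|exact: cvg_snd|exact: closed_ge|exact: closed_le].
  apply/seteqP; split=> q [cq Iq]; split=> //.
    by move: Iq; case: (rm) => [[[[a b] c] d] t] /= [/andP[? ?] /andP[? ?]]; split; apply/andP; split; exact: ltW.
  have := @frontier_covered q; have := connected_component_sub cq.
  move: Iq; rewrite /=; case: (rm) => [[[[a b] c] d] t] [H1 H2] nAq fr.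
  by apply: contrapT => nI; exact: nAq (fr H1 H2 nI).
Qed.
End Room.

Definition ray_free (X Y dx dy : Z) : Prop :=
  forall k, (0 <= k)%BZ -> ~ C (X + (2 * k + 1) * dx)%BZ (Y + (2 * k + 1) * dy)%BZ.

(** The component contains the centres of all cells along the ray. *)
Lemma ray_unbounded p X Y dx dy : comp p = comp (center X Y) ->
  (X mod 2 = 1)%BZ -> (Y mod 2 = 1)%BZ -> unit_step dx dy -> ray_free X Y dx dy ->
  ~ A (center X Y) -> ~ bounded_set (comp p).
Proof.
move=> -> oX oY u free nA; rewrite /= => -[M0 [_ HM]].
have along k : comp (center X Y) = comp (center (X + 2 * Z.of_nat k * dx) (Y + 2 * Z.of_nat k * dy)).
  elim: k => [|k ->].
    by congr (comp (center _ _)); lia.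
  rewrite (@comp_step _ _ dx dy) //.
  - by congr (comp (center _ _)); lia.
  - by rewrite /unit_step in u; nia.
  - by rewrite /unit_step in u; nia.
  - have := free (Z.of_nat k) ltac:(lia); congr (~ C _ _); lia.
have [M M0M] : exists M, M0 < M by exists (M0 + 1); rewrite ltrDl ltr01.
(* The factor 2 is due to the width of a cell, one half: [k0] steps move the centre by [k0 / 2]. *)
have [k0 Hk] : exists k : nat, 2 * (`|M| + `|pos X| + `|pos Y|) < k%:R.
  by exists (Num.bound (2 * (`|M| + `|pos X| + `|pos Y|))); apply: archi_boundP; rewrite mulr_ge0 ?addr_ge0.
pose q := center (X + 2 * Z.of_nat k0 * dx) (Y + 2 * Z.of_nat k0 * dy).
have cq : comp (center X Y) q.
  rewrite (along k0); apply: connected_component_refl.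
  apply: (@cell_free (X + 2 * Z.of_nat k0 * dx) (Y + 2 * Z.of_nat k0 * dy)).
  - by rewrite /unit_step in u; nia.
  - by rewrite /unit_step in u; nia.
  - exact: pos_center.
  - exact: pos_center.
have : `|q| <= M := HM M M0M q cq; rewrite prod_normE ge_max /q /center; cbn [fst snd].
have pk : pos (2 * Z.of_nat k0) = k0%:R / 2.
  rewrite /pos; have -> : int_of_Z (2 * Z.of_nat k0) = (2 * k0)%N by lia.
  by rewrite -[_%:~R]/((2 * k0)%:R) natrM; field.
have := ler_norm M; have := normr_ge0 (pos X); have := normr_ge0 (pos Y).
rewrite /unit_step in u.
have [[->|->]|[->|->]] : ((dx = 1 \/ dx = -1) \/ (dy = 1 \/ dy = -1))%BZ by lia.
- rewrite Z.mul_1_r !posD pk => ? ? ? /andP[/ler_normlP[? ?] _].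
  have := ler_norm (- pos X); rewrite normrN; lra.
- rewrite -Z.opp_eq_mul_m1 !posD posN pk => ? ? ? /andP[/ler_normlP[? ?] _].
  have := ler_norm (pos X); lra.
- rewrite Z.mul_1_r !posD pk => ? ? ? /andP[_ /ler_normlP[? ?]].
  have := ler_norm (- pos Y); rewrite normrN; lra.
- rewrite -Z.opp_eq_mul_m1 !posD posN pk => ? ? ? /andP[_ /ler_normlP[? ?]].
  have := ler_norm (pos Y); lra.
Qed.
End GridSet.

Lemma interior_center rm X Y : interior_of rm (center X Y) <-> inside rm X Y.
Proof.
case: rm => [[[[a b] c] d] t]; rewrite /interior_of /inside /center.
cbn [fst snd]; rewrite /= !pos_lt; split; [lia|].
by move=> ?; split; lia.
Qed.

Lemma interior_of_inj rm1 rm2 : proper rm1 -> proper rm2 ->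
  interior_of rm1 = interior_of rm2 -> rect rm1 = rect rm2.
Proof.
move=> P1 P2 e.
have {}e X Y : inside rm1 X Y <-> inside rm2 X Y by rewrite -!interior_center e.
move: P1 P2 e; case: rm1 rm2 => [[[[a b] c] d] t] [[[[a' b'] c'] d'] t'].
room_simpl => P1 P2 e.
have := e (2 * a + 1)%BZ (2 * c + 1)%BZ; have := e (2 * a' + 1)%BZ (2 * c' + 1)%BZ.
have := e (2 * b - 1)%BZ (2 * d - 1)%BZ; have := e (2 * b' - 1)%BZ (2 * d' - 1)%BZ.
by move=> ? ? ? ?; congr (_, _, _, _); lia.
Qed.

Lemma interior_bounded rm : bounded_set (interior_of rm).
Proof.
case: rm => [[[[a b] c] d] t] /=.
exists (`|pos (2 * a)| + `|pos (2 * b)| + `|pos (2 * c)| + `|pos (2 * d)|); split.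
  by rewrite num_real.
move=> M HM [x y] /= [/andP[a1 b1] /andP[c1 d1]].
have := ler_norm (- pos (2 * a)); have := ler_norm (pos (2 * b)).
have := ler_norm (- pos (2 * c)); have := ler_norm (pos (2 * d)).
rewrite !normrN => ? ? ? ?.
have := normr_ge0 (pos (2 * a)); have := normr_ge0 (pos (2 * b)).
have := normr_ge0 (pos (2 * c)); have := normr_ge0 (pos (2 * d)).
move=> ? ? ? ?.
by rewrite prod_normE /= ge_max; apply/andP; split; apply/ler_normlP; split; lra.
Qed.

Definition covered_by (E : Z -> Z -> Z) (n : Z) (X Y : Z) : Prop := (0 <= E X Y <= n)%BZ.

(** * The bounded components are the closed rooms *)

Section Regions.
Variables (B : Z -> Z -> Prop) (N : Z) (E : Z -> Z -> Z) (l : seq room) (n : Z).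
Hypothesis T : tiling B N E l.
Let C := covered_by E n.
Hypothesis outer : forall X Y, (X mod 2 = 1)%BZ -> (Y mod 2 = 1)%BZ -> ~ B X Y ->
  exists dx dy, unit_step dx dy /\ ray_free C X Y dx dy.
Let A := grid C.
Let comp := connected_component (~` A).

Let center_free X Y : (X mod 2 = 1)%BZ -> (Y mod 2 = 1)%BZ -> ~ A (center X Y).
Proof. by move=> oX oY; apply: (cell_free (X := X) (Y := Y)); rewrite ?pos_center. Qed.

Let inner rm : rm \in l -> forall X Y, ((X + Y) mod 2 = 1)%BZ -> inside rm X Y -> ~ C X Y.
Proof. by move=> rml X Y par I; rewrite /C /covered_by (tl_inside (proj1 T) rml par I); lia. Qed.

Let border rm : rm \in l -> (time rm <= n)%BZ ->
  forall X Y, ((X + Y) mod 2 = 1)%BZ -> meets rm X Y -> ~ inside rm X Y -> C X Y.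
Proof.
move=> rml tn X Y par M I; have := tl_boundary (proj1 T) rml par M I.
by rewrite /C /covered_by; lia.
Qed.

Lemma outside_unbounded X Y : (X mod 2 = 1)%BZ -> (Y mod 2 = 1)%BZ -> ~ B X Y ->
  ~ bounded_set (comp (center X Y)).
Proof.
move=> oX oY nB; have [dx [dy [u free]]] := outer oX oY nB.
by apply: (ray_unbounded _ oX oY u free) => //; exact: center_free.
Qed.

(** Crossing last edges leads through rooms with strictly increasing closing stages, so all these
    edges are absent at stage [n]. As the stages are bounded by [N], the chain ends outside of [B],
    in an unbounded component. *)
Lemma incomplete_unbounded rm X Y : rm \in l -> (n < time rm)%BZ ->
  (X mod 2 = 1)%BZ -> (Y mod 2 = 1)%BZ -> inside rm X Y -> ~ bounded_set (comp (center X Y)).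
Proof.
have [k] : exists k : nat, (N - time rm < Z.of_nat k)%BZ.
  by exists (Z.to_nat (N - time rm + 1)); lia.
elim: k rm X Y => [|k IH] rm X Y Hk rml tn oX oY I.
  by have := tl_proper (proj1 T) rml; lia.
have [X0 [Y0 [dx [dy [oX0 oY0 u I0 [Et nx]]]]]] := proj2 T _ rml.
have P := proj1 (tl_proper (proj1 T) rml).
have -> : comp (center X Y) = comp (center X0 Y0).
  by apply: (interior_connected (inner rml)); apply/interior_center.
have nC : ~ C (X0 + dx)%BZ (Y0 + dy)%BZ by rewrite /C /covered_by Et; lia.
have -> : comp (center X0 Y0) = comp (center (X0 + 2 * dx) (Y0 + 2 * dy)).
  exact: comp_step.
case: nx => [nB|[rm' rml' [I' lt]]].
  by apply: outside_unbounded nB; lia.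
by apply: (IH rm') => //; lia.
Qed.

Theorem regionsE : internal_regions A =
  [set` [seq interior_of rm | rm : room <- l & (time rm <=? n)%BZ]].
Proof.
apply/seteqP; split=> [_ [[p nA ->] bnd]|_ /= /mapP[rm + ->]].
  have [X [Y [oX oY e bX bY]]] := comp_center nA.
  have [BXY|nB] := pselect (B X Y); last first.
    by case: (outside_unbounded oX oY nB); rewrite -[comp _]e.
  have [rm rml I] := tl_cover (proj1 T) oX oY BXY.
  have P := proj1 (tl_proper (proj1 T) rml).
  have [tn|tn] := Z_le_gt_dec (time rm) n; last first.
    by case: (incomplete_unbounded rml _ oX oY I); [lia|rewrite -[comp _]e].
  apply/mapP; exists rm; first by rewrite mem_filter rml andbT; lia.
  apply: (room_component P (border rml tn) (inner rml)).
  (* The point [p] is only known to lie in the closure of a cell of the room; it is interior because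
     the frontier of a closed room is covered and [p] is not. *)
  apply: contrapT => nI; apply: nA; move: I nI.
  have := @frontier_covered C rm P (border rml tn) p.
  case: (rm) => [[[[a b] c] d] t] fr [I1 I2] nI; apply: fr nI.
    by case/andP: bX => ? ?; apply/andP; split; [apply: le_trans (_ : pos (X - 1) <= _)|apply: le_trans (_ : _ <= pos (X + 1)) _] => //; rewrite pos_le; lia.
  by case/andP: bY => ? ?; apply/andP; split; [apply: le_trans (_ : pos (Y - 1) <= _)|apply: le_trans (_ : _ <= pos (Y + 1)) _] => //; rewrite pos_le; lia.
rewrite mem_filter => /andP[tn rml].
have {}tn : (time rm <= n)%BZ by lia.
have P := proj1 (tl_proper (proj1 T) rml).
have [p Ip] : exists p, interior_of rm p.
  case: (rm) P => [[[[a b] c] d] t] P; exists (center (2 * a + 1) (2 * c + 1)).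
  by apply/interior_center; move: P; room_simpl; lia.
have nA := interior_free (inner rml) Ip.
split; last exact: interior_bounded.
by exists p => //; rewrite (room_component P (border rml tn) (inner rml) Ip).
Qed.

Lemma regions_finite : finite_set (internal_regions A).
Proof. by rewrite regionsE; exact: finite_seq. Qed.

Lemma regions_rectangle D : internal_regions A D -> open_rectangle D.
Proof.
rewrite regionsE /= => /mapP[rm + ->]; rewrite mem_filter => /andP[_ rml].
have [+ _] := tl_proper (proj1 T) rml; case: rm {rml} => [[[[a b] c] d] t] /= P.
exists (pos (2 * a)), (pos (2 * b)), (pos (2 * c)), (pos (2 * d)).
by rewrite !pos_lt; split=> //; lia.
Qed.

Lemma regions_card : #|` fset_set (internal_regions A)| = count (fun rm => time rm <=? n)%BZ l.
Proof.
rewrite regionsE.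
set s := map _ _.
have -> : [set` s] = [set` [fset x in s]%fset].
  by apply/seteqP; split=> x /=; rewrite inE.
rewrite set_fsetK card_fseq undup_id ?size_map ?size_filter //.
have U : uniq [seq rect rm | rm : room <- l & (time rm <=? n)%BZ].
  by apply: subseq_uniq (tl_uniq (proj1 T)); apply: map_subseq; exact: filter_subseq.
rewrite /s map_inj_in_uniq; first exact: map_uniq U.
move=> r1 r2; rewrite !mem_filter => /andP[t1 r1l] /andP[t2 r2l] e.
have eR := interior_of_inj (proj1 (tl_proper (proj1 T) r1l)) (proj1 (tl_proper (proj1 T) r2l)) e.
exact: uniq_map_inj (tl_uniq (proj1 T)) _ _ r1l r2l eR.
Qed.
End Regions.
End Grid.

(** * The structures as sets of sites *)

(** [(u, v)] is the centre of a toothpick that would have [(x, y)] as an end; such a toothpick is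
    perpendicular to the one centred at [(x, y)]. *)
Definition parent (par x y u v : Z) : Prop :=
  if ((x + y + par) mod 2 =? 0)%BZ then (u = x /\ (v = y - 1 \/ v = y + 1))%BZ
  else (v = y /\ (u = x - 1 \/ u = x + 1))%BZ.

Section Sites.
Variable R : realType.
Local Notation pos := (@pos R).

Definition site (x y : Z) : R * R := (pos (2 * x), pos (2 * y)).

Lemma site_inj x y u v : site x y = site u v -> x = u /\ y = v.
Proof.
move=> e; have := pos_inj (congr1 fst e : pos (2 * x) = pos (2 * u)).
have := pos_inj (congr1 snd e : pos (2 * y) = pos (2 * v)); lia.
Qed.

Lemma site0 : site 0 0 = (0, 0).
Proof. by rewrite /site /pos mul0r. Qed.

Definition toothpick (par x y : Z) : segment R :=
  Segment ((x + y + par) mod 2 =? 0)%BZ (site x y) 1.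

Definition sites (f : Z -> Z -> Z) (tp : Z -> Z -> segment R) (n : Z) : set (segment R) :=
  [set t | exists x y, (0 <= f x y <= n)%BZ /\ t = tp x y].

Section Grow.
Variables (allowed : set (segment R)) (par : Z) (L : Z -> Z -> Prop).
Variables (f : Z -> Z -> Z) (tp : Z -> Z -> segment R) (n : Z).
Hypothesis n0 : (0 <= n)%BZ.
Hypothesis ends1 : forall x y u v, L x y -> parent par x y u v -> seg_ends (tp u v) (site x y).
Hypothesis ends2 : forall u v p, seg_ends (tp u v) p -> allowed (perp_toothpick (tp u v) p) ->
  exists x y, [/\ L x y, parent par x y u v, p = site x y & perp_toothpick (tp u v) p = tp x y].
Hypothesis ends3 : forall x y u v, L x y -> seg_ends (tp u v) (site x y) -> parent par x y u v.
Hypothesis mid1 : forall x y u v, L x y -> midpoint (tp u v) = site x y -> u = x /\ v = y.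
Hypothesis mid2 : forall x y, L x y -> midpoint (tp x y) = site x y.
Hypothesis tp_allowed : forall x y, L x y -> allowed (tp x y).
Hypothesis tp_perp : forall x y u v, L x y -> parent par x y u v ->
  perp_toothpick (tp u v) (site x y) = tp x y.
Hypothesis tp_inj : forall x y u v, tp x y = tp u v -> x = u /\ y = v.
Hypothesis newL : forall x y, f x y = (n + 1)%BZ -> L x y.
Hypothesis rule : forall x y, L x y -> f x y = (n + 1)%BZ <-> ~ (0 <= f x y <= n)%BZ /\
  exists u v, [/\ parent par x y u v, (0 <= f u v <= n)%BZ &
    forall u' v', parent par x y u' v' -> (0 <= f u' v' <= n)%BZ -> u' = u /\ v' = v].

(** An end at a site is exposed when no other born toothpick ends there, so the parent is unique,
    and none is centred there, so the site is unborn. [L] is the set of sites where toothpicks are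
    allowed, and [tp] is abstract in order to include the half-toothpick. *)
Lemma grow_sites : grow allowed (sites f tp n) = sites f tp (n + 1).
Proof.
apply/seteqP; split=> [t [[x [y [fxy ->]]]|[al [s [e [[u [v [fuv ->]]] [se ex] tE]]]]]|
  t [x [y [fxy ->]]]].
- by exists x, y; split=> //; lia.
- rewrite tE in al; have [x [y [Lxy pxy pE perpE]]] := ends2 se al.
  rewrite tE perpE; exists x, y; split=> //.
  suff : f x y = (n + 1)%BZ by lia.
  apply/(rule Lxy); split.
    move=> fxy.
    have [tt|tt] := pselect (tp x y = tp u v).
      by have [? ?] := tp_inj tt; subst u v; move: pxy; rewrite /parent; case: ifP; lia.
    have [_] := ex (tp x y) (ex_intro _ x (ex_intro _ y (conj fxy erefl))) tt.
    by rewrite mid2.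
  exists u, v; split=> // u' v' p' f'; apply: contrapT => ne.
  have [tt|tt] := pselect (tp u' v' = tp u v); first exact: ne (tp_inj tt).
  have [+ _] := ex (tp u' v') (ex_intro _ u' (ex_intro _ v' (conj f' erefl))) tt.
  by apply; rewrite pE; exact: ends1.
- have [old|new] : (0 <= f x y <= n \/ f x y = n + 1)%BZ by lia.
    by left; exists x, y.
  have Lxy := newL new.
  have [noff [u [v [puv fuv un]]]] := (rule Lxy).1 new.
  right; split; first exact: tp_allowed.
  exists (tp u v), (site x y); split; [by exists u, v| |by rewrite tp_perp].
  split; first exact: ends1.
  move=> _ [u' [v' [f' ->]]] ne; split=> [se|e].
    by have [? ?] := un _ _ (ends3 Lxy se) f'; subst u' v'.
  by have [? ?] := mid1 Lxy (esym e); subst u' v'.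
Qed.
End Grow.

Lemma pos_half X : pos X - 1 / 2 = pos (X - 2).
Proof. by rewrite -Z.add_opp_r posD posN /pos; congr (_ - _); rewrite -[_%:~R]/(2 : R); field. Qed.

Lemma pos_half' X : pos X + 1 / 2 = pos (X + 2).
Proof. by rewrite posD /pos; congr (_ + _); rewrite -[_%:~R]/(2 : R); field. Qed.

Lemma toothpick_ends par u v p : seg_ends (toothpick par u v) p <->
  exists x y, parent par x y u v /\ p = site x y.
Proof.
cbv beta iota zeta delta [seg_ends toothpick site midpoint horizontal len].
rewrite !pos_half !pos_half' /parent /site.
case: ifP => h.
- split=> [[->|->]|[x [y [+ ->]]]].
  + by exists (u - 1)%BZ, v; split; [case: ifP; lia|congr (pos _, _); lia].
  + by exists (u + 1)%BZ, v; split; [case: ifP; lia|congr (pos _, _); lia].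
  case: ifP => h'; first lia.
  move=> [-> [->|->]]; [right|left]; congr (pos _, _); lia.
- split=> [[->|->]|[x [y [+ ->]]]].
  + by exists u, (v - 1)%BZ; split; [case: ifP; lia|congr (_, pos _); lia].
  + by exists u, (v + 1)%BZ; split; [case: ifP; lia|congr (_, pos _); lia].
  case: ifP => h'; last lia.
  move=> [-> [->|->]]; [right|left]; congr (_, pos _); lia.
Qed.

Lemma toothpick_perp par x y u v : parent par x y u v ->
  perp_toothpick (toothpick par u v) (site x y) = toothpick par x y.
Proof.
rewrite /perp_toothpick /toothpick /parent /= => p; congr Segment.
by move: p; case: ifP; lia.
Qed.

Lemma toothpick_inj par x y u v : toothpick par x y = toothpick par u v -> x = u /\ y = v.
Proof. by case=> _ ? ?; apply: site_inj; congr (_, _). Qed.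

Lemma norm_half X (x : R) : (`|x - pos X| <= 1 / 2) = (pos (X - 2) <= x <= pos (X + 2)).
Proof. by rewrite ler_distl pos_half pos_half'. Qed.

Lemma toothpick_points par x y p : seg_points (toothpick par x y) p <->
  if ((x + y + par) mod 2 =? 0)%BZ then on_edge (2 * x - 1) (2 * y) p \/ on_edge (2 * x + 1) (2 * y) p
  else on_edge (2 * x) (2 * y - 1) p \/ on_edge (2 * x) (2 * y + 1) p.
Proof.
case: p => px py.
cbv beta iota zeta delta [seg_points toothpick site midpoint horizontal len mkset fst snd].
rewrite !norm_half; cbv beta iota zeta delta [on_edge fst snd].
case: ifP => h.
- rewrite (_ : ((2 * y) mod 2 =? 0)%BZ = true); last lia.
  replace (2 * x - 1 - 1)%BZ with (2 * x - 2)%BZ by lia.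
  replace (2 * x - 1 + 1)%BZ with (2 * x)%BZ by lia.
  replace (2 * x + 1 - 1)%BZ with (2 * x)%BZ by lia.
  replace (2 * x + 1 + 1)%BZ with (2 * x + 2)%BZ by lia.
  have l1 : pos (2 * x - 2) <= pos (2 * x) by rewrite pos_le; lia.
  have l2 : pos (2 * x) <= pos (2 * x + 2) by rewrite pos_le; lia.
  split.
    move=> [/andP[a b] ->]; have /orP[c|c] := le_total px (pos (2 * x)).
      by left; rewrite a c.
    by right; rewrite b c.
  by case=> -[/andP[a b] ->]; split=> //; apply/andP; split=> //; [exact: le_trans l2|exact: le_trans l1 _].
- rewrite (_ : ((2 * y - 1) mod 2 =? 0)%BZ = false); last lia.
  rewrite (_ : ((2 * y + 1) mod 2 =? 0)%BZ = false); last lia.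
  replace (2 * y - 1 - 1)%BZ with (2 * y - 2)%BZ by lia.
  replace (2 * y - 1 + 1)%BZ with (2 * y)%BZ by lia.
  replace (2 * y + 1 - 1)%BZ with (2 * y)%BZ by lia.
  replace (2 * y + 1 + 1)%BZ with (2 * y + 2)%BZ by lia.
  have l1 : pos (2 * y - 2) <= pos (2 * y) by rewrite pos_le; lia.
  have l2 : pos (2 * y) <= pos (2 * y + 2) by rewrite pos_le; lia.
  split.
    move=> [-> /andP[a b]]; have /orP[c|c] := le_total py (pos (2 * y)).
      by left; rewrite a c.
    by right; rewrite b c.
  by case=> -[-> /andP[a b]]; split=> //; apply/andP; split=> //; [exact: le_trans l2|exact: le_trans l1 _].
Qed.

(** * The toothpick structure as a set of sites and as a grid *)

Section Tooth.
Variables (m : Z) (f : Z -> Z -> Z).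
Hypothesis F : tooth_sites m f.

(** If both parents are born by stage [n], either they are simultaneous and block the site, or the
    site was born one stage after the earlier one, hence by stage [n]. So a birth at [n + 1] means
    exactly one born parent. *)
Lemma tooth_birth n x y : (1 <= n < 2 * m)%BZ -> f x y = (n + 1)%BZ <-> ~ (0 <= f x y <= n)%BZ /\
  exists u v, [/\ parent 1 x y u v, (0 <= f u v <= n)%BZ &
    forall u' v', parent 1 x y u' v' -> (0 <= f u' v' <= n)%BZ -> u' = u /\ v' = v].
Proof.
move=> hn; have [[-> ->]|ne] := pselect (x = 0%BZ /\ y = 0%BZ).
  by rewrite (ts_init F); split=> [|[]]; lia.
have Rg := ts_range F; have [H0 H1] : tooth_rule m f x y := ts_rule F ne.
rewrite /parent; case par : ((x + y + 1) mod 2 =? 0)%BZ.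
- have {H0 H1} := H1 ltac:(lia).
  have := Rg x (y - 1)%BZ; have := Rg x (y + 1)%BZ; have := Rg x y.
  have [? ?] := @born_byP (2 * m) (f x (y - 1)) (f x (y + 1)) ltac:(have := Rg x (y - 1)%BZ; lia) ltac:(have := Rg x (y + 1)%BZ; lia).
  move=> r1 r2 r3 e; split.
    move=> fn; split; first lia.
    have [on|on] : (0 <= f x (y - 1) <= n /\ ~ (0 <= f x (y + 1) <= n) \/ 0 <= f x (y + 1) <= n /\ ~ (0 <= f x (y - 1) <= n))%BZ by lia.
      by exists x, (y - 1)%BZ; split; [lia|lia|move=> u' v' [-> [->|->]]; lia].
    by exists x, (y + 1)%BZ; split; [lia|lia|move=> u' v' [-> [->|->]]; lia].
  move=> [off [u [v [[-> [->|->]] fu un]]]].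
    have := un x (y + 1)%BZ ltac:(lia); lia.
  have := un x (y - 1)%BZ ltac:(lia); lia.
- have {H0 H1} := H0 ltac:(lia).
  have := Rg (x - 1)%BZ y; have := Rg (x + 1)%BZ y; have := Rg x y.
  have [? ?] := @born_byP (2 * m) (f (x - 1)%BZ y) (f (x + 1)%BZ y) ltac:(have := Rg (x - 1)%BZ y; lia) ltac:(have := Rg (x + 1)%BZ y; lia).
  move=> r1 r2 r3 e; split.
    move=> fn; split; first lia.
    have [on|on] : (0 <= f (x - 1) y <= n /\ ~ (0 <= f (x + 1) y <= n) \/ 0 <= f (x + 1) y <= n /\ ~ (0 <= f (x - 1) y <= n))%BZ by lia.
      by exists (x - 1)%BZ, y; split; [lia|lia|move=> u' v' [-> [->|->]]; lia].
    by exists (x + 1)%BZ, y; split; [lia|lia|move=> u' v' [-> [->|->]]; lia].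
  move=> [off [u [v [[-> [->|->]] fu un]]]].
    have := un (x + 1)%BZ y ltac:(lia); lia.
  have := un (x - 1)%BZ y ltac:(lia); lia.
Qed.

Lemma tooth_structure_sites n : (Z.of_nat n < 2 * m)%BZ ->
  toothpick_structure R n.+1 = sites f (toothpick 1) (Z.of_nat n.+1).
Proof.
have m2 := ts_m F.
elim: n => [|n IH] hn.
  apply/seteqP; split=> [t /= ->|t [x [y [fxy ->]]]].
    exists 0%BZ, 0%BZ; rewrite (ts_init F); split; first lia.
    by rewrite /toothpick site0.
  have [-> ->] : x = 0%BZ /\ y = 0%BZ by have := @ts_supp _ _ F x y; lia.
  by rewrite /toothpick site0; exact: erefl.
have -> : Z.of_nat n.+2 = (Z.of_nat n.+1 + 1)%BZ by lia.
rewrite -(@grow_sites setT 1 (fun _ _ => True)); try lia.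
- by rewrite -IH //; lia.
- by move=> x y u v _ p; apply/toothpick_ends; exists x, y.
- move=> u v p /toothpick_ends[x [y [pxy ->]]] _; exists x, y; split=> //.
  exact: toothpick_perp.
- by move=> x y u v _ /toothpick_ends[x' [y' [pxy /site_inj[-> ->]]]].
- by move=> x y u v _ /site_inj.
- by [].
- by move=> x y _; exact: Logic.I.
- by move=> x y u v _; exact: toothpick_perp.
- exact: toothpick_inj.
- by move=> x y _; apply: tooth_birth; lia.
Qed.

Lemma tooth_covered n : covered (sites f (toothpick 1) n) = grid (covered_by (tooth_edge f) n).
Proof.
apply/seteqP; split=> p.
  move=> [t [x [y [fxy ->]]] /toothpick_points]; case: ifP => par [] e.
  - exists (2 * x - 1)%BZ, (2 * y)%BZ; split=> //; first lia.
    by rewrite /covered_by (@tooth_edge_h _ _ _ (x - 1) y); try lia; case: ifP => ?; rewrite ?Z.sub_add; lia.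
  - exists (2 * x + 1)%BZ, (2 * y)%BZ; split=> //; first lia.
    by rewrite /covered_by (@tooth_edge_h _ _ _ x y); try lia; case: ifP => ?; lia.
  - exists (2 * x)%BZ, (2 * y - 1)%BZ; split=> //; first lia.
    by rewrite /covered_by (@tooth_edge_v _ _ _ x (y - 1)); try lia; case: ifP => ?; rewrite ?Z.sub_add; lia.
  - exists (2 * x)%BZ, (2 * y + 1)%BZ; split=> //; first lia.
    by rewrite /covered_by (@tooth_edge_v _ _ _ x y); try lia; case: ifP => ?; lia.
move=> [X [Y [/odd_sumP[[x [y [-> ->]]]|[x [y [-> ->]]]]]]]; rewrite /covered_by.
- rewrite (@tooth_edge_h _ _ _ x y) //; case: ifP => par c e.
    exists (toothpick 1 (x + 1) y); first by exists (x + 1)%BZ, y.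
    apply/toothpick_points; rewrite ifT; last lia.
    by left; rewrite (_ : 2 * (x + 1) - 1 = 2 * x + 1)%BZ //; lia.
  exists (toothpick 1 x y); first by exists x, y.
  by apply/toothpick_points; rewrite ifT; [right|lia].
- rewrite (@tooth_edge_v _ _ _ x y) //; case: ifP => par c e.
    exists (toothpick 1 x y); first by exists x, y.
    by apply/toothpick_points; rewrite ifF; [right|lia].
  exists (toothpick 1 x (y + 1)); first by exists x, (y + 1)%BZ.
  apply/toothpick_points; rewrite ifF; last lia.
  by left; rewrite (_ : 2 * (y + 1) - 1 = 2 * y + 1)%BZ //; lia.
Qed.

Lemma tooth_outer n X Y : (X mod 2 = 1)%BZ -> (Y mod 2 = 1)%BZ -> ~ tooth_box m X Y ->
  exists dx dy, unit_step dx dy /\ ray_free (covered_by (tooth_edge f) n) X Y dx dy.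
Proof.
have m2 := ts_m F; rewrite /tooth_box /ray_free /covered_by => oX oY out.
have off := ts_off F.
have [?|[?|[?|?]]] : (2 * (m - 1) < X \/ X < - (2 * (m - 1)) \/ 2 * m < Y \/ Y < - (2 * m))%BZ by lia.
- exists 1%BZ, 0%BZ; split=> // k k0; rewrite (@tooth_edge_v _ _ _ (X / 2 + k + 1) (Y / 2)); try lia.
  by rewrite !off; try lia; case: ifP => ?; lia.
- exists (-1)%BZ, 0%BZ; split=> // k k0; rewrite (@tooth_edge_v _ _ _ (X / 2 - k) (Y / 2)); try lia.
  by rewrite !off; try lia; case: ifP => ?; lia.
- exists 0%BZ, 1%BZ; split=> // k k0; rewrite (@tooth_edge_h _ _ _ (X / 2) (Y / 2 + k + 1)); try lia.
  by rewrite !off; try lia; case: ifP => ?; lia.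
- exists 0%BZ, (-1)%BZ; split=> // k k0; rewrite (@tooth_edge_h _ _ _ (X / 2) (Y / 2 - k)); try lia.
  by rewrite !off; try lia; case: ifP => ?; lia.
Qed.
End Tooth.
End Sites.

(** * The corner structure as a set of sites and as a grid *)

Section Corner.
Variable R : realType.
Local Notation pos := (@pos R).
Local Notation site := (@site R).

Definition corner_toothpick (x y : Z) : segment R :=
  if ((x =? 0) && (y =? 0))%BZ then Segment true (4^-1, 0) 2^-1 else toothpick R 0 x y.

Definition open_quadrants (x y : Z) : Prop := (1 <= x \/ 1 <= y)%BZ.

Lemma corner_toothpickE x y : ~ (x = 0 /\ y = 0)%BZ -> corner_toothpick x y = toothpick R 0 x y.
Proof. by move=> ne; rewrite /corner_toothpick ifF //; lia. Qed.

Lemma pos0 : pos 0 = 0. Proof. by rewrite /pos mul0r. Qed.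

Lemma pos2 : pos 2 = 2^-1.
Proof. by rewrite /pos -[(int_of_Z _)%:~R]/(2 : R); field. Qed.

Lemma corner_toothpick0_ends p : seg_ends (corner_toothpick 0 0) p <-> p = site 0 0 \/ p = site 1 0.
Proof.
rewrite /corner_toothpick /= /seg_ends site0; cbn [midpoint horizontal len].
have -> : (4^-1 - 2^-1 / 2 : R) = 0 by field.
have -> : (4^-1 + 2^-1 / 2 : R) = pos (2 * 1).
  by rewrite /pos -[(int_of_Z _)%:~R]/(2 : R); field.
by rewrite -pos0.
Qed.

Lemma open_quadrants_allowed x y (h : bool) : open_quadrants x y ->
  corner_allowed R (Segment h (site x y) 1).
Proof.
move=> L; split.
  apply/seteqP; split=> // -[px py] [].
  cbv beta iota zeta delta [seg_points site midpoint horizontal len mkset third_quadrant fst snd].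
  rewrite !norm_half => Hp [x0 y0].
  rewrite -pos0 in x0 y0.
  case: L => L; case: h Hp => [[/andP[a _] b]|[b /andP[a _]]].
  - by have := between_tl a x0; lia.
  - by move: x0; rewrite b pos_lt; lia.
  - by move: y0; rewrite b pos_lt; lia.
  - by have := between_tl a y0; lia.
move=> [px py] [].
cbv beta iota zeta delta [seg_points seg_ends site midpoint horizontal len mkset negative_axes fst snd].
rewrite !norm_half !pos_half !pos_half' => + Hn.
case: h => [[/andP[a _] b]|[b /andP[a _]]].
- case: Hn => -[p1 p2].
    by move: p2 p1; rewrite b -pos0 => /pos_inj e p1; have := between_tl a p1; rewrite /open_quadrants in L; lia.
  left; move: p1 p2 a; rewrite b -pos0 => ->; rewrite pos_lt pos_le => ? ?.
  by congr (pos _, _); rewrite /open_quadrants in L; lia.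
- case: Hn => -[p1 p2]; last first.
    by move: p1 p2; rewrite b -pos0 => /pos_inj e p1; have := between_tl a p1; rewrite /open_quadrants in L; lia.
  left; move: p1 p2 a; rewrite b -pos0 => + ->; rewrite pos_lt pos_le => ? ?.
  by congr (_, pos _); rewrite /open_quadrants in L; lia.
Qed.

(** For [x, y <= 0], the point at distance 1/4 to the left of the centre, or below it for a vertical
    toothpick, is on the toothpick but not an end of it, and it is in the third quadrant or on a
    negative axis. *)
Lemma allowed_open_quadrants x y (h : bool) :
  corner_allowed R (Segment h (site x y) 1) -> open_quadrants x y.
Proof.
move=> [H3 Ha]; apply: contrapT => nL.
have {nL} [x0 y0] : (x <= 0 /\ y <= 0)%BZ by rewrite /open_quadrants in nL; lia.
case: h H3 Ha => H3 Ha.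
- have onp : seg_points (Segment true (site x y) 1) (pos (2 * x - 1), pos (2 * y)).
    cbv beta iota zeta delta [seg_points site midpoint horizontal len mkset fst snd].
    by split=> //; rewrite norm_half !pos_le; lia.
  have [y0'|y0'] : (y < 0 \/ y = 0)%BZ by lia.
    have : set0 (pos (2 * x - 1), pos (2 * y)).
      by rewrite -H3; split=> //; rewrite /third_quadrant /mkset; cbn [fst snd]; rewrite -pos0 !pos_lt; lia.
    by [].
  have : negative_axes R (pos (2 * x - 1), pos (2 * y)).
    by left; cbn [fst snd]; rewrite -pos0 !pos_lt y0'; split; [lia|].
  move=> na; have := Ha _ (conj onp na).
  cbv beta iota zeta delta [seg_ends site midpoint horizontal len].
  rewrite pos_half pos_half' => -[] e.
    by have := pos_inj (congr1 fst e : pos (2 * x - 1) = pos (2 * x - 2)); lia.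
  by have := pos_inj (congr1 fst e : pos (2 * x - 1) = pos (2 * x + 2)); lia.
- have onp : seg_points (Segment false (site x y) 1) (pos (2 * x), pos (2 * y - 1)).
    cbv beta iota zeta delta [seg_points site midpoint horizontal len mkset fst snd].
    by split=> //; rewrite norm_half !pos_le; lia.
  have [x0'|x0'] : (x < 0 \/ x = 0)%BZ by lia.
    have : set0 (pos (2 * x), pos (2 * y - 1)).
      by rewrite -H3; split=> //; rewrite /third_quadrant /mkset; cbn [fst snd]; rewrite -pos0 !pos_lt; lia.
    by [].
  have : negative_axes R (pos (2 * x), pos (2 * y - 1)).
    by right; cbn [fst snd]; rewrite -pos0 !pos_lt x0'; split; [|lia].
  move=> na; have := Ha _ (conj onp na).
  cbv beta iota zeta delta [seg_ends site midpoint horizontal len].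
  rewrite pos_half pos_half' => -[] e.
    by have := pos_inj (congr1 snd e : pos (2 * y - 1) = pos (2 * y - 2)); lia.
  by have := pos_inj (congr1 snd e : pos (2 * y - 1) = pos (2 * y + 2)); lia.
Qed.

Section CornerSites.
Variables (m : Z) (f : Z -> Z -> Z).
Hypothesis F : corner_sites m f.

Lemma corner_birth n x y : (0 <= n < 2 * m - 1)%BZ -> open_quadrants x y ->
  f x y = (n + 1)%BZ <-> ~ (0 <= f x y <= n)%BZ /\
  exists u v, [/\ parent 0 x y u v, (0 <= f u v <= n)%BZ &
    forall u' v', parent 0 x y u' v' -> (0 <= f u' v' <= n)%BZ -> u' = u /\ v' = v].
Proof.
have m2 := cs_m F; move=> hn L.
have Rg := cs_range F.
(* At the exceptional site both sides are false: the upper parent [(m, 1 - m)] is born at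
   [2 * m - 1], later than [n], and the lower one never. *)
have [[-> ->]|ne] := pselect (x = m /\ y = - m)%BZ.
  rewrite (cs_off F) //; try lia; split; first lia.
  move=> [_ [u [v []]]]; rewrite /parent ifT; last lia.
  move=> [-> [->|->]].
    by rewrite (cs_off F); lia.
  rewrite (_ : - m + 1 = 1 - m)%BZ; last lia.
  by rewrite (cs_right F); try lia; case: ifP; lia.
have [H0 H1] : _ /\ _ := cs_rule F L ne.
rewrite /parent; case par : ((x + y + 0) mod 2 =? 0)%BZ.
- have {H0 H1} := H0 ltac:(lia).
  have := Rg x (y - 1)%BZ; have := Rg x (y + 1)%BZ; have := Rg x y.
  have [? ?] := @born_byP (2 * m) (f x (y - 1)) (f x (y + 1)) ltac:(have := Rg x (y - 1)%BZ; lia) ltac:(have := Rg x (y + 1)%BZ; lia).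
  move=> r1 r2 r3 e; split.
    move=> fn; split; first lia.
    have [on|on] : (0 <= f x (y - 1) <= n /\ ~ (0 <= f x (y + 1) <= n) \/ 0 <= f x (y + 1) <= n /\ ~ (0 <= f x (y - 1) <= n))%BZ by lia.
      by exists x, (y - 1)%BZ; split; [lia|lia|move=> u' v' [-> [->|->]]; lia].
    by exists x, (y + 1)%BZ; split; [lia|lia|move=> u' v' [-> [->|->]]; lia].
  move=> [off [u [v [[-> [->|->]] fu un]]]].
    have := un x (y + 1)%BZ ltac:(lia); lia.
  have := un x (y - 1)%BZ ltac:(lia); lia.
- have {H0 H1} := H1 ltac:(lia).
  have := Rg (x - 1)%BZ y; have := Rg (x + 1)%BZ y; have := Rg x y.
  have [? ?] := @born_byP (2 * m) (f (x - 1)%BZ y) (f (x + 1)%BZ y) ltac:(have := Rg (x - 1)%BZ y; lia) ltac:(have := Rg (x + 1)%BZ y; lia).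
  move=> r1 r2 r3 e; split.
    move=> fn; split; first lia.
    have [on|on] : (0 <= f (x - 1) y <= n /\ ~ (0 <= f (x + 1) y <= n) \/ 0 <= f (x + 1) y <= n /\ ~ (0 <= f (x - 1) y <= n))%BZ by lia.
      by exists (x - 1)%BZ, y; split; [lia|lia|move=> u' v' [-> [->|->]]; lia].
    by exists (x + 1)%BZ, y; split; [lia|lia|move=> u' v' [-> [->|->]]; lia].
  move=> [off [u [v [[-> [->|->]] fu un]]]].
    have := un (x + 1)%BZ y ltac:(lia); lia.
  have := un (x - 1)%BZ y ltac:(lia); lia.
Qed.

Lemma corner_structure_sites n : (Z.of_nat n < 2 * m)%BZ ->
  corner_structure R n = sites f corner_toothpick (Z.of_nat n).
Proof.
have m2 := cs_m F.
elim: n => [|n IH] hn.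
  apply/seteqP; split=> [t /= ->|t [x [y [fxy ->]]]].
    by exists 0%BZ, 0%BZ; rewrite (cs_origin F); split.
  by have [-> ->] : x = 0%BZ /\ y = 0%BZ by have := @cs_supp _ _ F x y; lia.
have -> : Z.of_nat n.+1 = (Z.of_nat n + 1)%BZ by lia.
(* The midpoint of the half-toothpick is halfway between two sites, so it never occupies an end. *)
have mid0 x y : open_quadrants x y -> midpoint (corner_toothpick 0 0) <> site x y.
  move=> L /(congr1 fst) /= e.
  have : pos 1 = pos (2 * x) by rewrite -e /pos div1r.
  by move/pos_inj; lia.
rewrite -(@grow_sites _ (corner_allowed R) 0 open_quadrants); first by rewrite -IH //; lia.
- lia.
- move=> x y u v L p.
  have [[? ?]|ne] := pselect (u = 0 /\ v = 0)%BZ; last first.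
    by rewrite corner_toothpickE //; apply/toothpick_ends; exists x, y.
  subst u v; apply/corner_toothpick0_ends; right.
  by move: p; rewrite /parent; case: ifP => ?; rewrite /open_quadrants in L; [lia|move=> p; congr (site _ _); lia].
- move=> u v p.
  have [[? ?]|ne] := pselect (u = 0 /\ v = 0)%BZ; last first.
    rewrite corner_toothpickE // => /toothpick_ends[x [y [pxy ->]]].
    rewrite toothpick_perp // => al; have L := allowed_open_quadrants al.
    exists x, y; split=> //; rewrite ?toothpick_perp // corner_toothpickE //.
    by rewrite /open_quadrants in L; lia.
  (* At the end [(0, 0)] the perpendicular toothpick would run along the negative [y]-axis; only the
     end [(1, 0)] can grow. *)
  subst u v => /corner_toothpick0_ends[->|->] al.
    by have := allowed_open_quadrants al; rewrite /open_quadrants; lia.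
  exists 1%BZ, 0%BZ; split=> //; first by left.
  by rewrite /parent /=; lia.
- move=> x y u v L.
  have [[? ?]|ne] := pselect (u = 0 /\ v = 0)%BZ; last first.
    by rewrite corner_toothpickE // => /toothpick_ends[x' [y' [pxy /site_inj[-> ->]]]].
  subst u v => /corner_toothpick0_ends[] /site_inj[e1 e2]; subst x y.
    by rewrite /open_quadrants in L; lia.
  by rewrite /parent /=; lia.
- move=> x y u v L.
  have [[? ?]|ne] := pselect (u = 0 /\ v = 0)%BZ; last first.
    by rewrite corner_toothpickE // => /site_inj.
  by subst u v => /(mid0 _ _ L).
- by move=> x y L; rewrite corner_toothpickE //; rewrite /open_quadrants in L; lia.
- move=> x y L; rewrite corner_toothpickE; last by rewrite /open_quadrants in L; lia.
  exact: open_quadrants_allowed.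
- move=> x y u v L p.
  rewrite [corner_toothpick x y]corner_toothpickE; last by rewrite /open_quadrants in L; lia.
  have [[? ?]|ne] := pselect (u = 0 /\ v = 0)%BZ; last first.
    by rewrite corner_toothpickE // toothpick_perp.
  subst u v; rewrite -(toothpick_perp R p) /perp_toothpick.
  by congr Segment.
- move=> x y u v.
  have [[? ?]|ne] := pselect (u = 0 /\ v = 0)%BZ; last first.
    have [[? ?]|ne'] := pselect (x = 0 /\ y = 0)%BZ.
      subst x y; rewrite [corner_toothpick u v]corner_toothpickE // /corner_toothpick /= => -[_ _ _ e].
      by exfalso; move: e; lra.
    by rewrite !corner_toothpickE //; exact: toothpick_inj.
  subst u v; have [[? ?]|ne'] := pselect (x = 0 /\ y = 0)%BZ; first by [].
  rewrite [corner_toothpick x y]corner_toothpickE // /corner_toothpick /= => -[_ _ _ e].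
  by exfalso; move: e; lra.
- move=> x y e; have S := @cs_supp _ _ F x y.
  have [[? ?]|ne] := pselect (x = 0 /\ y = 0)%BZ; last by rewrite /open_quadrants; lia.
  by subst x y; have := cs_origin F; lia.
- by move=> x y L; apply: corner_birth L; lia.
Qed.

Lemma corner_covered n : (0 <= n)%BZ ->
  negative_axes R `|` covered (sites f corner_toothpick n) = grid (covered_by (corner_edge f) n).
Proof.
have m2 := cs_m F; move=> n0.
(* The closed wall edges contain the origin, which is not in [negative_axes] but is an end of the
   half-toothpick. *)
have origin_in p : p = (0, 0) -> covered (sites f corner_toothpick n) p.
  move=> ->; exists (corner_toothpick 0 0); first by exists 0%BZ, 0%BZ; rewrite (cs_origin F).
  rewrite /corner_toothpick /seg_points /=; split=> //.
  by rewrite sub0r normrN ger0_norm ?invr_ge0 ?ler0n //; lra.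
apply/seteqP; split=> p.
  move=> [[[p1 p2]|[p1 p2]]|[t [x [y [fxy ->]]]]].
  - have [X [oX /andP[a b]]] := odd_floor p.1.
    have ? : (X < 0)%BZ by rewrite -pos0 in p1; have := between_tl a p1; lia.
    exists X, 0%BZ; split; [lia| |by rewrite /on_edge /= a (ltW b) p2 -pos0].
    by rewrite /covered_by /corner_edge ifT; lia.
  - have [X [oX /andP[a b]]] := odd_floor p.2.
    have ? : (X < 0)%BZ by rewrite -pos0 in p2; have := between_tl a p2; lia.
    exists 0%BZ, X; split; [lia| |].
      by rewrite /covered_by /corner_edge ifT; lia.
    by rewrite /on_edge ifF; [rewrite p1 -pos0 a (ltW b)|lia].
  have [[? ?]|ne] := pselect (x = 0 /\ y = 0)%BZ.
    subst x y; rewrite /corner_toothpick /seg_points /= => -[H H2].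
    exists 1%BZ, 0%BZ; split=> //.
    suff : pos 0 <= p.1 <= pos 2 /\ p.2 = pos 0 by [].
    rewrite H2 pos0 pos2; split=> //.
    by move: H; rewrite ler_distl => /andP[? ?]; apply/andP; split; lra.
  have S := @cs_supp _ _ F x y.
  rewrite corner_toothpickE // => /toothpick_points; case: ifP => par [] e.
  - exists (2 * x - 1)%BZ, (2 * y)%BZ; split=> //; first lia.
    by rewrite /covered_by (@corner_edge_h _ _ _ (x - 1) y); try lia; case: ifP => ?; [lia|case: ifP => ?; rewrite ?Z.sub_add; lia].
  - exists (2 * x + 1)%BZ, (2 * y)%BZ; split=> //; first lia.
    by rewrite /covered_by (@corner_edge_h _ _ _ x y); try lia; case: ifP => ?; [lia|case: ifP => ?; lia].
  - exists (2 * x)%BZ, (2 * y - 1)%BZ; split=> //; first lia.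
    by rewrite /covered_by (@corner_edge_v _ _ _ x (y - 1)); try lia; case: ifP => ?; [lia|case: ifP => ?; rewrite ?Z.sub_add; lia].
  - exists (2 * x)%BZ, (2 * y + 1)%BZ; split=> //; first lia.
    by rewrite /covered_by (@corner_edge_v _ _ _ x y); try lia; case: ifP => ?; [lia|case: ifP => ?; lia].
move=> [X [Y [/odd_sumP[[x [y [-> ->]]]|[x [y [-> ->]]]]]]]; rewrite /covered_by.
- rewrite (@corner_edge_h _ _ _ x y) //; case: ifP => wall.
    move=> _; rewrite /on_edge ifT; last lia.
    move=> [/andP[_ b] e2].
    have p2 : p.2 = 0 by rewrite e2 -pos0; congr (pos _); lia.
    have : p.1 <= 0 by apply: (le_trans b); rewrite -pos0 pos_le; lia.
    rewrite le_eqVlt => /orP[/eqP p1|p1]; last by left; left.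
    by right; apply: origin_in; move: p1 p2; case: p {b e2} => /= ? ? -> ->.
  have cov u : ((u + y) mod 2 = 0)%BZ -> (0 <= f u y <= n)%BZ -> (u = x \/ u = x + 1)%BZ ->
      on_edge (2 * x + 1) (2 * y) p -> covered (sites f corner_toothpick n) p.
    move=> par c ux e; exists (corner_toothpick u y); first by exists u, y.
    have [[? ?]|ne] := pselect (u = 0 /\ y = 0)%BZ; last first.
      rewrite corner_toothpickE //; apply/toothpick_points; rewrite ifT; last lia.
      by case: ux => ?; [right|left; rewrite (_ : 2 * u - 1 = 2 * x + 1)%BZ]; subst u => //; lia.
    subst u y; have ? : x = 0%BZ by lia. subst x.
    have [+ p2] : pos 0 <= p.1 <= pos 2 /\ p.2 = pos 0 := e.
    rewrite /corner_toothpick /seg_points /= p2 pos0 pos2 ler_distl => /andP[? ?].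
    by split=> //; apply/andP; split; lra.
  by case: ifP => par c e; right; [apply: (cov x)|apply: (cov (x + 1)%BZ)] => //; lia.
- rewrite (@corner_edge_v _ _ _ x y) //; case: ifP => wall.
    move=> _; rewrite /on_edge ifF; last lia.
    move=> [e1 /andP[_ b]].
    have p1 : p.1 = 0 by rewrite e1 -pos0; congr (pos _); lia.
    have : p.2 <= 0 by apply: (le_trans b); rewrite -pos0 pos_le; lia.
    rewrite le_eqVlt => /orP[/eqP p2|p2]; last by left; right.
    by right; apply: origin_in; move: p1 p2; case: p {b e1} => /= ? ? -> ->.
  case: ifP => par c e; right.
    exists (corner_toothpick x (y + 1)); first by exists x, (y + 1)%BZ.
    rewrite corner_toothpickE; last lia.
    apply/toothpick_points; rewrite ifF; last lia.
    by left; rewrite (_ : 2 * (y + 1) - 1 = 2 * y + 1)%BZ //; lia.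
  exists (corner_toothpick x y); first by exists x, y.
  rewrite corner_toothpickE; last lia.
  by apply/toothpick_points; rewrite ifF; [right|lia].
Qed.

Lemma corner_outer n X Y : (X mod 2 = 1)%BZ -> (Y mod 2 = 1)%BZ -> ~ corner_box m X Y ->
  exists dx dy, unit_step dx dy /\ ray_free (covered_by (corner_edge f) n) X Y dx dy.
Proof.
have m2 := cs_m F; rewrite /corner_box /ray_free /covered_by => oX oY out.
have off := cs_off F.
have [?|[?|[?|?]]] : (2 * m < X \/ (X < 2 * (2 - m) \/ (X < 0 /\ Y < 0)) \/ 2 * m < Y \/ Y < 2 * (1 - m))%BZ by lia.
- exists 1%BZ, 0%BZ; split=> // k k0; rewrite (@corner_edge_v _ _ _ (X / 2 + k + 1) (Y / 2)); try lia.
  by rewrite !off; try lia; case_ifs; lia.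
- exists (-1)%BZ, 0%BZ; split=> // k k0; rewrite (@corner_edge_v _ _ _ (X / 2 - k) (Y / 2)); try lia.
  by rewrite !off; try lia; case_ifs; lia.
- exists 0%BZ, 1%BZ; split=> // k k0; rewrite (@corner_edge_h _ _ _ (X / 2) (Y / 2 + k + 1)); try lia.
  by rewrite !off; try lia; case_ifs; lia.
- exists 0%BZ, (-1)%BZ; split=> // k k0; rewrite (@corner_edge_h _ _ _ (X / 2) (Y / 2 - k)); try lia.
  by rewrite !off; try lia; case_ifs; lia.
Qed.
End CornerSites.
End Corner.

(** * Counting the rooms *)

(** The value of [m] at level [k], whose box is complete at stage [2 * scale k], that is
    [2 ^ (k + 2)]. *)
Definition scale (k : nat) : Z := Z.of_nat (2 ^ k.+1)%N.

Lemma scaleS k : scale k.+1 = (2 * scale k)%BZ.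
Proof. by rewrite /scale expnS; lia. Qed.

Lemma scale_ge k : (Z.of_nat k < scale k)%BZ.
Proof. by have := ltn_expl k.+1 (isT : (1 < 2)%N); rewrite /scale; lia. Qed.

Fixpoint corner_time (k : nat) : Z -> Z -> Z :=
  if k is k'.+1 then corner_step (scale k') (corner_time k') else corner_base.

Fixpoint corner_rooms (k : nat) : seq room :=
  if k is k'.+1 then corner_rooms_step (scale k') (corner_rooms k')
  else corner_rooms_base.

Fixpoint tooth_time (k : nat) : Z -> Z -> Z :=
  if k is k'.+1 then tooth_step (scale k') (tooth_time k') (corner_time k')
  else tooth_base.

Fixpoint tooth_rooms (k : nat) : seq room :=
  if k is k'.+1 then tooth_rooms_step (scale k') (tooth_rooms k') (corner_rooms k')
  else tooth_rooms_base.

Lemma corner_sites_time k : corner_sites (scale k) (corner_time k).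
Proof.
elim: k => [|k IH]; first exact: corner_sites_base.
by rewrite scaleS; exact: corner_sites_step.
Qed.

Lemma tooth_sites_time k : tooth_sites (scale k) (tooth_time k).
Proof.
elim: k => [|k IH]; first exact: tooth_sites_base.
by rewrite scaleS; apply: tooth_sites_step => //; exact: corner_sites_time.
Qed.

Lemma corner_tiling k :
  tiling (corner_box (scale k)) (2 * scale k) (corner_edge (corner_time k)) (corner_rooms k).
Proof.
elim: k => [|k IH]; first exact: corner_tiling_base.
by rewrite scaleS; apply: corner_tiling_step => //; exact: corner_sites_time.
Qed.

Lemma tooth_tiling k :
  tiling (tooth_box (scale k)) (2 * scale k) (tooth_edge (tooth_time k)) (tooth_rooms k).
Proof.
elim: k => [|k IH]; first exact: tooth_tiling_base.
rewrite scaleS; apply: tooth_tiling_step => //.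
- exact: tooth_sites_time.
- exact: corner_sites_time.
- exact: corner_tiling.
Qed.

Definition completed (l : seq room) (n : Z) : nat := count (fun rm => time rm =? n)%BZ l.

Lemma completed_cat l1 l2 n : completed (l1 ++ l2) n = (completed l1 n + completed l2 n)%N.
Proof. exact: count_cat. Qed.

Lemma completed_move g s l n : completed (map (move_room g s) l) n = completed l (n - s).
Proof.
rewrite /completed count_map; apply: eq_count => rm /=.
by rewrite move_room_time; lia.
Qed.

Lemma completed_out B N E l n : tiling B N E l -> (n < 2 \/ N < n)%BZ -> completed l n = 0%N.
Proof.
move=> [T _] out; apply/eqP; rewrite -leqn0 leqNgt -has_count; apply/hasPn => rm rml.
by have := tl_proper T rml; lia.
Qed.

Lemma completed_step l n : completed l (n + 1) =
  (count (fun rm => time rm <=? n + 1)%BZ l - count (fun rm => time rm <=? n)%BZ l)%N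
  /\ (count (fun rm => time rm <=? n)%BZ l <= count (fun rm => time rm <=? n + 1)%BZ l)%N.
Proof.
have [n' n1] : exists n', n' = (n + 1)%BZ by eexists.
by rewrite /completed -n1; elim: l => //= rm l; lia.
Qed.

Lemma completed1 rm n : completed [:: rm] n = (time rm =? n)%BZ.
Proof. by rewrite /completed /= addn0. Qed.

(** A and B give the factor 2, C gives the argument ahead by one stage, and the gap rooms C; AC and
    B; AB give the last three summands. *)
Lemma completed_corner k n : completed (corner_rooms k.+1) n =
  (completed (corner_rooms k) n + 2 * completed (corner_rooms k) (n - 2 * scale k)
   + completed (corner_rooms k) (n - 2 * scale k + 1)
   + ((4 * scale k - 2 =? n)%BZ + 2 * (4 * scale k - 1 =? n)%BZ + (4 * scale k =? n)%BZ))%N.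
Proof.
rewrite -[corner_rooms k.+1]/(corner_rooms_step (scale k) (corner_rooms k)) /corner_rooms_step !completed_cat !completed_move !completed1.
rewrite (_ : n - (2 * scale k - 1) = n - 2 * scale k + 1)%BZ; last lia.
rewrite /time /room_C /room_AC /room_B /room_AB; cbn [snd]; lia.
Qed.

Lemma completed_tooth k n : completed (tooth_rooms k.+1) n =
  (completed (tooth_rooms k) n + 4 * completed (corner_rooms k) (n - 2 * scale k)
   + (2 * (4 * scale k - 1 =? n)%BZ + 2 * (4 * scale k =? n)%BZ))%N.
Proof.
rewrite -[tooth_rooms k.+1]/(tooth_rooms_step (scale k) (tooth_rooms k) (corner_rooms k)) /tooth_rooms_step !completed_cat !completed_move !completed1.
rewrite /time /room_up /room_down /room_left /room_right; cbn [snd]; lia.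
Qed.

(** At the last stage only A, B and the room between them contribute, so the count doubles and
    increases by one. *)
Lemma completed_corner_last k : Z.of_nat (completed (corner_rooms k) (2 * scale k)) = (scale k - 1)%BZ.
Proof.
elim: k => [//|k IH]; have k0 := scale_ge k.
rewrite completed_corner scaleS.
rewrite (completed_out (n := 2 * (2 * scale k)) (corner_tiling k)); last lia.
rewrite (_ : 2 * (2 * scale k) - 2 * scale k = 2 * scale k)%BZ; last lia.
rewrite (completed_out (n := 2 * scale k + 1) (corner_tiling k)); last lia.
by move: IH; case: completed => *; lia.
Qed.

(** The four copies contribute [scale k - 1] rooms each, and the upper and lower gap rooms two
    more. *)
Lemma completed_tooth_last k : Z.of_nat (completed (tooth_rooms k) (2 * scale k)) = (2 * scale k - 2)%BZ.
Proof.
case: k => [//|k]; have k0 := scale_ge k.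
rewrite completed_tooth scaleS.
rewrite (completed_out (n := 2 * (2 * scale k)) (tooth_tiling k)); last lia.
rewrite (_ : 2 * (2 * scale k) - 2 * scale k = 2 * scale k)%BZ; last lia.
by have := completed_corner_last k; lia.
Qed.

(** * The recurrences *)

Section Counts.
Variable R : realType.

Lemma corner_regions_grid k n : (Z.of_nat n < 2 * scale k)%BZ -> corner_regions R n =
  internal_regions (grid (R := R) (covered_by (corner_edge (corner_time k)) (Z.of_nat n))).
Proof.
move=> hn; have F := corner_sites_time k.
by rewrite /corner_regions (corner_structure_sites R F hn) (corner_covered R F) //; lia.
Qed.

Lemma toothpick_regions_grid k n : (Z.of_nat n <= 2 * scale k)%BZ -> toothpick_regions R n =
  internal_regions (grid (R := R) (covered_by (tooth_edge (tooth_time k)) (Z.of_nat n))).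
Proof.
move=> hn; have F := tooth_sites_time k.
rewrite -tooth_covered /toothpick_regions; congr (internal_regions (covered _)).
case: n hn => [|n] hn; last by apply: (tooth_structure_sites R F); lia.
apply/seteqP; split=> // t [x [y [fxy _]]].
by have := @ts_supp _ _ F x y; lia.
Qed.

Lemma corner_regions_card k n : (Z.of_nat n < 2 * scale k)%BZ ->
  #|` fset_set (corner_regions R n)| = count (fun rm => time rm <=? Z.of_nat n)%BZ (corner_rooms k).
Proof.
move=> hn; rewrite (corner_regions_grid hn).
by apply: regions_card (corner_tiling k) _ => X Y; exact: corner_outer (corner_sites_time k) _ _ _.
Qed.

Lemma toothpick_regions_card k n : (Z.of_nat n <= 2 * scale k)%BZ ->
  #|` fset_set (toothpick_regions R n)| = count (fun rm => time rm <=? Z.of_nat n)%BZ (tooth_rooms k).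
Proof.
move=> hn; rewrite (toothpick_regions_grid hn).
by apply: regions_card (tooth_tiling k) _ => X Y; exact: tooth_outer (tooth_sites_time k) _ _ _.
Qed.

Lemma rho_completed k n : (Z.of_nat n <= 2 * scale k)%BZ ->
  rho R n = (completed (corner_rooms k) (Z.of_nat n))%:Z.
Proof.
have k0 := scale_ge k; move=> hn.
have lt_case j : (Z.of_nat n < 2 * scale j)%BZ -> rho R n = (completed (corner_rooms j) (Z.of_nat n))%:Z.
  case: n {hn} => [|n] hn.
    rewrite /rho (corner_regions_card hn).
    rewrite (completed_out (n := Z.of_nat 0) (corner_tiling j)); last lia.
    congr Posz; apply/eqP; rewrite -leqn0 leqNgt -has_count; apply/hasPn => rm rml.
    by have := tl_proper (proj1 (corner_tiling j)) rml; lia.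
  rewrite /rho (corner_regions_card hn) (corner_regions_card (k := j)); last lia.
  have -> : Z.of_nat n.+1 = (Z.of_nat n + 1)%BZ by lia.
  by have [-> le] := completed_step (corner_rooms j) (Z.of_nat n); rewrite subzn.
have [lt|e] : (Z.of_nat n < 2 * scale k \/ Z.of_nat n = 2 * scale k)%BZ by lia.
  exact: lt_case.
(* The sites of level [k] describe the structure only before stage [2 * scale k]. At that stage the
   next level is used; its copies and gap rooms close later, so the count is the same. *)
rewrite (lt_case k.+1) ?scaleS; last lia.
rewrite completed_corner; congr Posz.
rewrite (completed_out (n := Z.of_nat n - 2 * scale k) (corner_tiling k)); last lia.
rewrite (completed_out (n := Z.of_nat n - 2 * scale k + 1) (corner_tiling k)); last lia.
by have := corner_sites_time k => /cs_m; lia.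
Qed.

Lemma r_completed k n : (1 <= Z.of_nat n <= 2 * scale k)%BZ ->
  r R n = (completed (tooth_rooms k) (Z.of_nat n))%:Z.
Proof.
case: n => [|n] hn; first lia.
rewrite /r (toothpick_regions_card (k := k)); last lia.
rewrite (toothpick_regions_card (k := k)); last lia.
have -> : Z.of_nat n.+1 = (Z.of_nat n + 1)%BZ by lia.
by have [-> le] := completed_step (tooth_rooms k) (Z.of_nat n); rewrite subzn.
Qed.

Lemma rho_double k i : (1 <= Z.of_nat i < 2 * scale k)%BZ ->
  rho R (2 ^ k.+2 + i) = 2 * rho R i + rho R i.+1 +
    ((Z.of_nat i =? 2 * scale k - 2)%BZ + 2 * (Z.of_nat i =? 2 * scale k - 1)%BZ)%N%:Z.
Proof.
move=> hi; have e2 : Z.of_nat (2 ^ k.+2 + i) = (2 * scale k + Z.of_nat i)%BZ.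
  by rewrite /scale expnS; lia.
rewrite (rho_completed (k := k.+1)); last by rewrite e2 scaleS; lia.
rewrite (rho_completed (k := k) (n := i)); last lia.
rewrite (rho_completed (k := k) (n := i.+1)); last lia.
rewrite completed_corner e2 (completed_out (corner_tiling k)); last lia.
rewrite (_ : 2 * scale k + Z.of_nat i - 2 * scale k = Z.of_nat i)%BZ; last lia.
rewrite (_ : Z.of_nat i + 1 = Z.of_nat i.+1)%BZ; last lia.
by move: (completed _ _) (completed _ _) => c1 c2; lia.
Qed.

Lemma r_double k i : (1 <= Z.of_nat i < 2 * scale k)%BZ ->
  r R (2 ^ k.+2 + i) = 4 * rho R i + (2 * (Z.of_nat i =? 2 * scale k - 1)%BZ)%N%:Z.
Proof.
move=> hi; have e2 : Z.of_nat (2 ^ k.+2 + i) = (2 * scale k + Z.of_nat i)%BZ.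
  by rewrite /scale expnS; lia.
rewrite (r_completed (k := k.+1)); last by rewrite e2 scaleS; lia.
rewrite (rho_completed (k := k) (n := i)); last lia.
rewrite completed_tooth e2 (completed_out (tooth_tiling k)); last lia.
rewrite (_ : 2 * scale k + Z.of_nat i - 2 * scale k = Z.of_nat i)%BZ; last lia.
by move: (completed _ _) => c1; lia.
Qed.

Lemma exp2_int k : 2 ^+ k = (2 ^ k)%N%:Z :> int.
Proof. by rewrite -[RHS]natz natrX. Qed.

Lemma rho_pow k : rho R (2 ^ k.+2) = 2 ^+ k.+1 - 1.
Proof.
have e2 : Z.of_nat (2 ^ k.+2) = (2 * scale k)%BZ by rewrite /scale expnS; lia.
rewrite (rho_completed (k := k)) e2; last lia.
have := completed_corner_last k; rewrite /scale exp2_int; lia.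
Qed.

Lemma r_pow k : r R (2 ^ k.+2) = 2 ^+ k.+2 - 2.
Proof.
have e2 : Z.of_nat (2 ^ k.+2) = (2 * scale k)%BZ by rewrite /scale expnS; lia.
have k0 := scale_ge k.
rewrite (r_completed (k := k)) e2; last lia.
have := completed_tooth_last k; rewrite /scale exp2_int; have := expnS 2 k.+1; lia.
Qed.
End Counts.

Unset Implicit Arguments.

Theorem theorem3 (R : realType) :
  (forall n : nat,
     [/\ finite_set (corner_regions R n),
         finite_set (toothpick_regions R n),
         forall C, corner_regions R n C -> open_rectangle C &
         forall C, toothpick_regions R n C -> open_rectangle C]) /\
  ([/\ rho R 0 = 0, rho R 1 = 0, rho R 2 = 1 & rho R 3 = 2] /\
   forall k : nat, (2 <= k)%N ->
     [/\ rho R (2 ^ k) = 2 ^+ k.-1 - 1,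
         forall i : nat, (1 <= i <= 2 ^ k - 3)%N ->
           rho R (2 ^ k + i) = 2 * rho R i + rho R i.+1,
         forall i : nat, i = (2 ^ k - 2)%N ->
           rho R (2 ^ k + i) = 2 * rho R i + rho R i.+1 + 1 &
         forall i : nat, i = (2 ^ k - 1)%N ->
           rho R (2 ^ k + i) = 2 * rho R i + rho R i.+1 + 2]) /\
  ([/\ r R 0 = 0, r R 1 = 0, r R 2 = 0 & r R 3 = 2] /\
   forall k : nat, (2 <= k)%N ->
     [/\ r R (2 ^ k) = 2 ^+ k - 2,
         forall i : nat, (1 <= i <= 2 ^ k - 2)%N ->
           r R (2 ^ k + i) = 4 * rho R i &
         forall i : nat, i = (2 ^ k - 1)%N ->
           r R (2 ^ k + i) = 4 * rho R i + 2]).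
Proof.
split.
  move=> n.
  have hn : (Z.of_nat n < 2 * scale n)%BZ by have := scale_ge n; lia.
  have Fo := fun X Y => @corner_outer _ _ (corner_sites_time n) (Z.of_nat n) X Y.
  have To := fun X Y => @tooth_outer _ _ (tooth_sites_time n) (Z.of_nat n) X Y.
  rewrite (corner_regions_grid R hn) (@toothpick_regions_grid R n); last lia.
  split.
  - exact: regions_finite (corner_tiling n) Fo.
  - exact: regions_finite (tooth_tiling n) To.
  - exact: regions_rectangle (corner_tiling n) Fo.
  - exact: regions_rectangle (tooth_tiling n) To.
split; split.
- by split; rewrite (@rho_completed R 0).
- case=> [|[|k]] // _.
  have e2 : Z.of_nat (2 ^ k.+2) = (2 * scale k)%BZ by rewrite /scale expnS; lia.
  have k0 := cs_m (corner_sites_time k).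
  split; first exact: rho_pow.
  + by move=> i hi; rewrite rho_double; lia.
  + by move=> i hi; rewrite rho_double; lia.
  + by move=> i hi; rewrite rho_double; lia.
- by split=> //; rewrite (@r_completed R 0).
- case=> [|[|k]] // _.
  have e2 : Z.of_nat (2 ^ k.+2) = (2 * scale k)%BZ by rewrite /scale expnS; lia.
  have k0 := cs_m (corner_sites_time k).
  split; first exact: r_pow.
  + by move=> i hi; rewrite r_double; lia.
  + by move=> i hi; rewrite r_double; lia.
Qed.
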